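(* The following assertion is false: for every $f\in L_2(\mathbb{R}^3)$ the map $t\mapsto B_t f$ is in $L_2(\mathbb{R},\mathrm{BMO}(\mathbb{R}^3))$, and there exists a constant $c$ independent of $f$ such that $$\left(\int_{-\infty}^\infty \|B_t f\|_{\mathrm{BMO}}^2\,dt\right)^{1/2}\le c\,\|f\|_2 \quad\text{for all } f\in L_2(\mathbb{R}^3).$$
   Context: For $f\in L_2(\mathbb{R}^3)$ and $t\in\mathbb{R}$, $B_t f=u(t,\cdot)$, where $u$ is the solution of the wave equation $\partial_t^2u(t,x)=\Delta u(t,x)$, $u(0,x)=0$, $\partial_tu(0,x)=f(x)$, with $t\in\mathbb{R}$, $x\in\mathbb{R}^3$. Equivalently, in terms of the Fourier transform in the space variable, $\hat h(\zeta)=\int_{\mathbb{R}^3} e^{-ix\cdot\zeta}h(x)\,dx$ (extended to $L_2$), one has $\widehat{B_t f}(\zeta)=\dfrac{\sin(t|\zeta|)}{|\zeta|}\hat f(\zeta)$. The Hardy space $H_1(\mathbb{R}^d)$ is the space of $g\in L_1(\mathbb{R}^d)$ such that $Mg\in L_1(\mathbb{R}^d)$, with $\|g\|_{H_1}=\|Mg\|_1$, where $$Mg(x)=\sup_{t>0}\left|\int_{\mathbb{R}^d}\frac{1}{(4\pi t)^{d/2}}\exp\left(-\frac{|y|^2}{4t}\right)g(x-y)\,dy\right|.$$ $\mathrm{BMO}(\mathbb{R}^d)$ is the dual space of $H_1(\mathbb{R}^d)$ with the dual norm (functions modulo constants): it consists of the locally integrable $f$ for which $$\|f\|_{\mathrm{BMO}}=\sup\left\{\left|\int_{\mathbb{R}^d}fg\right|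 : g \text{ bounded with compact support},\ \int_{\mathbb{R}^d} g=0,\ \|g\|_{H_1}\le 1\right\}<\infty$$ (such $g$ are dense in $H_1(\mathbb{R}^d)$). Saying that $t\mapsto B_tf$ is in $L_2(\mathbb{R},\mathrm{BMO}(\mathbb{R}^3))$ means that $B_tf\in\mathrm{BMO}(\mathbb{R}^3)$ for almost every $t$ and $\int_{-\infty}^\infty\|B_tf\|_{\mathrm{BMO}}^2\,dt<\infty$. *)

(* Defs.v *)
From mathcomp Require Import all_boot all_order all_algebra.
From mathcomp Require Import all_classical all_reals all_analysis.
From mathcomp Require Import complex.

Set Implicit Arguments.
Unset Strict Implicit.
Unset Printing Implicit Defensive.

Import Order.TTheory GRing.Theory Num.Theory.
Import numFieldNormedType.Exports.
Import ComplexField.Normc.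

Local Open Scope classical_set_scope.
Local Open Scope ring_scope.
Local Open Scope complex_scope.

Section Euclidean3.
Context {R : realType}.
Implicit Types x y : R * R * R.

Definition dot3 x y : R := x.1.1 * y.1.1 + x.1.2 * y.1.2 + x.2 * y.2.

(* The library norm on a product is the max norm, hence this definition. *)
Definition norm3 x : R := Num.sqrt (dot3 x x).

End Euclidean3.

Definition leb3 {R : realType} :
    {measure set (measurableTypeR R * measurableTypeR R * measurableTypeR R)
      -> \bar R} :=
  ((@lebesgue_measure R \x @lebesgue_measure R) \x @lebesgue_measure R)%E.

(* Elements of function spaces are Borel measurable representatives of their  *)
(* almost-everywhere classes.                                                 *)
Section ComplexFunctions.
Context {R : realType}.
Implicit Types f g h : R * R * R -> R[i].

Definition cmeasurable f : Prop :=
  measurable_fun setT (fun x => complex.Re (f x)) /\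
  measurable_fun setT (fun x => complex.Im (f x)).

(* Meaningful only when f is integrable. *)
Definition cintegral f : R[i] :=
  Rintegral leb3 setT (fun x => complex.Re (f x)) +i*
  Rintegral leb3 setT (fun x => complex.Im (f x)).

Definition Lp_norm (p : \bar R) f : \bar R :=
  Lnorm leb3 p (fun x => (normc (f x))%:E).

Definition Lp (p : \bar R) f : Prop :=
  cmeasurable f /\ (Lp_norm p f < +oo)%E.

Definition loc_integrable f : Prop :=
  cmeasurable f /\
  forall K : set (R * R * R), compact K ->
    (\int[leb3]_(x in K) (normc (f x))%:E < +oo)%E.

Definition cbounded f : Prop := exists M : R, forall x, normc (f x) <= M.

Definition compactly_supported f : Prop :=
  exists2 K : set (R * R * R), compact K & forall x, ~ K x -> f x = 0.

End ComplexFunctions.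

Section Fourier.
Context {R : realType}.
Implicit Types f g h F : R * R * R -> R[i].

Definition expi (a : R) : R[i] := cos a +i* sin a.

(* The integral formula, for h in L1. *)
Definition fourier h (zeta : R * R * R) : R[i] :=
  cintegral (fun x => expi (- dot3 x zeta) * h x).

(* F represents the transform of f in L2: the extension by continuity of the  *)
(* integral formula from the dense subspace of functions in both L1 and L2.   *)
Definition fourierL2 f F : Prop :=
  [/\ Lp 2%:E f, Lp 2%:E F &
      exists h : nat -> R * R * R -> R[i],
        [/\ forall n, Lp 1%:E (h n) /\ Lp 2%:E (h n),
            Lp_norm 2%:E (fun x => h n x - f x) @[n --> \oo] --> 0%E &
            Lp_norm 2%:E (fun z => fourier (h n) z - F z) @[n --> \oo]
              --> 0%E]].

End Fourier.

Section WaveEquation.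
Context {R : realType}.

(* g represents the solution at time t of u_tt = Delta u, u(0) = 0,           *)
(* u_t(0) = f.  The value of the multiplier at z = 0 is irrelevant.           *)
Definition wave_at (t : R) (f g : R * R * R -> R[i]) : Prop :=
  exists F G : R * R * R -> R[i],
    [/\ fourierL2 f F, fourierL2 g G &
        {ae leb3, forall z, G z = (sin (t * norm3 z) / norm3 z)%:C * F z}].

(* u is the map t |-> B_t f; the transform on L2 being injective, each u t is *)
(* unique up to almost-everywhere equality.                                   *)
Definition wave_flow (f : R * R * R -> R[i]) (u : R -> R * R * R -> R[i]) :
    Prop :=
  forall t, wave_at t f (u t).

End WaveEquation.

Section HardyBMO.
Context {R : realType}.
Implicit Types f g : R * R * R -> R[i].

Definition heat_kernel (t : R) (y : R * R * R) : R :=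
  ((4 * pi * t) `^ (3 / 2))^-1 * expR (- (norm3 y ^+ 2 / (4 * t))).

Definition heat_maximal g (x : R * R * R) : \bar R :=
  ereal_sup [set (normc (cintegral
                  (fun y => (heat_kernel t y)%:C * g (x - y))))%:E
            | t in [set t : R | 0 < t]].

Definition hardy_norm g : \bar R := (\int[leb3]_x heat_maximal g x)%E.

Definition bmo_test g : Prop :=
  [/\ cmeasurable g, cbounded g, compactly_supported g,
      cintegral g = 0 & (hardy_norm g <= 1)%E].

(* A seminorm on functions, a norm modulo constants. *)
Definition bmo_norm f : \bar R :=
  ereal_sup [set (normc (cintegral (fun x => f x * g x)))%:E
            | g in bmo_test].

Definition bmo f : Prop := loc_integrable f /\ (bmo_norm f < +oo)%E.

Definition L2_bmo (u : R -> R * R * R -> R[i]) : Prop :=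
  {ae @lebesgue_measure R, forall t, bmo (u t)} /\
  (\int[@lebesgue_measure R]_t (bmo_norm (u t) ^+ 2) < +oo)%E.

End HardyBMO.

(* Main.v *)
(* Superpose N = 256^M spherical pulses of amplitude 1/|x - X_j| on annuli of
   thickness O(1) and radius s_j = T + 256 j around X_j = (256 j, w_j, 0),
   with T of order N.  The j-th pulse focuses at X_j at time s_j.  At that
   time and near X_j, the k-th pulse is a spherical front of radius D = |s_j -
   s_k| around X_k; at distance r it equals (1 - D / r) / 2, that is about
   (w_j - w_k)^2 / (4 D^2), and it vanishes three units further along the
   first axis.  All contributions have the same sign, so that testing against
   the difference of the indicators of two unit-size cubes bounds the BMO norm
   below by a multiple of sum_k (w_j - w_k)^2 / (j - k)^2.  Taking for w a
   lacunary sum of zigzags, which is 1/2-Hoelder but oscillates at each of M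
   scales, makes this sum at least of order M, for a set of times of measure N
   / 2.  On the other hand two of the annuli, around X_j and X_k, meet in
   volume O(T^2 / |j - k|), whence |f|_2^2 = O(N log N) = O(N M).  The
   estimate would give N M^2 = O(N M). *)

Require Import Defs.
From HB Require Import structures.
From mathcomp Require Import all_boot all_order all_algebra.
From mathcomp Require Import all_classical all_reals all_analysis.
From mathcomp Require Import measurable_realfun complex.
From mathcomp Require Import ring lra.
From mathcomp Require Import zify.

Set Implicit Arguments.
Unset Strict Implicit.
Unset Printing Implicit Defensive.

Import Order.TTheory GRing.Theory Num.Theory.
Import numFieldNormedType.Exports.
Import ComplexField.Normc.

Local Open Scope classical_set_scope.
Local Open Scope ring_scope.

(** * Measure-preserving maps *)

(** With w constant, the k-th front would pass exactly through X_j, where r = D and the wave 1 - D /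
    r vanishes; only a transverse gap om = w_j - w_k makes it positive. But r - D is about om^2 / (2
    D) and has to stay inside the front, so om^2 may be at most of order D: within this construction
    1/2 is the largest possible exponent, and it just makes the contributions sum like 1 / |j - k|.
    The sum must be of order M at every j, so w has to oscillate at all scales near every point,
    whence the self-similar form. The scale ratio 256 and the amplitude ratio 16 = sqrt 256 leave
    geometric tails with factor 1/15 around the dominant scale. The spacing 256 keeps D >= 255,
    which controls the expansion of 1 - D / r and leaves room for 15 times the Hoelder constant 16.

    Waves are explicit: for radial data r u solves the one-dimensional wave equation, so a shell has
    a closed solution, which is verified on the Fourier side. Rotations come from shears, and radial
    integration from uniqueness of measures on rays. For BMO a single test function, normalised once
    and then translated, serves all centres and times. *)

Section MeasurePreserving.
Context d (T : measurableType d) (R : realType) (mu : {measure set T -> \bar R}).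

Definition mpres (phi : T -> T) : Prop :=
  measurable_fun setT phi /\
  forall A, measurable A -> mu (phi @^-1` A) = mu A.

Lemma integral_mpres (phi : T -> T) (f : T -> \bar R) :
  mpres phi -> measurable_fun setT f ->
  (\int[mu]_x f (phi x) = \int[mu]_x f x)%E.
Proof.
move=> [mphi pphi].
have ge0 g : measurable_fun setT g -> (forall x, 0 <= g x)%E ->
    (\int[mu]_x g (phi x) = \int[mu]_x g x)%E.
  move=> mg g0; rewrite -[LHS](ge0_integral_pushforward mphi mu measurableT mg)//.
  by apply: eq_measure_integral => A mA _; exact: pphi.
move=> mf; rewrite [LHS]integralE [RHS]integralE.
rewrite -[X in (_ = X - _)%E](ge0 (f^\+)%E); [|exact: measurable_funepos|by []].
rewrite -[X in (_ = _ - X)%E](ge0 (f^\-)%E); [|exact: measurable_funeneg|by []].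
rewrite -[X in X^\+%E]/(f \o phi) -[X in X^\-%E]/(f \o phi) funepos_comp funeneg_comp; reflexivity.
Qed.

Lemma mpres_comp (phi psi : T -> T) :
  mpres phi -> mpres psi -> mpres (phi \o psi).
Proof.
move=> [mphi pphi] [mpsi ppsi]; split; first exact: measurableT_comp.
move=> A mA; rewrite comp_preimage ppsi ?pphi//.
by rewrite -[X in measurable X]setTI; exact: mphi.
Qed.

End MeasurePreserving.

Section MeasurePreservingProduct.
Context d1 d2 (T1 : measurableType d1) (T2 : measurableType d2) (R : realType).
Variables (m1 : {sigma_finite_measure set T1 -> \bar R})
          (m2 : {sigma_finite_measure set T2 -> \bar R}).

(** By Fubini: the section of the preimage over [x] is the preimage of a section under [tau x],
    hence has the same measure. Shears and product maps are instances. *)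
Lemma mpres_skewr (tau : T1 -> T2 -> T2) :
  measurable_fun setT (fun p : T1 * T2 => tau p.1 p.2) ->
  (forall x, mpres m2 (tau x)) ->
  mpres (m1 \x m2)%E (fun p : T1 * T2 => (p.1, tau p.1 p.2)).
Proof.
move=> mtau ptau; split; first exact: measurable_fun_pair.
move=> A mA; rewrite /= /product_measure1 /=; apply: eq_integral => x _ /=.
rewrite -((ptau x).2 _ (measurable_xsection x mA)).
by congr (m2 _); apply/seteqP; split => y; rewrite /xsection /= !inE.
Qed.

Lemma mpres_skewl (tau : T2 -> T1 -> T1) :
  measurable_fun setT (fun p : T1 * T2 => tau p.2 p.1) ->
  (forall y, mpres m1 (tau y)) ->
  mpres (m1 \x m2)%E (fun p : T1 * T2 => (tau p.2 p.1, p.2)).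
Proof.
move=> mtau ptau; split; first exact: measurable_fun_pair.
move=> A mA.
(* The product measure integrates sections over the first factor; uniqueness on rectangles gives the
   opposite order, which suits this map. *)
have E B : measurable B -> (m1 \x m2)%E B = (m1 \x^ m2)%E B.
  move=> mB; apply: product_measure_unique => //= C D mC mD.
  by rewrite product_measure2E.
rewrite [LHS]E; last first.
  by rewrite -[X in measurable X]setTI; apply: measurable_fun_pair.
rewrite [RHS]E//= /product_measure2 /=; apply: eq_integral => y _ /=.
rewrite -((ptau y).2 _ (measurable_ysection y mA)).
by congr (m1 _); apply/seteqP; split => x; rewrite /ysection /= !inE.
Qed.

Lemma mpres_prod (phi : T1 -> T1) (psi : T2 -> T2) :
  mpres m1 phi -> mpres m2 psi ->
  mpres (m1 \x m2)%E (fun p : T1 * T2 => (phi p.1, psi p.2)).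
Proof.
move=> pphi ppsi.
apply: (@mpres_comp _ _ _ _ (fun p => (phi p.1, p.2)) (fun p => (p.1, psi p.2))).
- apply: (@mpres_skewl (fun=> phi)) => //.
  by apply: measurableT_comp => //; exact: pphi.1.
- apply: (@mpres_skewr (fun=> psi)) => //.
  by apply: measurableT_comp => //; exact: ppsi.1.
Qed.

End MeasurePreservingProduct.

(** The pushforward under a name that carries its measure structure, so that uniqueness theorems for
    measures apply to it directly. *)
Definition pushforward_measure d1 d2 (T1 : measurableType d1)
    (T2 : measurableType d2) (R : realType) (m : {measure set T1 -> \bar R})
    (f : T1 -> T2) (mf : measurable_fun setT f) : {measure set T2 -> \bar R} :=
  measure_function_pushforward__canonical__measure_function_Measure m mf.

Lemma pushforward_measureE d1 d2 (T1 : measurableType d1)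
    (T2 : measurableType d2) (R : realType) (m : {measure set T1 -> \bar R})
    (f : T1 -> T2) (mf : measurable_fun setT f) (A : set T2) :
  pushforward_measure m mf A = m (f @^-1` A).
Proof. by []. Qed.

Lemma ge0_integral_pushforward_measure d1 d2 (T1 : measurableType d1)
    (T2 : measurableType d2) (R : realType) (m : {measure set T1 -> \bar R})
    (f : T1 -> T2) (mf : measurable_fun setT f) (v : T2 -> \bar R) :
  measurable_fun setT v -> (forall y, 0 <= v y)%E ->
  (\int[pushforward_measure m mf]_y v y = \int[m]_x v (f x))%E.
Proof.
by move=> mv v0; apply: (ge0_integral_pushforward mf m measurableT mv) => y _.
Qed.

Section Leb2. Context (R : realType).
Local Notation R' := (measurableTypeR R).
Local Notation leb := (@lebesgue_measure R).

(** Plane measure with its own sigma-finite structure: [leb3] becomes a product of two sigma-finite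
    measures, a plane and an axis, to which the skew maps and Fubini apply. *)
Definition leb2 : set (R' * R')%type -> \bar R := (leb \x leb)%E.
HB.instance Definition _ := Measure.on leb2.

Lemma leb2_sigma_finite : sigma_finite setT leb2.
Proof.
have /sigma_finiteP[F [TF ndF Foo]] := sigma_finiteT leb.
exists (fun n => F n `*` F n).
  rewrite -setXTT TF predeqE => -[x y]; split.
    move=> [/= [n _ Fnx] [k _ Gky]]; exists (maxn n k) => //; split.
    - by move: x Fnx; exact/subsetPset/ndF/leq_maxl.
    - by move: y Gky; exact/subsetPset/ndF/leq_maxr.
  by move=> [n _ []/= ? ?]; split; exists n.
move=> k; have [? ?] := Foo k.
split; first exact: measurableX.
by rewrite /leb2 product_measure1E// lte_mul_pinfty// ge0_fin_numE.
Qed.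

HB.instance Definition _ := Measure_isSigmaFinite.Build _ _ _ leb2 leb2_sigma_finite.

Lemma leb3E : leb3 = (leb2 \x leb)%E :> {measure set (R' * R' * R')%type -> \bar R}.
Proof. by []. Qed.
End Leb2.

(** * Invariance of Lebesgue measure under translations, shears and rotations *)

Section LebesgueInvariance.
Context (R : realType).
Local Notation R' := (measurableTypeR R).
Local Notation E3 := (R' * R' * R')%type.
Local Notation leb := (@lebesgue_measure R).

Lemma mpres_leb_translate (a : R) : mpres leb (fun x : R' => x + a : R').
Proof.
have mt : measurable_fun setT (fun x : R' => x + a : R') by exact: measurable_funD.
split=> // A mA.
symmetry; apply: (lebesgue_measure_unique (mu := pushforward_measure leb mt)) => // X /ocitvP[->|[[u v]/= uv ->]].
  by rewrite !measure0.
rewrite /pushforward /= (_ : _ @^-1` _ = `](u - a), (v - a)]%classic).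
  by rewrite !lebesgue_measure_itv/= !lte_fin ltrD2r; case: ifP => // _;
    rewrite -!EFinD opprD addrACA subrr addr0.
by apply/seteqP; split=> x /=; rewrite !in_itv/= ltrBlDr lerBrDr.
Qed.

Lemma mpres_lebN : mpres leb (fun x : R' => - x : R').
Proof.
split; first exact: oppr_measurable.
move=> A mA; rewrite -[RHS]lebesgue_measureN//; congr (leb _).
Qed.

Lemma mpres_leb3_translate (a : E3) : mpres leb3 (fun x : E3 => x + a : E3).
Proof.
have -> : (fun x : E3 => x + a : E3) =
  (fun x : E3 => ((x.1.1 + a.1.1, x.1.2 + a.1.2), x.2 + a.2) : E3) by [].
rewrite leb3E.
apply: (@mpres_prod _ _ (R' * R')%type R' R (@leb2 R) leb
  (fun p : R' * R' => (p.1 + a.1.1, p.2 + a.1.2)) (fun y : R' => y + a.2)).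
- by apply: (@mpres_prod _ _ R' R' R leb leb (fun y : R' => y + a.1.1)
    (fun y : R' => y + a.1.2)); exact: mpres_leb_translate.
- exact: mpres_leb_translate.
Qed.

Lemma mpres_leb3N : mpres leb3 (fun x : E3 => - x : E3).
Proof.
have -> : (fun x : E3 => - x : E3) =
  (fun x : E3 => ((- x.1.1, - x.1.2), - x.2) : E3) by [].
rewrite leb3E.
apply: (@mpres_prod _ _ (R' * R')%type R' R (@leb2 R) leb
  (fun p : R' * R' => (- p.1, - p.2)) (fun y : R' => - y)).
- by apply: (@mpres_prod _ _ R' R' R leb leb (fun y : R' => - y)
    (fun y : R' => - y)); exact: mpres_lebN.
- exact: mpres_lebN.
Qed.

Lemma mpres_shear3 (a b : R) :
  mpres leb3 (fun x : E3 => ((x.1.1, x.1.2), x.2 + (a * x.1.1 + b * x.1.2)) : E3).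
Proof.
have -> : (fun x : E3 => ((x.1.1, x.1.2), x.2 + (a * x.1.1 + b * x.1.2)) : E3) =
  (fun x : E3 => (x.1, x.2 + (a * x.1.1 + b * x.1.2))).
  by apply/funext => -[[? ?] ?].
rewrite leb3E.
apply: (@mpres_skewr _ _ (R' * R')%type R' R (@leb2 R) leb (fun p y => y + (a * p.1 + b * p.2))).
  apply: measurable_funD => //; apply: measurable_funD; apply: measurable_funM => //;
  by apply: measurableT_comp.
by move=> p; exact: mpres_leb_translate.
Qed.

Lemma mpres_shear12 (a b : R) :
  mpres leb3 (fun x : E3 => ((x.1.1 + a * x.2, x.1.2 + b * x.2), x.2) : E3).
Proof.
rewrite leb3E.
apply: (@mpres_skewl _ _ (R' * R')%type R' R (@leb2 R) leb (fun y p => (p.1 + a * y, p.2 + b * y))).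
  apply: measurable_fun_pair; apply: measurable_funD => //;
    solve [by apply: measurable_funM | by apply: measurableT_comp].
by move=> y; apply: (@mpres_prod _ _ R' R' R leb leb (fun z : R' => z + a * y)
    (fun z : R' => z + b * y)); exact: mpres_leb_translate.
Qed.

(* A plane rotation by an angle other than pi is a product of three shears, the outer two with slope tan (theta / 2). *)
Let rot13_shear (c s : R) : c ^+ 2 + s ^+ 2 = 1 -> c != -1 ->
  mpres leb3 (fun x : E3 => ((c * x.1.1 - s * x.2, x.1.2), s * x.1.1 + c * x.2) : E3).
Proof.
move=> cs c1; pose q := s / (1 + c).
have c0 : 1 + c != 0 by rewrite addrC -(opprK 1) subr_eq0.
have -> : (fun x : E3 => ((c * x.1.1 - s * x.2, x.1.2), s * x.1.1 + c * x.2) : E3) =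
  (fun x : E3 => ((x.1.1 + (- q) * x.2, x.1.2 + 0 * x.2), x.2) : E3) \o
  ((fun x : E3 => ((x.1.1, x.1.2), x.2 + (s * x.1.1 + 0 * x.1.2)) : E3) \o
   (fun x : E3 => ((x.1.1 + (- q) * x.2, x.1.2 + 0 * x.2), x.2) : E3)).
  apply/funext => -[[x y] z] /=.
  have qs : q * s = 1 - c.
    have -> : q * s = (s ^+ 2) / (1 + c) by rewrite /q; ring.
    have -> : s ^+ 2 = (1 - c) * (1 + c) by rewrite -[s ^+ 2](addKr (c ^+ 2)) cs; ring.
    by rewrite mulfK.
  have qc : q * (1 + c) = s by rewrite /q divfK.
  congr ((_, _), _); apply/eqP; rewrite -subr_eq0; apply/eqP.
  - transitivity (x * (q * s - (1 - c)) +
      z * ((q * (1 + c) - s) - q * (q * s - (1 - c)))); first by ring.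
    by rewrite qs qc !subrr; ring.
  - by ring.
  - transitivity (z * (q * s - (1 - c))); first by ring.
    by rewrite qs !subrr; ring.
apply: mpres_comp; first exact: mpres_shear12.
apply: mpres_comp; [exact: mpres_shear3|exact: mpres_shear12].
Qed.

Lemma mpres_rot13 (c s : R) : c ^+ 2 + s ^+ 2 = 1 ->
  mpres leb3 (fun x : E3 => ((c * x.1.1 - s * x.2, x.1.2), s * x.1.1 + c * x.2) : E3).
Proof.
have [->|c1] := eqVneq c (-1); last by move=> cs; exact: rot13_shear.
move=> cs; have s0 : s = 0.
  by apply/eqP; rewrite -sqrf_eq0; apply/eqP; lra.
(* The angle pi, excluded so far, is the square of a quarter turn. *)
have r01 : mpres leb3 (fun x : E3 => ((0 * x.1.1 - 1 * x.2, x.1.2), 1 * x.1.1 + 0 * x.2) : E3).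
  by apply: rot13_shear; [ring|rewrite eq_sym oppr_eq0 oner_eq0].
have := mpres_comp r01 r01; congr (mpres _ _); apply/funext => -[[x y] z] /=.
by rewrite s0; congr ((_, _), _); ring.
Qed.

Let swap12 : mpres leb3 (fun x : E3 => ((x.1.2, x.1.1), x.2) : E3).
Proof.
rewrite leb3E.
apply: (@mpres_prod _ _ (R' * R')%type R' R (@leb2 R) leb
  (fun p : R' * R' => (p.2, p.1)) (fun y => y)); last first.
  by split=> //; exact: measurable_id.
split; first exact: measurable_fun_pair.
move=> A mA; pose sw := fun p : R' * R' => (p.2, p.1).
have msw : measurable_fun setT sw by exact: measurable_fun_pair.
symmetry; apply: (product_measure_unique (m' := pushforward_measure (@leb2 R) msw)) => //= U V mU mV.
rewrite /pushforward/=.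
rewrite muleC -(product_measure1E _ _ mV mU); apply: (congr1 (@leb2 R)).
by apply/seteqP; split=> -[x y] /= [].
Qed.

(* Two plane rotations bring any vector to the third axis. *)
Lemma rotate_to_axis (z : E3) : exists rho : E3 -> E3,
  [/\ mpres leb3 rho, forall x, norm3 (rho x) = norm3 x &
      forall x, dot3 (rho x) z = norm3 z * x.2].
Proof.
(* The plane rotation taking [(a, b)] to the second axis; the identity serves when both coordinates
   vanish. *)
have unit (a b : R) : exists c s, c ^+ 2 + s ^+ 2 = 1 /\
    (c * a + s * b = 0 /\ c * b - s * a = Num.sqrt (a ^+ 2 + b ^+ 2)).
  have [ab0|ab0] := eqVneq (a ^+ 2 + b ^+ 2) 0.
    exists 1, 0; move/eqP: ab0; rewrite paddr_eq0 ?sqr_ge0// !expf_eq0/=.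
    by move=> /andP[/eqP -> /eqP ->]; rewrite expr0n/= !addr0 sqrtr0; split; [ring|split; ring].
  have r0 : Num.sqrt (a ^+ 2 + b ^+ 2) != 0.
    by rewrite sqrtr_eq0 -ltNge lt_neqAle eq_sym ab0 addr_ge0 ?sqr_ge0.
  have rr : Num.sqrt (a ^+ 2 + b ^+ 2) ^+ 2 = a ^+ 2 + b ^+ 2.
    by rewrite sqr_sqrtr// addr_ge0 ?sqr_ge0.
  move: (Num.sqrt _) r0 rr => r r0 rr.
  exists (b / r), (- a / r); split; [|split].
  - have -> : (b / r) ^+ 2 + (- a / r) ^+ 2 = (a ^+ 2 + b ^+ 2) / r ^+ 2 by field.
    by rewrite -rr divff// expf_neq0.
  - by field.
  - have -> : b / r * b - - a / r * a = (a ^+ 2 + b ^+ 2) / r by field.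
    by rewrite -rr expr2 mulfK.
pose rot (c s : R) : E3 -> E3 :=
  fun x => ((c * x.1.1 - s * x.2, x.1.2), s * x.1.1 + c * x.2).
pose sw : E3 -> E3 := fun x => ((x.1.2, x.1.1), x.2).
have [c1 [s1 [u1 [a1 b1]]]] := unit z.1.1 z.2.
set r1 := Num.sqrt _ in b1.
have [c2 [s2 [u2 [a2 b2]]]] := unit z.1.2 r1.
exists (rot c1 s1 \o (sw \o rot c2 s2)); split.
- apply: mpres_comp; first exact: mpres_rot13.
  by apply: mpres_comp; [exact: swap12|exact: mpres_rot13].
- have nrot c s x : c ^+ 2 + s ^+ 2 = 1 -> norm3 (rot c s x) = norm3 x.
    move=> cs; congr Num.sqrt; rewrite /dot3 /=.
    transitivity ((c ^+ 2 + s ^+ 2) * (x.1.1 * x.1.1 + x.2 * x.2) + x.1.2 * x.1.2).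
      by ring.
    by rewrite cs; ring.
  move=> x /=; rewrite nrot// -[RHS](nrot c2 s2)//.
  by rewrite /norm3 /dot3 /=; congr Num.sqrt; ring.
- have r1E : r1 ^+ 2 = z.1.1 ^+ 2 + z.2 ^+ 2 by rewrite sqr_sqrtr// addr_ge0 ?sqr_ge0.
  move=> x; rewrite /dot3 /=.
  transitivity (x.1.1 * (c2 * z.1.2 + s2 * (c1 * z.2 - s1 * z.1.1)) +
    x.1.2 * (c1 * z.1.1 + s1 * z.2) + x.2 * (c2 * (c1 * z.2 - s1 * z.1.1) - s2 * z.1.2)).
    by ring.
  rewrite a1 b1 a2 b2 r1E.
  rewrite /norm3 /dot3 !mulr0 !add0r mulrC; congr (Num.sqrt _ * _); ring.
Qed.

End LebesgueInvariance.

(** * Radial integrals *)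

Section IntegralRestriction.
Local Open Scope ereal_scope.
Context d (T : measurableType d) (R : realType) (mu : {measure set T -> \bar R}).
Variables (D : set T) (mD : measurable D).

Import HBNNSimple.

Let integral_nnsfun_fsum (m : {measure set T -> \bar R}) E (h : {nnsfun T >-> R}) :
  measurable E -> \int[m]_(x in E) (h x)%:E =
    \sum_(k \in range h) (k%:E * m (h @^-1` [set k] `&` E)).
Proof.
move=> mE.
under eq_integral do rewrite fimfunE -fsumEFin//.
rewrite ge0_integral_fsum//; last 2 first.
- by move=> y; apply/measurable_EFinP; exact: measurable_funM.
- by move=> y x _; rewrite nnfun_muleindic_ge0.
apply: eq_fsbigr => r _; rewrite integralZl_indic_nnsfun// integral_indic//.
Qed.

(** Both sides agree on simple functions, and monotone convergence extends this. An integral over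
    [D] thus becomes one against a measure, which can be pushed forward. *)
Lemma ge0_integral_mrestr (f : T -> \bar R) : measurable_fun setT f ->
  (forall x, 0 <= f x) ->
  \int[mrestr mu mD]_x f x = \int[mu]_(x in D) f x.
Proof.
move=> mf f0; pose g := nnsfun_approx measurableT mf.
have cg x : (EFin \o g ^~ x) n @[n --> \oo] --> f x.
  by apply: cvg_nnsfun_approx => // y _; exact: f0.
have fE : f = fun x => limn (EFin \o g ^~ x).
  by apply/funext => x; apply/esym/cvg_lim => //.
rewrite fE !monotone_convergence//.
- congr (limn _); apply/funext => n.
  rewrite !integral_nnsfun_fsum//.
  by apply: eq_fsbigr => k _; rewrite setIT.
- by move=> n; apply/measurable_EFinP; exact: measurable_funTS.
- by move=> n x _; rewrite lee_fin.
- by move=> x _ a b ab; rewrite lee_fin; exact/lefP/nd_nnsfun_approx.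
- by move=> n; apply/measurable_EFinP.
- by move=> n x _; rewrite lee_fin.
- by move=> x _ a b ab; rewrite lee_fin; exact/lefP/nd_nnsfun_approx.
Qed.

End IntegralRestriction.

Section OneVariable.
Context (R : realType).
Local Notation R' := (measurableTypeR R).
Local Notation leb := (@lebesgue_measure R).

Lemma integral_is_derive (f F : R -> R) (a b : R) : a <= b ->
  (forall x, is_derive x (1 : R) F (f x)) -> continuous f ->
  (\int[leb]_(x in `[a, b]) (f x)%:E = (F b - F a)%:E)%E.
Proof.
rewrite le_eqVlt => /predU1P[<- _ _|ab dF cf].
  by rewrite set_itv1 integral_set1 subrr.
have cF : continuous F.
  move=> x; apply: differentiable_continuous; apply/derivable1_diffP.
  by have [] := dF x.
rewrite (@continuous_FTC2 _ f F)//.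
- by apply: continuous_subspaceT.
- split=> [x _||]; first by have [] := dF x.
  + by apply: cvg_at_right_filter; exact: cF.
  + by apply: cvg_at_left_filter; exact: cF.
- by move=> x _; rewrite derive1E; have [_ ] := dF x.
Qed.

Lemma leb_itvcc (a b : R) : a <= b -> leb `[a, b]%classic = (b - a)%:E.
Proof.
rewrite lebesgue_measure_itv/= lte_fin le_eqVlt => /predU1P[->|->].
  by rewrite ltxx subrr.
by rewrite EFinB.
Qed.

Lemma leb_scale (l : R) (A : set R') : 0 < l -> measurable A ->
  (l%:E * leb ((fun x : R' => (l * x)%R : R') @^-1` A) = leb A)%E.
Proof.
move=> l0 mA.
have mt : measurable_fun setT (fun x : R' => l * x : R') by exact: measurable_funM.
pose ln : {nonneg R} := NngNum (ltW l0).
symmetry.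
apply: (lebesgue_measure_unique (mu := mscale ln (pushforward_measure leb mt))) => // X /ocitvP[->|[[u v]/= uv ->]].
  by rewrite !measure0.
rewrite /mscale pushforward_measureE (_ : _ @^-1` _ = `](u / l), (v / l)]%classic).
  have uvl : u / l < v / l by rewrite ltr_pM2r ?invr_gt0.
  have E : leb `](u / l), (v / l)] = (v / l - u / l)%:E.
    by rewrite lebesgue_measure_itv/= lte_fin uvl.
  apply: etrans (congr1 (fun y => l%:E * y)%E (esym E)).
  rewrite lebesgue_measure_itv/= lte_fin uv -EFinD -EFinM -mulrBl.
  by rewrite mulrCA divff ?mulr1// gt_eqF.
by apply/seteqP; split=> x /=; rewrite !in_itv/= ltr_pdivrMr// ler_pdivlMr// mulrC.
Qed.

End OneVariable.

(** * The distribution of the distance to the origin on a horizontal plane at height c *)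

Section Cylinder.
Context (R : realType).
Local Notation R' := (measurableTypeR R).
Local Notation leb := (@lebesgue_measure R).
Local Notation leb2 := (@leb2 R).
Local Notation E2 := (R' * R')%type.

Definition sqn2 (p : R * R) : R := p.1 ^+ 2 + p.2 ^+ 2.

Lemma measurable_sqn2 : measurable_fun setT (sqn2 : E2 -> R').
Proof. by apply: measurable_funD; apply: measurable_funX. Qed.

Let disc (s : R) : set E2 := [set p | sqn2 p < s].

Let mdisc s : measurable (disc s).
Proof.
rewrite -[X in measurable X]setTI.
have -> : disc s = sqn2 @^-1` `]-oo, s[ by apply/seteqP; split=> p; rewrite /disc /= in_itv.
by apply: measurable_sqn2.
Qed.

(* Half the density of the radius in a plane, i.e. pi; the value is immaterial here. *)
Definition kappa : R := fine (leb2 (disc 1)).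

Lemma kappa_ge0 : 0 <= kappa.
Proof. by rewrite /kappa fine_ge0. Qed.

Let disc1_fin : leb2 (disc 1) \is a fin_num.
Proof.
rewrite ge0_fin_numE//.
apply: (@le_lt_trans _ _ (leb2 (`[(-1)%R, 1%R] `*` `[(-1)%R, 1%R]))).
  apply: le_measure; rewrite ?inE//; first exact: measurableX.
  move=> [x y]; rewrite /disc /sqn2/= !in_itv/= => xy1.
  have := sqr_ge0 x; have := sqr_ge0 y => y0 x0.
  by split; apply/andP; split; nra.
have -> : leb2 (`[(-1)%R, 1%R] `*` `[(-1)%R, 1%R]) =
  (leb `[(-1)%R, 1%R]%classic * leb `[(-1)%R, 1%R]%classic)%E.
  exact: product_measure1E.
rewrite lebesgue_measure_itv/= lte_fin.
by case: ifP => _; rewrite -?EFinB -?EFinM ltry.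
Qed.

Let leb2_scale (l : R) (A : set E2) : 0 < l -> measurable A ->
  ((l ^+ 2)%:E * leb2 ((fun p : E2 => (l * p.1, l * p.2)%R : E2) @^-1` A) = leb2 A)%E.
Proof.
move=> l0 mA.
have ml : measurable_fun setT (fun x : R' => l * x : R') by exact: measurable_funM.
have mt : measurable_fun setT (fun p : E2 => (l * p.1, l * p.2) : E2).
  by apply: measurable_fun_pair; apply: (measurableT_comp ml).
pose ln : {nonneg R} := NngNum (sqr_ge0 l).
symmetry.
apply: (product_measure_unique (m' := mscale ln (pushforward_measure leb2 mt))) => // U V mU mV.
have mpre (W : set R') : measurable W -> measurable ((fun x : R' => l * x : R') @^-1` W).
  by move=> mW; rewrite -[X in measurable X]setTI; exact: ml.
pose pre W := (fun x : R' => (l * x)%R : R') @^-1` W.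
transitivity ((l ^+ 2)%:E * leb2 (pre U `*` pre V))%E; first by [].
have -> : leb2 (pre U `*` pre V) = (leb (pre U) * leb (pre V))%E.
  by apply: product_measure1E; exact: mpre.
transitivity (l%:E * leb (pre U) * (l%:E * leb (pre V)))%E.
  by rewrite expr2 EFinM muleACA.
by congr (_ * _)%E; exact: leb_scale.
Qed.

Lemma leb2_disc (s : R) : 0 <= s -> leb2 [set p | sqn2 p < s] = (kappa * s)%:E.
Proof.
rewrite le_eqVlt => /predU1P[<-|s0].
  rewrite mulr0 (_ : [set p | _] = set0) ?measure0//.
  by apply/seteqP; split=> // p; rewrite /= /sqn2 ltNge addr_ge0 ?sqr_ge0.
have l0 : 0 < Num.sqrt s by rewrite sqrtr_gt0.
rewrite -[LHS](leb2_scale l0 (mdisc s)) sqr_sqrtr ?ltW// mulrC EFinM.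
congr (_ * _)%E; rewrite /kappa fineK; last exact: disc1_fin.
apply: (congr1 leb2).
apply/seteqP; split=> p; rewrite /disc /sqn2 /= !exprMn sqr_sqrtr ?ltW// -mulrDr.
  by rewrite gtr_pMr.
by move=> ?; rewrite gtr_pMr.
Qed.

Variable c : R.
Let q (p : E2) : R := Num.sqrt (c ^+ 2 + sqn2 p).

Lemma measurable_cyl_radius : measurable_fun setT (q : E2 -> R').
Proof.
apply: (measurableT_comp (continuous_measurable_fun (@sqrt_continuous R))).
by apply: measurable_funD => //; exact: measurable_sqn2.
Qed.

(** The region under the graph of [2 * kappa * r] over []|c|, +oo[]. Its first projection pushes
    plane measure to the measure of density [2 * kappa * r], so that this density is available as a
    measure without further construction. *)
Let U : set E2 := [set x | `|c| < x.1 /\ 0 <= x.2 <= 2 * kappa * x.1].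

Let mU : measurable U.
Proof.
have -> : U = (fst @^-1` `]`|c|, +oo[) `&` ((snd @^-1` `[0, +oo[) `&`
    ((fun x : E2 => 2 * kappa * x.1 - x.2 : R') @^-1` `[0, +oo[)).
  apply/seteqP; split=> -[x y]; rewrite /U /= !in_itv/= !andbT subr_ge0.
    by move=> [-> /andP[-> ->]].
  by move=> [-> [-> ->]].
apply: measurableI; [|apply: measurableI]; rewrite -[X in measurable X]setTI.
- by apply: measurable_fst.
- by apply: measurable_snd.
- by apply: measurable_funB => //; apply: measurable_funM.
Qed.

Let mrU : {measure set E2 -> \bar R} := mrestr leb2 mU.

Let leb2_U (v : R' -> \bar R) : measurable_fun setT v -> (forall r, 0 <= v r)%E ->
  (\int[leb2]_(x in U) v x.1 = \int[leb]_(r in `]`|c|%R, +oo[) ((2 * kappa * r)%:E * v r))%E.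
Proof.
move=> mv v0; rewrite integral_mkcond fubini_tonelli1; last 2 first.
- apply/(measurable_restrictT _ mU); apply: measurable_funTS.
  exact: measurableT_comp.
- by move=> x; rewrite patchE; case: ifP.
rewrite [RHS]integral_mkcond; apply: eq_integral => r _; rewrite /fubini_F /=.
have [rc|rc] := ltP `|c| r.
  have r0 : 0 <= 2 * kappa * r.
    by rewrite mulr_ge0// ?mulr_ge0 ?kappa_ge0// (le_trans _ (ltW rc)).
  transitivity (\int[leb]_(y in `[0%R, (2 * kappa * r)%R]) v r)%E.
    rewrite [RHS]integral_mkcond; apply: eq_integral => y _.
    rewrite !patchE; congr (if _ then _ else _); apply/idP/idP; rewrite !inE /U /= in_itv/=.
      by case.
    by split.
  rewrite patchE ifT; last by rewrite inE/= in_itv/= rc.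
  transitivity (v r * leb `[0%R, (2 * kappa * r)%R]%classic)%E.
    by rewrite integral_cst.
  by rewrite leb_itvcc// subr0 muleC.
rewrite patchE ifF; last by apply/negP; rewrite inE/= in_itv/= ltNge rc.
rewrite integral0_eq// => y _; rewrite patchE ifF//.
by apply/negP; rewrite inE /U/= ltNge rc => -[].
Qed.

Let int_2kappa (a b : R) : a <= b ->
  (\int[leb]_(r in `[a, b]) (2 * kappa * r)%:E = (kappa * (b ^+ 2 - a ^+ 2))%:E)%E.
Proof.
move=> ab.
have D x : is_derive x (1 : R) (fun r : R => kappa * r ^+ 2) (2 * kappa * x).
  by apply: is_derive_eq; rewrite /GRing.scale /=; ring.
rewrite (integral_is_derive ab D) ?mulrBr//.
by move=> x; apply: cvgM; [exact: cvg_cst|exact: cvg_id].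
Qed.

(** For [b > |c|] the left side is the area of a disc of squared radius [b^2 - c^2], namely
    [kappa * (b^2 - c^2)], which is also the integral of the density; for other [b] both sides
    vanish. *)
Let cyl_ray (b : R) : (leb2 (q @^-1` `]-oo, b[%classic) =
  \int[leb]_(r in `]`|c|%R, +oo[)
    ((2 * kappa * r)%:E * (\1_(`]-oo, b[%classic : set R') r)%:E))%E.
Proof.
have nc2 : `|c| ^+ 2 = c ^+ 2 by rewrite real_normK ?num_real.
have [bc|bc] := leP b `|c|.
  rewrite (_ : _ @^-1` _ = set0) ?measure0.
    rewrite integral0_eq// => r; rewrite /= in_itv/= andbT => cr.
    rewrite indicE memNset ?mule0//= in_itv/= => rb.
    by have := lt_trans cr rb; rewrite ltNge bc.
  apply/seteqP; split => // p; rewrite /= in_itv/= ltNge => /negP; apply.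
  apply: (le_trans bc); rewrite -sqrtr_sqr ler_wsqrtr// lerDl.
  by rewrite addr_ge0 ?sqr_ge0.
have b0 : 0 < b by rewrite (le_lt_trans _ bc).
have bc2 : c ^+ 2 <= b ^+ 2.
  by rewrite -nc2 ler_sqr ?nnegrE// ?ltW.
transitivity (kappa * (b ^+ 2 - c ^+ 2))%:E.
  rewrite -leb2_disc ?subr_ge0; last exact: bc2.
  apply: (congr1 leb2).
  have qb p : (q p < b) = (sqn2 p < b ^+ 2 - c ^+ 2).
    rewrite ltrBrDl -[in LHS](ger0_norm (ltW b0)) -sqrtr_sqr ltr_sqrt//.
    exact: exprn_gt0.
  by apply/seteqP; split=> p; rewrite /= in_itv/= qb.
transitivity (\int[leb]_(r in `[`|c|%R, b]) (2 * kappa * r)%:E)%E.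
  by rewrite int_2kappa ?ltW// nc2.
have mk (E : set R') : measurable_fun E (fun r : R' => (2 * kappa * r)%:E).
  by apply/measurable_EFinP; apply: measurable_funM.
transitivity (\int[leb]_(r in `]`|c|%R, b]) (2 * kappa * r)%:E)%E.
  exact: esym (integral_itv_obnd_cbnd (mk _)).
transitivity (\int[leb]_(r in `]`|c|%R, b[) (2 * kappa * r)%:E)%E.
  exact: esym (integral_itv_bndo_bndc (mk _)).
rewrite integral_mkcond [RHS]integral_mkcond; apply: eq_integral => r _.
rewrite !patchE indicE !mem_setE !in_itv/= !andbT.
by case: (`|c| < r); case: (r < b); rewrite ?mule1 ?mule0.
Qed.

(** A measure on the line that is finite on the rays []-oo, n[] is determined by its values on such
    rays. By [cyl_ray] the pushforward of the plane under the radius [q] and that of [U] under the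
    first projection agree there. *)
Lemma integral_cyl_ge0 (v : R' -> \bar R) :
  measurable_fun setT v -> (forall r, 0 <= v r)%E ->
  (\int[leb2]_p v (q p) =
   \int[leb]_(r in `]`|c|%R, +oo[) ((2 * kappa * r)%:E * v r))%E.
Proof.
move=> mv v0; rewrite -leb2_U//.
have mq := measurable_cyl_radius.
have mf : measurable_fun setT (fst : E2 -> R') by [].
have E1 : (\int[mrU]_x v x.1 = \int[leb2]_(x in U) v x.1)%E.
  by apply: ge0_integral_mrestr => //; exact: measurableT_comp.
have E2 := ge0_integral_pushforward_measure mrU mf mv v0.
have E3 := ge0_integral_pushforward_measure leb2 mq mv v0.
rewrite -E1 -E2 -E3 {E1 E2 E3}.
pose Mq := pushforward_measure leb2 mq.
pose Mf := pushforward_measure mrU mf.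
have rays b : Mq `]-oo, b[%classic = Mf `]-oo, b[%classic.
  rewrite /Mq /Mf !pushforward_measureE /mrU /mrestr /=.
  rewrite -[RHS](@integral_indic _ _ _ _ U) //; last first.
    by rewrite -[X in measurable X]setTI; apply: measurable_fst.
  have -> : (\int[leb2]_(x in U) (\1_(fst @^-1` `]-oo, b[%classic) x)%:E =
     \int[leb2]_(x in U) ((\1_(`]-oo, b[%classic : set R') x.1)%:E))%E by [].
  rewrite (leb2_U (v := fun r => (\1_(`]-oo, b[%classic : set R') r)%:E)); last 2 first.
  - by apply/measurable_EFinP; apply: measurable_indic.
  - by move=> r; rewrite lee_fin.
  exact: cyl_ray.
apply: eq_measure_integral => A mA _; rewrite -/Mq -/Mf.
have := @measure_unique _ R R' (@RGenInftyO.G R) (fun n => `]-oo, n%:R[%classic).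
apply; last exact: mA.
- exact: RGenInftyO.measurableE.
- move=> _ _ [x ->] [y ->]; exists (Num.min x y).
  by apply/seteqP; split=> z /=; rewrite !in_itv/= lt_min; [move=> [-> ->]|move=> /andP[]].
- by move=> n; exists n%:R.
- apply/seteqP; split=> // x _.
  exists (Num.truncn `|x|).+1 => //=; rewrite in_itv/=.
  by rewrite (le_lt_trans (ler_norm x))// truncnS_gt.
- by move=> _ [x ->]; exact: rays.
- move=> n; rewrite /Mq pushforward_measureE.
  apply: (@le_lt_trans _ _ (leb2 [set p | sqn2 p < n%:R ^+ 2])).
    apply: le_measure; rewrite ?inE.
    + by rewrite -[X in measurable X]setTI; exact: (measurable_cyl_radius measurableT).
    + exact: mdisc.
    + move=> p; rewrite /= in_itv/= => qn; have q0 : 0 <= q p by exact: sqrtr_ge0.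
      have : q p ^+ 2 < n%:R ^+ 2 by rewrite ltr_pXn2r// nnegrE.
      rewrite sqr_sqrtr; first by apply: le_lt_trans; rewrite lerDr sqr_ge0.
      by rewrite addr_ge0 ?sqr_ge0// /sqn2 addr_ge0 ?sqr_ge0.
  by rewrite leb2_disc ?ltry// sqr_ge0.
Qed.

Lemma integral_cyl (v : R' -> \bar R) : measurable_fun setT v ->
  (\int[leb2]_p v (q p) =
   \int[leb]_(r in `]`|c|%R, +oo[) ((2 * kappa * r)%:E * v r))%E.
Proof.
move=> mv; rewrite [LHS]integralE [RHS]integralE.
rewrite -[X in X^\+%E]/(v \o q) -[X in X^\-%E]/(v \o q) funepos_comp funeneg_comp.
rewrite (integral_cyl_ge0 (v := v^\+%E)) ?(integral_cyl_ge0 (v := v^\-%E))//;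
  [|exact: measurable_funeneg|exact: measurable_funepos].
have w0 r : r \in `]`|c|, +oo[%classic -> (0 <= (2 * kappa * r)%:E)%E.
  rewrite mem_setE in_itv/= andbT lee_fin => cr.
  by rewrite mulr_ge0 ?(le_trans _ (ltW cr))// mulr_ge0// kappa_ge0.
congr (_ - _)%E; apply: eq_integral => r /w0 rw.
  by rewrite !funeposE maxe_pMr// mule0.
by rewrite !funenegE -muleN maxe_pMr// mule0.
Qed.

End Cylinder.

Section Radial.
Context (R : realType).
Local Notation R' := (measurableTypeR R).
Local Notation leb := (@lebesgue_measure R).
Local Notation leb2 := (@leb2 R).
Local Notation E2 := (R' * R')%type.
Local Notation E3 := (R' * R' * R')%type.

Lemma integral_is_derive_itv (f F : R -> R) (x y : bool) (a b : R) : a <= b ->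
  (forall x, is_derive x (1 : R) F (f x)) -> continuous f ->
  (\int[leb]_(r in [set` Interval (BSide x a) (BSide y b)]) (f r)%:E =
   (F b - F a)%:E)%E.
Proof.
move=> ab dF cf.
have mf (D : set R') : measurable_fun D (fun r : R' => (f r)%:E).
  by apply/measurable_EFinP; apply: measurable_funTS; exact: continuous_measurable_fun.
apply: etrans (integral_is_derive ab dF cf).
have E z : (\int[leb]_(r in [set` Interval (BSide z a) (BSide y b)]) (f r)%:E =
   \int[leb]_(r in [set` Interval (BSide z a) (BRight b)]) (f r)%:E)%E.
  by case: y => //; exact: (integral_itv_bndo_bndc (mf _)).
by apply: etrans (E _) _; case: x => //; exact: (integral_itv_obnd_cbnd (mf _)).
Qed.

Lemma norm3_cyl (x : E3) : norm3 x = Num.sqrt (x.2 ^+ 2 + sqn2 x.1).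
Proof. by rewrite /norm3 /dot3 /sqn2; congr Num.sqrt; ring. Qed.

Lemma norm3_ge0 (x : E3) : 0 <= norm3 x.
Proof. exact: sqrtr_ge0. Qed.

Lemma measurable_dot3 (z : E3) : measurable_fun setT (fun x : E3 => dot3 x z : R').
Proof.
apply: measurable_funD; [apply: measurable_funD|]; apply: measurable_funM => //.
- exact: (measurableT_comp measurable_fst measurable_fst).
- exact: (measurableT_comp measurable_snd measurable_fst).
Qed.

Lemma measurable_norm3 : measurable_fun setT (@norm3 R : E3 -> R').
Proof.
apply: (measurableT_comp (continuous_measurable_fun (@sqrt_continuous R))).
have m1 : measurable_fun setT (fun x : E3 => x.1.1 : R').
  exact: (measurableT_comp measurable_fst measurable_fst).
have m2 : measurable_fun setT (fun x : E3 => x.1.2 : R').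
  exact: (measurableT_comp measurable_snd measurable_fst).
by apply: measurable_funD; [apply: measurable_funD|]; apply: measurable_funM.
Qed.

Lemma bounded_box_integrable2 (f : E2 -> R') (B : R) : measurable_fun setT f ->
  (forall p, `|f p| <= B) ->
  (forall p, f p != 0 -> `|p.1| <= B /\ `|p.2| <= B) ->
  leb2.-integrable setT (EFin \o f).
Proof.
move=> mf fB f0; have mI : measurable (`[- B, B]%classic : set R') by exact: measurable_itv.
pose I : set R' := `[- B, B]%classic; pose box : set E2 := I `*` I.
have mbox : measurable box by exact: measurableX.
have fE : EFin \o f = (EFin \o f) \_ box.
  apply/funext => p; rewrite patchE; case: ifPn => //; rewrite notin_setE => nb /=.
  congr EFin; apply/eqP; apply/negPn/negP => /f0 [p1 p2]; apply: nb.
  by split; rewrite /I /= in_itv/= -ler_norml.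
suff H : leb2.-integrable box (EFin \o f).
  by rewrite fE; apply: (integrable_mkcond (EFin \o f) mbox).1.
apply: measurable_bounded_integrable => //.
- apply: (@le_lt_trans _ _ (leb2 box)) => //.
  have -> : leb2 box = (leb I * leb I)%E by exact: product_measure1E.
  rewrite /I lebesgue_measure_itv/=; case: ifP => _; last by rewrite mule0 ltry.
  by rewrite -EFinB -EFinM ltry.
- exact: measurable_funTS.
- exists B; split; first exact: num_real.
  by move=> C BC p _; exact: le_trans (fB p) (ltW BC).
Qed.

(** Bounded measurable functions with bounded support; one constant serves as bound and as radius.
    All data, waves at fixed time and test functions belong to this class, which is integrable and
    closed under sums, multiples and translations. *)
Definition bcs (f : E3 -> R') : Prop :=
  measurable_fun setT f /\
  exists B, forall x, `|f x| <= B /\ (B < norm3 x -> f x = 0).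

Lemma norm3_coord (x : E3) :
  [/\ `|x.1.1| <= norm3 x, `|x.1.2| <= norm3 x & `|x.2| <= norm3 x].
Proof.
by split; rewrite -sqrtr_sqr ler_wsqrtr// /dot3;
  have := (sqr_ge0 x.1.1, sqr_ge0 x.1.2, sqr_ge0 x.2); move=> [[? ?] ?]; nra.
Qed.

Definition box3 (B : R) : set E3 :=
  (`[- B, B]%classic `*` `[- B, B]%classic) `*` `[- B, B]%classic.

Lemma measurable_box3 B : measurable (box3 B).
Proof. by apply: measurableX => //; apply: measurableX. Qed.

Lemma leb3_box3 (B : R) : 0 <= B -> leb3 (box3 B) = ((2 * B) ^+ 3)%:E.
Proof.
move=> B0.
have mI : measurable (`[- B, B]%classic : set R') by exact: measurable_itv.
pose I : set R' := `[- B, B]%classic.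
transitivity (leb2 (I `*` I) * leb I)%E.
  by apply: product_measure1E => //; exact: measurableX.
have -> : leb2 (I `*` I) = (leb I * leb I)%E by exact: product_measure1E.
rewrite /I leb_itvcc; last by lra.
by rewrite -!EFinM; congr EFin; ring.
Qed.

Lemma bcs_integrable f : bcs f -> leb3.-integrable setT (EFin \o f).
Proof.
move=> [mf [B fB]].
have B0 : 0 <= B by have [+ _] := fB ((0, 0), 0); apply: le_trans.
have fE : EFin \o f = (EFin \o f) \_ (box3 B).
  apply/funext => x; rewrite patchE; case: ifPn => //; rewrite notin_setE => nb /=.
  have [_ ->//] := fB x; rewrite ltNge; apply/negP => xB; apply: nb.
  have [x1 x2 x3] := norm3_coord x.
  by split; [split|]; rewrite /= in_itv/= -ler_norml; apply: le_trans xB.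
suff H : leb3.-integrable (box3 B) (EFin \o f).
  by rewrite fE; apply: (integrable_mkcond (EFin \o f) (measurable_box3 B)).1.
apply: measurable_bounded_integrable => //.
- exact: measurable_box3.
- by rewrite leb3_box3// ltry.
- exact: measurable_funTS.
- exists B; split; first exact: num_real.
  by move=> C BC x _; have [+ _] := fB x; move=> /le_trans; apply; exact: ltW.
Qed.

Lemma integral3_cyl_ge0 (h : E2 -> \bar R) : measurable_fun setT h ->
  (forall p, 0 <= h p)%E ->
  (\int[leb3]_x h (x.2, norm3 x) =
   \int[leb]_c \int[leb]_(r in `]`|c|%R, +oo[) ((2 * kappa R * r)%:E * h (c, r)))%E.
Proof.
move=> mh h0; rewrite leb3E fubini_tonelli2; last 2 first.
- apply: measurableT_comp => //; apply: measurable_fun_pair => //.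
  exact: measurable_norm3.
- by move=> x; exact: h0.
apply: eq_integral => c _; rewrite /fubini_G.
rewrite -(integral_cyl_ge0 c (v := fun r => h (c, r)))//; last first.
  exact: measurableT_comp.
by apply: eq_integral => p _; rewrite norm3_cyl.
Qed.

Lemma bcs_norm3 (v : R' -> R') (B : R) : measurable_fun setT v ->
  (forall r, `|v r| <= B) -> (forall r, B < r -> v r = 0) ->
  bcs (fun x : E3 => v (norm3 x)).
Proof.
move=> mv vB v0; split; first exact: (measurableT_comp mv measurable_norm3).
by exists B => x; split => // /v0.
Qed.

Lemma bcsM (f g : E3 -> R') : bcs f -> measurable_fun setT g ->
  (forall x, `|g x| <= 1) -> bcs (fun x => g x * f x).
Proof.
move=> [mf [B fB]] mg g1; split; first exact: measurable_funM.
exists B => x; have [h1 h2] := fB x; split; last by move=> /h2 ->; rewrite mulr0.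
rewrite normrM (le_trans _ h1)// -[leRHS]mul1r ler_wpM2r//.
Qed.

Lemma integral_cos_itv (z r K : R) : 0 < z -> 0 <= r ->
  (\int[leb]_(c in `](- r)%R, r[) (K * cos (z * c))%:E =
   (K * (2 * sin (z * r) / z))%:E)%E.
Proof.
move=> z0 r0; have zn : z != 0 by rewrite gt_eqF.
have D x : is_derive x (1 : R) (fun c : R => K * (z^-1 * sin (z * c))) (K * cos (z * x)).
  by apply: is_derive_eq; rewrite /GRing.scale /= mulr1; congr (K * _); field.
rewrite (@integral_is_derive_itv _ _ false true _ _ _ D).
- by congr EFin; rewrite mulrN sinN; field.
- by lra.
- move=> x; apply: cvgM; first exact: cvg_cst.
  apply: continuous_comp; last exact: continuous_cos.
  by apply: cvgM; [exact: cvg_cst|exact: cvg_id].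
Qed.

Lemma measurable_cos_comp d (T : measurableType d) (g : T -> R') :
  measurable_fun setT g -> measurable_fun setT (fun x => cos (g x) : R').
Proof.
by move=> mg; apply: (measurableT_comp (continuous_measurable_fun (@continuous_cos R)) mg).
Qed.

Lemma measurable_sin_comp d (T : measurableType d) (g : T -> R') :
  measurable_fun setT g -> measurable_fun setT (fun x => sin (g x) : R').
Proof.
by move=> mg; apply: (measurableT_comp (continuous_measurable_fun (@continuous_sin R)) mg).
Qed.

Let ind_lt (p : E2) : R' := \1_([set p : E2 | `|p.1| < p.2]) p.

Let measurable_ind_lt : measurable_fun setT ind_lt.
Proof.
apply: measurable_indic.
have -> : [set p : E2 | `|p.1| < p.2] =
    (fun p : E2 => p.2 - `|p.1| : R') @^-1` `]0, +oo[%classic.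
  by apply/seteqP; split=> p; rewrite /= in_itv/= andbT subr_gt0.
rewrite -[X in measurable X]setTI.
have m1 : measurable_fun setT (fun p : E2 => p.2 - `|p.1| : R').
  by apply: measurable_funB => //; exact: (measurableT_comp _ measurable_fst).
by apply: m1.
Qed.

(** Rotating [z] to the third axis makes the cosine a function of the height alone. In the
    coordinates height and radius, integrating the height over []-r, r[] first gives
    [2 sin (s r) / s]: the transform of a radial function is a one-dimensional sine transform. *)
Lemma integral_cos_radial (v : R' -> R') (B : R) (z : E3) :
  measurable_fun setT v -> (forall r, `|v r| <= B) -> (forall r, B < r -> v r = 0) ->
  0 < norm3 z ->
  (\int[leb3]_x (cos (dot3 x z) * v (norm3 x))%:E =
   \int[leb]_(r in `]0%R, +oo[)
      (4 * kappa R / norm3 z * (r * v r * sin (norm3 z * r)))%:E)%E.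
Proof.
move=> mv vB v0 z0; have B0 : 0 <= B by exact: le_trans (vB 0).
have [rho [mrho nrho drho]] := rotate_to_axis z.
set s := norm3 z in z0 drho *.
pose f (x : E3) := (cos (dot3 x z) * v (norm3 x))%:E.
have mcos : measurable_fun setT (fun x : E3 => cos (dot3 x z) : R').
  exact: measurable_cos_comp (measurable_dot3 z).
have mf : measurable_fun setT f.
  apply/measurable_EFinP; apply: measurable_funM => //.
  exact: (measurableT_comp mv measurable_norm3).
rewrite -[LHS](integral_mpres mrho mf).
pose g (x : E3) : R' := cos (s * x.2) * v (norm3 x).
have -> : (\int[leb3]_x f (rho x) = \int[leb3]_x (EFin \o g) x)%E.
  by apply: eq_integral => x _; rewrite /f /g /= drho nrho.
have mc : measurable_fun setT (fun c : R' => cos (s * c) : R').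
  by apply: measurable_cos_comp; apply: measurable_funM.
have ig : leb3.-integrable setT (EFin \o g).
  apply: bcs_integrable; apply: bcsM; first exact: (@bcs_norm3 _ B).
    by exact: (measurableT_comp mc measurable_snd).
  by move=> x; rewrite ler_norml cos_geN1 cos_le1.
rewrite leb3E -integral21_prod_meas1//.
pose w (p : E2) : R' := ind_lt p * (2 * kappa R * p.2 * v p.2 * cos (s * p.1)).
have -> : (\int[leb]_c fubini_G leb2 (EFin \o g) c =
    \int[leb]_c \int[leb]_r (w (c, r))%:E)%E.
  apply: eq_integral => c _; rewrite /fubini_G.
  pose h (r : R') : R' := cos (s * c) * v r.
  transitivity (\int[leb2]_p (EFin \o h) (Num.sqrt (c ^+ 2 + sqn2 p)))%E.
    by apply: eq_integral => p _; rewrite /g /= norm3_cyl.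
  rewrite (integral_cyl c (v := EFin \o h)); last first.
    by apply/measurable_EFinP; apply: measurable_funM.
  rewrite integral_mkcond; apply: eq_integral => r _.
  rewrite patchE mem_setE in_itv/= andbT /w /ind_lt indicE.
  case: ifPn => cr; first by rewrite mem_set//= mul1r /h -EFinM; congr EFin; ring.
  by rewrite memNset ?mul0r//=; apply/negP.
have mw : measurable_fun setT (fun p : E2 => (w p)%:E).
  apply/measurable_EFinP; apply: measurable_funM => //.
  apply: measurable_funM; last exact: (measurableT_comp mc measurable_fst).
  apply: measurable_funM; last exact: (measurableT_comp mv measurable_snd).
  by apply: measurable_funM.
have iw : leb2.-integrable setT (EFin \o w).
  apply: (@bounded_box_integrable2 _ (Num.max B (2 * kappa R * B * B))).
  - exact/measurable_EFinP.
  - move=> p; rewrite /w /ind_lt indicE.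
    have [lt|] := boolP (p \in _); last by rewrite mul0r normr0 le_max B0.
    move: lt; rewrite inE /= => lt; have p0 : 0 <= p.2 by rewrite (le_trans _ (ltW lt)).
    rewrite mul1r le_max; apply/orP; right.
    rewrite !normrM (ger0_norm (kappa_ge0 R)) (ger0_norm p0) (ger0_norm (ler0n R 2)).
    have [pB|/v0->] := leP p.2 B; last first.
      by rewrite normr0 mulr0 mul0r !mulr_ge0// kappa_ge0.
    rewrite -[leRHS]mulr1 ler_pM// ?mulr_ge0 ?kappa_ge0//; last first.
      by rewrite ler_norml cos_geN1 cos_le1.
    by rewrite ler_pM// ?mulr_ge0 ?kappa_ge0// ler_wpM2l// mulr_ge0// kappa_ge0.
  - move=> p; rewrite /w /ind_lt indicE.
    have [lt|] := boolP (p \in _); last by rewrite mul0r eqxx.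
    have [pB _|/v0->] := leP p.2 B; last by rewrite mulr0 mul0r mulr0 eqxx.
    move: lt; rewrite inE /= => lt; have p0 : 0 <= p.2 by rewrite (le_trans _ (ltW lt)).
    by rewrite (ger0_norm p0) !le_max pB (le_trans (ltW lt) pB).
rewrite (Fubini (m1 := leb) (m2 := leb) iw).
rewrite [RHS]integral_mkcond; apply: eq_integral => r _.
rewrite patchE mem_setE in_itv/= andbT; case: ifPn => [r0|]; last first.
  rewrite -leNgt => r0; rewrite integral0_eq// => c _.
  rewrite /w /ind_lt indicE memNset ?mul0r//= => cr.
  by have := le_lt_trans (normr_ge0 c) cr; rewrite ltNge r0.
transitivity (\int[leb]_(c in `](- r)%R, r[) (2 * kappa R * r * v r * cos (s * c))%:E)%E.
  rewrite [RHS]integral_mkcond; apply: eq_integral => c _.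
  rewrite patchE mem_setE in_itv/= -ltr_norml /w /ind_lt indicE.
  case: ifPn => cr; first by rewrite mem_set//= mul1r.
  by rewrite memNset ?mul0r//=; apply/negP.
by rewrite integral_cos_itv ?ltW//; congr EFin; ring.
Qed.

End Radial.

(** * The integrable weight [(a^2 + |x|^2)^-2] *)

Section Weight.
Context (R : realType).
Local Notation R' := (measurableTypeR R).
Local Notation leb := (@lebesgue_measure R).
Local Notation leb2 := (@leb2 R).
Local Notation E2 := (R' * R')%type.
Local Notation E3 := (R' * R' * R')%type.

Variables (a : R).
Hypothesis a0 : 0 < a.

Let den_gt0 (r : R) : 0 < a ^+ 2 + r ^+ 2.
Proof. by rewrite ltr_pwDl ?sqr_ge0// exprn_gt0. Qed.

Let den_neq0 (r : R) : a ^+ 2 + r ^+ 2 != 0.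
Proof. by rewrite gt_eqF. Qed.

Let continuous_denV : continuous (fun r : R => (a ^+ 2 + r ^+ 2)^-1).
Proof.
move=> x; apply: cvgV => //; apply: cvgD; first exact: cvg_cst.
exact: exprn_continuous.
Qed.

Lemma integral_inner_weight (k c : R) : 0 <= k ->
  (\int[leb]_(r in `]`|c|%R, +oo[) ((2 * k * r)%:E * (((a ^+ 2 + r ^+ 2) ^+ 2)^-1)%:E) =
   (k / (a ^+ 2 + c ^+ 2))%:E)%E.
Proof.
move=> k0; pose f (r : R) := 2 * k * r * ((a ^+ 2 + r ^+ 2) ^+ 2)^-1.
pose F (r : R) := - k * (a ^+ 2 + r ^+ 2)^-1.
have cf : continuous f.
  move=> x; apply: cvgM; first by apply: cvgM; [exact: cvg_cst|exact: cvg_id].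
  rewrite (_ : (fun r => _) = (fun r : R => (a ^+ 2 + r ^+ 2)^-1 * (a ^+ 2 + r ^+ 2)^-1)).
    by rewrite expr2 invfM; apply: cvgM; exact: continuous_denV.
  by apply/funext => r; rewrite expr2 invfM.
have cF : continuous F.
  by move=> x; apply: cvgM; [exact: cvg_cst|exact: continuous_denV].
have dF x : is_derive x (1 : R) F (f x).
  have dd : is_derive x (1 : R) (fun r : R => a ^+ 2 + r ^+ 2) (2 * x).
    by apply: is_derive_eq; rewrite /GRing.scale /=; ring.
  have dv := @is_deriveV R (fun r : R => a ^+ 2 + r ^+ 2) x (2 * x) 1 (den_neq0 x) dd.
  rewrite /F; apply: is_derive_eq; rewrite /GRing.scale /= /f.
  by field; rewrite den_neq0.
under eq_integral do rewrite -EFinM.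
rewrite integral_itv_obnd_cbnd; last first.
  by apply/measurable_EFinP; apply: measurable_funTS; exact: continuous_measurable_fun.
rewrite (@ge0_continuous_FTC2y R f F _ 0).
- by rewrite /F real_normK ?num_real// -EFinB sub0r mulNr opprK.
- move=> r cr; have r0 : 0 <= r by exact: le_trans cr.
  by rewrite /f mulr_ge0 ?invr_ge0 ?sqr_ge0// !mulr_ge0.
- by apply: continuous_subspaceT.
- rewrite -[X in _ --> X](mulr0 (- k)); apply: cvgM; first exact: cvg_cst.
  apply/gtr0_cvgV0; first by near=> x; exact: den_gt0.
  apply: (ger_cvgy _ (@cvgr_expr2 R)).
  by near=> x; rewrite lerDr sqr_ge0.
- by move=> x _; have [] := dF x.
- by apply: cvg_at_right_filter; exact: cF.
- by move=> x _; rewrite derive1E; have [_ ] := dF x.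
Unshelve. all: by end_near. Qed.

Lemma integral_outer_weight (k : R) : 0 <= k ->
  (\int[leb]_c (k / (a ^+ 2 + c ^+ 2))%:E = (k * pi / a)%:E)%E.
Proof.
move=> k0; pose f (c : R) := k / (a ^+ 2 + c ^+ 2).
pose F (c : R) := k / a * atan (c / a).
have an : a != 0 by rewrite gt_eqF.
have cf : continuous f.
  by move=> x; apply: cvgM; [exact: cvg_cst|exact: continuous_denV].
have dF x : is_derive x (1 : R) F (f x).
  rewrite /F; apply: is_derive_eq. rewrite /GRing.scale /= /f.
  by field; rewrite an den_neq0.
have cF : continuous F.
  move=> x; apply: differentiable_continuous; apply/derivable1_diffP.
  by have [] := dF x.
rewrite (ge0_symfun_integralT (f := f))//; last 2 first.
- by move=> x; rewrite divr_ge0// ltW.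
- by move=> x; rewrite /f /= sqrrN.
rewrite -set_itvcy (@ge0_continuous_FTC2y R f F _ (k / a * (pi / 2))).
- by rewrite /F mul0r atan0 mulr0 sube0 -EFinM; congr EFin; field.
- by move=> x _; rewrite divr_ge0// ltW.
- by apply: continuous_subspaceT.
- apply: cvgM; first exact: cvg_cst.
  apply: (@cvg_comp _ _ _ (fun x : R => x / a) (@atan R) _ _ _ _ (@cvgy_atan R)).
  by apply: (@gt0_cvgMly R _ _ a^-1 id); [rewrite invr_gt0|exact: cvg_id].
- by move=> x _; have [] := dF x.
- by apply: cvg_at_right_filter; exact: cF.
- by move=> x _; rewrite derive1E; have [_ ] := dF x.
Qed.

(** Both integrals in height and radius have elementary antiderivatives, a rational function and an
    arctangent. The factor [1 / a] is what later makes the bound on the mass of the heat kernel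
    independent of time; the case [a = 1] dominates transforms and maximal functions. *)
Lemma integral_weight :
  (\int[leb3]_x (((a ^+ 2 + norm3 x ^+ 2) ^+ 2)^-1)%:E = (kappa R * pi / a)%:E)%E.
Proof.
pose h (p : E2) := (((a ^+ 2 + p.2 ^+ 2) ^+ 2)^-1)%:E.
rewrite -[LHS]/(\int[leb3]_x h (x.2, norm3 x))%E integral3_cyl_ge0; last 2 first.
- apply/measurable_EFinP; pose g (r : R') : R' := ((a ^+ 2 + r ^+ 2) ^+ 2)^-1.
  have mg : measurable_fun setT g.
    apply: (@continuous_measurable_fun R g) => x; apply: cvgV; first by rewrite expf_neq0.
    rewrite /= (_ : (fun r => _) = (fun r => (a ^+ 2 + r ^+ 2) * (a ^+ 2 + r ^+ 2))).
      by rewrite expr2; apply: cvgM; (apply: cvgD; [exact: cvg_cst|exact: exprn_continuous]).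
    by apply/funext => r; rewrite expr2.
  exact: (measurableT_comp mg measurable_snd).
- by move=> p; rewrite lee_fin invr_ge0 sqr_ge0.
under eq_integral do rewrite integral_inner_weight ?kappa_ge0//.
by rewrite integral_outer_weight ?kappa_ge0.
Qed.

End Weight.

Section RadialSine.
Context (R : realType).
Local Notation R' := (measurableTypeR R).
Local Notation E3 := (R' * R' * R')%type.

Lemma integral_odd (f : E3 -> R') : bcs f -> (forall x, f (- x) = - f x) ->
  (\int[leb3]_x (f x)%:E = 0)%E.
Proof.
move=> bf fN; have if_ := bcs_integrable bf.
have fin : (\int[leb3]_x (f x)%:E)%E \is a fin_num by exact: (integrable_fin_num _ if_).
have : (\int[leb3]_x (f x)%:E = - \int[leb3]_x (f x)%:E)%E.
  rewrite -{1}(integral_mpres (mpres_leb3N R) (f := EFin \o f)); last first.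
    by apply/measurable_EFinP; exact: bf.1.
  rewrite -mulN1e -(integralZl measurableT if_ (-1)).
  by apply: eq_integral => x _; rewrite /= fN -EFinM mulN1r.
rewrite -(fineK fin) -EFinN => -[e].
by congr EFin; lra.
Qed.

Lemma integral_sin_radial (v : R' -> R') (B : R) (z : E3) :
  measurable_fun setT v -> (forall r, `|v r| <= B) -> (forall r, B < r -> v r = 0) ->
  (\int[leb3]_x (sin (dot3 x z) * v (norm3 x))%:E = 0)%E.
Proof.
move=> mv vB v0; apply: (@integral_odd (fun x => sin (dot3 x z) * v (norm3 x))).
  apply: bcsM; first exact: (@bcs_norm3 _ _ B).
    by apply: measurable_sin_comp; exact: measurable_dot3.
  by move=> x; rewrite ler_norml sin_geN1 sin_le1.
move=> x; have -> : norm3 (- x) = norm3 x.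
  by rewrite /norm3 /dot3 /=; congr Num.sqrt; ring.
have -> : dot3 (- x) z = - dot3 x z by rewrite /dot3 /=; ring.
by rewrite sinN mulNr.
Qed.

End RadialSine.

(** * Fourier transforms and wave flows *)

Section WaveData.
Context (R : realType).
Local Notation R' := (measurableTypeR R).
Local Notation E3 := (R' * R' * R')%type.

Lemma sqr_normc (x : R[i]) : normc x ^+ 2 = complex.Re x ^+ 2 + complex.Im x ^+ 2.
Proof. by case: x => a b /=; rewrite sqr_sqrtr// addr_ge0 ?sqr_ge0. Qed.

Lemma normc_ge0 (x : R[i]) : 0 <= normc x.
Proof. by case: x => a b; exact: sqrtr_ge0. Qed.

Lemma normc_real (a : R) : normc (a%:C)%C = `|a|.
Proof. by rewrite /= expr0n /= addr0 sqrtr_sqr. Qed.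

Lemma Lp_norm2E (g : E3 -> R[i]) :
  Lp_norm 2%:E g = ((\int[leb3]_x (normc (g x) ^+ 2)%:E) `^ 2^-1)%E.
Proof.
rewrite /Lp_norm unlock; congr (_ `^ _)%E; apply: eq_integral => x _.
transitivity (`|normc (g x)| `^ 2)%:E; first by [].
by rewrite ger0_norm ?normc_ge0// powR_mulrn// normc_ge0.
Qed.

Lemma Lp_norm2_lty (g : E3 -> R[i]) :
  (\int[leb3]_x (normc (g x) ^+ 2)%:E < +oo)%E -> (Lp_norm 2%:E g < +oo)%E.
Proof. by move=> g2; rewrite Lp_norm2E; apply: poweR_lty. Qed.

Lemma measurable_normc2 (g : E3 -> R[i]) : cmeasurable g ->
  measurable_fun setT (fun x : E3 => (normc (g x) ^+ 2)%:E).
Proof.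
move=> [mr mi]; apply/measurable_EFinP.
under eq_fun do rewrite sqr_normc.
by apply: measurable_funD; apply: measurable_funX.
Qed.

Lemma measurable_weight (a : R) : 0 < a ->
  measurable_fun setT (fun x : E3 => ((a ^+ 2 + norm3 x ^+ 2) ^+ 2)^-1 : R').
Proof.
move=> a0; pose g (r : R) : R := ((a ^+ 2 + r ^+ 2) ^+ 2)^-1.
have n0 x : a ^+ 2 + x ^+ 2 != 0 by rewrite gt_eqF// ltr_pwDl ?sqr_ge0// exprn_gt0.
have cg : continuous g.
  move=> x; apply: cvgV; first by rewrite expf_neq0.
  rewrite (_ : (fun r => _) = (fun r => (a ^+ 2 + r ^+ 2) * (a ^+ 2 + r ^+ 2))).
    by rewrite expr2; apply: cvgM; (apply: cvgD; [exact: cvg_cst|exact: exprn_continuous]).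
  by apply/funext => r; rewrite expr2.
exact: (measurableT_comp (continuous_measurable_fun cg) (@measurable_norm3 R)).
Qed.

(** The decay of the transform of a shell; its square is dominated by the weight with [a = 1], hence
    integrable in dimension three. *)
Definition decays2 (C : E3 -> R') : Prop :=
  measurable_fun setT C /\
  exists K, forall z, `|C z| <= K * (1 + norm3 z ^+ 2)^-1.

Lemma decays2_Lp2 (C S : E3 -> R') : decays2 C -> decays2 S ->
  Lp 2%:E (fun z => C z +i* S z)%C.
Proof.
move=> [mC [K CK]] [mS [L SL]]; split; first by split.
have mCS : cmeasurable (fun z => C z +i* S z)%C by split.
apply: Lp_norm2_lty.
have KL0 : 0 <= K ^+ 2 + L ^+ 2 by rewrite addr_ge0 ?sqr_ge0.
have mw : measurable_fun setT
    (fun z : E3 => (((1 ^+ 2 + norm3 z ^+ 2) ^+ 2)^-1)%:E : \bar R).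
  by apply/measurable_EFinP; apply: measurable_weight.
apply: (@le_lt_trans _ _ (\int[leb3]_z ((K ^+ 2 + L ^+ 2)%:E *
    (((1 ^+ 2 + norm3 z ^+ 2) ^+ 2)^-1)%:E))%E).
  apply: ge0_le_integral => //.
  - by move=> z _; rewrite lee_fin sqr_ge0.
  - exact: measurable_normc2.
  - exact: measurable_funeM.
  - move=> z _; rewrite -EFinM lee_fin sqr_normc /= expr1n.
    have w0 : 0 <= (1 + norm3 z ^+ 2)^-1 by rewrite invr_ge0 addr_ge0 ?sqr_ge0.
    have bd (a b : R) : `|a| <= b * (1 + norm3 z ^+ 2)^-1 ->
        a ^+ 2 <= b ^+ 2 * ((1 + norm3 z ^+ 2) ^+ 2)^-1.
      by move=> ab; rewrite -exprVn -exprMn -(real_normK (num_real a)) lerXn2r ?nnegrE// (le_trans _ ab).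
    by rewrite mulrDl lerD// bd.
rewrite ge0_integralZl//; last by move=> z _; rewrite lee_fin invr_ge0 sqr_ge0.
by rewrite integral_weight// -EFinM ltry.
Qed.

Lemma bcs_Lp1 (f : E3 -> R') : bcs f -> Lp 1%:E (fun x => (f x)%:C)%C.
Proof.
move=> bf; split; first by split; [exact: bf.1|exact: measurable_cst].
rewrite /Lp_norm Lnorm1; have /integrableP[_] := bcs_integrable bf.
by apply: le_lt_trans; rewrite le_eqVlt; apply/orP; left; apply/eqP;
  apply: eq_integral => x _; rewrite normc_real /= normr_id.
Qed.

Lemma bcs_sqr (f : E3 -> R') : bcs f -> bcs (fun x => f x ^+ 2).
Proof.
move=> [mf [B fB]]; split; first exact: measurable_funX.
have B0 : 0 <= B by have [+ _] := fB 0; apply: le_trans.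
exists (Num.max B (B ^+ 2)) => x; have [h1 h2] := fB x; split.
  by rewrite normrX le_max lerXn2r ?nnegrE ?orbT.
by rewrite gt_max => /andP[/h2 -> _]; rewrite expr0n.
Qed.

Lemma bcs_Lp2 (f : E3 -> R') : bcs f -> Lp 2%:E (fun x => (f x)%:C)%C.
Proof.
move=> bf; split; first by split; [exact: bf.1|exact: measurable_cst].
apply: Lp_norm2_lty.
have /integrableP[_] := bcs_integrable (bcs_sqr bf).
apply: le_lt_trans; rewrite le_eqVlt; apply/orP; left; apply/eqP.
by apply: eq_integral => x _; rewrite normc_real /= real_normK ?num_real// ger0_norm ?sqr_ge0.
Qed.

Lemma measurable_origin : measurable [set (0 : E3)].
Proof.
rewrite (_ : [set (0 : E3)] = box3 0); first exact: measurable_box3.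
apply/seteqP; split=> [x ->|[[x y] z]]; rewrite /box3 /= !in_itv/= ?oppr0 ?lexx//.
by move=> [[]]; rewrite -!eq_le => /eqP <- /eqP <- /eqP <-.
Qed.

Lemma leb3_set0 : leb3 [set (0 : E3)] = 0%E.
Proof.
pose o : E3 := 0.
have H (e : R) : (0 < e)%R -> (leb3 [set o] <= e%:E)%E.
  move=> e0; pose d := Num.min 1 (e / 8); have d0 : 0 < d by rewrite lt_min ltr01 divr_gt0.
  apply: (@le_trans _ _ (leb3 (box3 d))).
    apply: le_measure; rewrite ?inE.
    - exact: measurable_origin.
    - exact: measurable_box3.
    - by move=> x ->; split; [split|]; rewrite /= in_itv/= oppr_le0 ltW.
  rewrite (leb3_box3 (ltW d0)) lee_fin.
  have d1 : d <= 1 by rewrite ge_min lexx.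
  have d8 : d <= e / 8 by rewrite ge_min lexx orbT.
  have d2 : d ^+ 2 <= 1 by apply: exprn_ile1 => //; exact: ltW.
  have : d ^+ 3 <= d by rewrite exprS -[leRHS]mulr1 ler_pM2l.
  by rewrite exprMn; lra.
apply/eqP; rewrite eq_le measure_ge0 andbT.
by apply/lee_addgt0Pr => e e0; rewrite add0e; exact: H.
Qed.

(** For real [f] the Fourier transform is [C - i S]. The origin is left out because the explicit
    formulas divide by [norm3 z]; it is a null set. *)
Definition has_transform (f C S : E3 -> R') : Prop :=
  forall z, z != 0 ->
    (\int[leb3]_x (cos (dot3 x z) * f x)%:E = (C z)%:E)%E /\
    (\int[leb3]_x (sin (dot3 x z) * f x)%:E = (S z)%:E)%E.

Lemma has_transform_fourier f C S (z : E3) : bcs f -> has_transform f C S -> z != 0 ->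
  fourier (fun x => (f x)%:C)%C z = (C z -i* S z)%C.
Proof.
move=> bf H z0; have [hC hS] := H z z0.
rewrite /fourier /cintegral /Rintegral; congr (_ +i* _)%C.
- rewrite -[RHS]/(fine (C z)%:E) -hC; congr fine; apply: eq_integral => x _.
  by rewrite /= mulr0 subr0 cosN.
- transitivity (fine (- (S z)%:E)); last by [].
  have bs : bcs (fun x => sin (dot3 x z) * f x).
    apply: bcsM => //; last by move=> x; rewrite ler_norml sin_geN1 sin_le1.
    by apply: measurable_sin_comp; exact: measurable_dot3.
  rewrite -hS -mulN1e -(integralZl measurableT (bcs_integrable bs) (-1)).
  congr fine; apply: eq_integral => x _.
  by rewrite -EFinM /= mulr0 add0r sinN mulN1r mulNr.
Qed.

(** Since [f] is in both L1 and L2, it is its own approximating sequence. Both differences then have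
    norm 0, the second because the formula can fail only at the origin. *)
Lemma has_transform_fourierL2 f C S : bcs f -> decays2 C -> decays2 S ->
  has_transform f C S ->
  fourierL2 (fun x => (f x)%:C)%C (fun z => C z -i* S z)%C.
Proof.
move=> bf dC dS H.
have dN : decays2 (fun z => - S z).
  have [mS [K SK]] := dS; split; first exact: measurableT_comp.
  by exists K => z; rewrite normrN.
split; [exact: bcs_Lp2|exact: decays2_Lp2|].
exists (fun=> (fun x => (f x)%:C)%C); split.
- by move=> _; split; [exact: bcs_Lp1|exact: bcs_Lp2].
- rewrite (_ : (fun=> _) = fun=> 0%E); first exact: cvg_cst.
  apply/funext => _; rewrite Lp_norm2E integral0_eq ?poweR0r ?invr_neq0//.
  by move=> x _; rewrite subrr /= expr0n/= addr0 sqrtr0 expr0n.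
- rewrite (_ : (fun=> _) = fun=> 0%E); first exact: cvg_cst.
  apply/funext => _; rewrite Lp_norm2E.
  pose D (z : E3) := fourier (fun x => (f x)%:C)%C z - (C z -i* S z)%C.
  pose o : E3 := 0.
  suff -> : (\int[leb3]_z (normc (D z) ^+ 2)%:E = 0)%E by rewrite poweR0r ?invr_neq0.
  transitivity (\int[leb3]_z ((normc (D o) ^+ 2)%:E * (\1_[set o] z)%:E))%E.
    apply: eq_integral => z _; rewrite indicE; have [->|z0] := eqVneq z 0.
      by rewrite mem_set// mule1.
    rewrite memNset ?mule0; last by move=> /= ze; move: z0; rewrite ze eqxx.
    by rewrite /D (has_transform_fourier bf H z0) subrr /= expr0n/= addr0 sqrtr0 expr0n.
  rewrite ge0_integralZl//; last 2 first.
  - by apply/measurable_EFinP; apply: measurable_indic; exact: measurable_origin.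
  - by rewrite lee_fin sqr_ge0.
  by rewrite integral_indic ?setIT ?leb3_set0 ?mule0//; exact: measurable_origin.
Qed.

End WaveData.

(** * Pairs of a datum and an explicit solution *)

Section WavePairs.
Context (R : realType).
Local Notation R' := (measurableTypeR R).
Local Notation E3 := (R' * R' * R')%type.
Implicit Types (f g C S : E3 -> R') (u v : R -> E3 -> R').

Lemma dot3_le (x y : R * R * R) : dot3 x y <= norm3 x * norm3 y.
Proof.
have sq : dot3 x y ^+ 2 <= dot3 x x * dot3 y y.
  rewrite -subr_ge0; have -> : dot3 x x * dot3 y y - dot3 x y ^+ 2 =
    (x.1.1 * y.1.2 - x.1.2 * y.1.1) ^+ 2 + (x.1.1 * y.2 - x.2 * y.1.1) ^+ 2 +
    (x.1.2 * y.2 - x.2 * y.1.2) ^+ 2 by rewrite /dot3; ring.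
  by rewrite !addr_ge0 ?sqr_ge0.
have d0 : 0 <= dot3 x x by rewrite /dot3 !addr_ge0// -expr2 sqr_ge0.
apply: (le_trans (ler_norm _)); rewrite -sqrtr_sqr /norm3 -sqrtrM//.
by rewrite ler_wsqrtr.
Qed.

Lemma norm3_sqr (x : R * R * R) : norm3 x ^+ 2 = dot3 x x.
Proof. by rewrite sqr_sqrtr// /dot3 !addr_ge0// -expr2 sqr_ge0. Qed.

Lemma norm3D (x y : R * R * R) : norm3 (x + y) <= norm3 x + norm3 y.
Proof.
have nn : 0 <= norm3 x + norm3 y by rewrite addr_ge0// norm3_ge0.
rewrite -(ger0_norm nn) -sqrtr_sqr ler_wsqrtr//.
have -> : dot3 (x + y) (x + y) = dot3 x x + dot3 y y + 2 * dot3 x y.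
  by rewrite /dot3 /=; ring.
by rewrite sqrrD !norm3_sqr -mulr_natl; have := dot3_le x y; lra.
Qed.

Lemma norm3N (x : R * R * R) : norm3 (- x) = norm3 x.
Proof. by rewrite /norm3 /dot3 /=; congr Num.sqrt; ring. Qed.

Lemma norm3_gt0 (x : R * R * R) : x != 0 -> 0 < norm3 x.
Proof.
move=> x0; rewrite lt_neqAle norm3_ge0 andbT eq_sym; apply: contra x0 => /eqP n0.
have [h1 h2 h3] := norm3_coord (x : E3); rewrite n0 !normr_le0 in h1 h2 h3.
by case: x h1 h2 h3 {n0} => -[x y] z /= /eqP -> /eqP -> /eqP ->.
Qed.

Lemma normr_sin_le (x : R) : `|sin x| <= `|x|.
Proof.
wlog x0 : x / 0 <= x.
  move=> H; have [/H //|/ltW x0] := leP 0 x.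
  by have := H (- x); rewrite sinN !normrN oppr_ge0; apply.
have [c _] := @MVT_segment R sin cos 0 x x0 (fun y _ => is_derive_sin y)
  (continuous_subspaceT (@continuous_sin R)).
rewrite sin0 !subr0 => ->; rewrite normrM -[leRHS]mul1r ler_wpM2r//.
by rewrite ler_norml cos_geN1 cos_le1.
Qed.

Lemma bcs0 : bcs (fun=> 0 : R').
Proof. by split; [exact: measurable_cst|exists 0 => x; rewrite normr0]. Qed.

Lemma bcsD f g : bcs f -> bcs g -> bcs (fun x => f x + g x).
Proof.
move=> [mf [B fB]] [mg [D gD]]; split; first exact: measurable_funD.
have B0 : 0 <= B by have [+ _] := fB 0; apply: le_trans.
have D0 : 0 <= D by have [+ _] := gD 0; apply: le_trans.
exists (B + D) => x; have [h1 h2] := fB x; have [h3 h4] := gD x; split.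
  by rewrite (le_trans (ler_normD _ _))// lerD.
by move=> BD; rewrite h2 ?h4 ?addr0//; lra.
Qed.

Lemma bcsZ k f : bcs f -> bcs (fun x => k * f x).
Proof.
move=> [mf [B fB]]; split; first exact: measurable_funM.
exists (Num.max B (`|k| * B)) => x; have [h1 h2] := fB x; split.
  by rewrite le_max normrM ler_wpM2l ?orbT.
by rewrite gt_max => /andP[/h2 -> _]; rewrite mulr0.
Qed.

Lemma bcs_shift (a : E3) f : bcs f -> bcs (fun x => f (x - a)).
Proof.
move=> [mf [B fB]]; split.
  by apply: (measurableT_comp mf); have [] := mpres_leb3_translate (- a).
exists (B + norm3 a) => x; have [h1 h2] := fB (x - a); split.
  by rewrite (le_trans h1)// lerDl norm3_ge0.
move=> Ba; apply: h2; rewrite -(ltrD2r (norm3 a)) (lt_le_trans Ba)//.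
by rewrite -{1}(subrK a x); exact: norm3D.
Qed.

Lemma decays2D C S : decays2 C -> decays2 S -> decays2 (fun z => C z + S z).
Proof.
move=> [mC [K CK]] [mS [L SL]]; split; first exact: measurable_funD.
by exists (K + L) => z; rewrite (le_trans (ler_normD _ _))// mulrDl lerD.
Qed.

Lemma decays2M C (m : E3 -> R') (B : R) : decays2 C -> measurable_fun setT m ->
  (forall z, `|m z| <= B) -> decays2 (fun z => m z * C z).
Proof.
move=> [mC [K CK]] mm mB; split; first exact: measurable_funM.
by exists (B * K) => z; rewrite normrM -mulrA ler_pM.
Qed.

Lemma transform_integrable (h : E3 -> R') f : measurable_fun setT h ->
  (forall x, `|h x| <= 1) -> bcs f ->
  leb3.-integrable setT (fun x => (h x * f x)%:E).
Proof. by move=> mh h1 bf; exact: (bcs_integrable (bcsM bf mh h1)). Qed.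

Let mcos (z : E3) : measurable_fun setT (fun x : E3 => cos (dot3 x z) : R').
Proof. by apply: measurable_cos_comp; exact: measurable_dot3. Qed.

Let msin (z : E3) : measurable_fun setT (fun x : E3 => sin (dot3 x z) : R').
Proof. by apply: measurable_sin_comp; exact: measurable_dot3. Qed.

Let cos1 (z x : E3) : `|cos (dot3 x z)| <= 1.
Proof. by rewrite ler_norml cos_geN1 cos_le1. Qed.

Let sin1 (z x : E3) : `|sin (dot3 x z)| <= 1.
Proof. by rewrite ler_norml sin_geN1 sin_le1. Qed.

Lemma has_transformD f g C S C' S' : bcs f -> bcs g ->
  has_transform f C S -> has_transform g C' S' ->
  has_transform (fun x => f x + g x) (fun z => C z + C' z) (fun z => S z + S' z).
Proof.
move=> bf bg Hf Hg z z0; have [fc fs] := Hf z z0; have [gc gs] := Hg z z0.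
split; under eq_integral do rewrite mulrDr EFinD.
  by rewrite integralD//= ?fc ?gc//; exact: transform_integrable.
by rewrite integralD//= ?fs ?gs//; exact: transform_integrable.
Qed.

Lemma has_transformZ k f C S : bcs f -> has_transform f C S ->
  has_transform (fun x => k * f x) (fun z => k * C z) (fun z => k * S z).
Proof.
move=> bf Hf z z0; have [fc fs] := Hf z z0.
split; under eq_integral do rewrite mulrCA EFinM.
  by rewrite integralZl//= ?fc//; exact: transform_integrable.
by rewrite integralZl//= ?fs//; exact: transform_integrable.
Qed.

(** Translation multiplies the transform [C - i S] by [exp (-i a.z)]; these are the resulting real
    part and the opposite of the imaginary part. *)
Lemma has_transform_shift (a : E3) f C S : bcs f -> has_transform f C S ->
  has_transform (fun x => f (x - a))
    (fun z => cos (dot3 a z) * C z + (- sin (dot3 a z)) * S z)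
    (fun z => cos (dot3 a z) * S z + sin (dot3 a z) * C z).
Proof.
move=> bf Hf z z0; have [fc fs] := Hf z z0.
have ic := transform_integrable (mcos z) (cos1 z) bf.
have is_ := transform_integrable (msin z) (sin1 z) bf.
have ma := mpres_leb3_translate a.
have shift (h : R -> R') : measurable_fun setT (fun x : E3 => h (dot3 x z)) ->
    (\int[leb3]_x (h (dot3 x z) * f (x - a))%:E =
     \int[leb3]_x (h (dot3 x z + dot3 a z) * f x)%:E)%E.
  move=> mh; rewrite -(integral_mpres ma); last first.
    apply/measurable_EFinP; apply: measurable_funM => //.
    by have [] := bcs_shift a bf.
  apply: eq_integral => x _; rewrite addrK; congr ((h _ * _)%:E).
  by rewrite /dot3 /=; ring.
split; rewrite shift//.
  under eq_integral do rewrite cosD mulrBl ![_ * _ * f _]mulrAC [cos _ * _ * _]mulrC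
    [sin _ * _ * _]mulrC -mulNr EFinD !EFinM.
  rewrite integralD//=; [|exact: integrableZl|exact: integrableZl].
  by rewrite !integralZl// fc fs.
under eq_integral do rewrite sinD mulrDl ![_ * _ * f _]mulrAC [sin _ * _ * _]mulrC
    [cos _ * _ * _]mulrC EFinD !EFinM.
rewrite integralD//=; [|exact: integrableZl|exact: integrableZl].
by rewrite !integralZl// fc fs.
Qed.

Definition wave_mult (t : R) (z : E3) : R' := sin (t * norm3 z) / norm3 z.

Lemma wave_mult_le t z : `|wave_mult t z| <= `|t|.
Proof.
rewrite /wave_mult; have [->|n0] := eqVneq (norm3 z) 0.
  by rewrite invr0 mulr0 normr0.
rewrite normrM normfV ler_pdivrMr ?normr_gt0//.
by rewrite -normrM normr_sin_le.
Qed.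

Lemma measurable_wave_mult t : measurable_fun setT (wave_mult t).
Proof.
apply: measurable_funM; last first.
  rewrite (_ : (fun z : E3 => (norm3 z)^-1) = fun z : E3 => norm3 z `^ (-1)).
    exact: (measurableT_comp (measurable_powR (-1)) (@measurable_norm3 R)).
  by apply/funext => z; rewrite powR_inv1// norm3_ge0.
apply: measurable_sin_comp; apply: measurable_funM => //.
exact: measurable_norm3.
Qed.

(** The solution is certified through its transforms. Closure under sums, multiples and translations
    carries an explicit solution for one shell over to the whole superposition. *)
Definition wave_pair f u : Prop := exists C S,
  [/\ bcs f /\ forall t, bcs (u t), decays2 C /\ decays2 S, has_transform f C S &
      forall t, has_transform (u t) (fun z => wave_mult t z * C z)
                                    (fun z => wave_mult t z * S z)].

Lemma wave_pair_flow f u : wave_pair f u ->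
  wave_flow (fun x => (f x)%:C)%C (fun t x => (u t x)%:C)%C.
Proof.
move=> [C [S [[bf bu] [dC dS] Hf Hu]]] t.
exists (fun z => C z -i* S z)%C,
  (fun z => (wave_mult t z * C z) -i* (wave_mult t z * S z))%C; split.
- exact: has_transform_fourierL2.
- apply: has_transform_fourierL2 => //;
  apply: (decays2M _ (measurable_wave_mult t) (wave_mult_le t)) => //.
- apply: aeW => z; rewrite /wave_mult.
  by apply/eqP; rewrite eq_complex /=; apply/andP; split; apply/eqP; ring.
Qed.

Lemma wave_pair0 : wave_pair (fun=> 0) (fun _ _ => 0).
Proof.
exists (fun=> 0), (fun=> 0).
have d0 : decays2 (fun=> 0 : R').
  by split; [exact: measurable_cst|exists 0 => z; rewrite normr0 mul0r].
have h0 (m : E3 -> R') : has_transform (fun=> 0) (fun z => m z * 0) (fun z => m z * 0).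
  by move=> z _; rewrite mulr0; split; rewrite integral0_eq// => x _; rewrite mulr0.
split=> //; first by split => [|_]; exact: bcs0.
have := h0 (fun=> 0); congr has_transform; apply/funext => z; exact: mulr0.
Qed.

Lemma wave_pairD f g u v : wave_pair f u -> wave_pair g v ->
  wave_pair (fun x => f x + g x) (fun t x => u t x + v t x).
Proof.
move=> [C [S [[bf bu] [dC dS] Hf Hu]]] [C' [S' [[bg bv] [dC' dS'] Hg Hv]]].
exists (fun z => C z + C' z), (fun z => S z + S' z); split.
- by split=> [|t]; apply: bcsD.
- by split; exact: decays2D.
- exact: has_transformD.
- move=> t; have := has_transformD (bu t) (bv t) (Hu t) (Hv t).
  by congr has_transform; apply/funext => z; rewrite mulrDr.
Qed.

Lemma wave_pairZ k f u : wave_pair f u ->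
  wave_pair (fun x => k * f x) (fun t x => k * u t x).
Proof.
move=> [C [S [[bf bu] [dC dS] Hf Hu]]].
have mk : measurable_fun setT (fun _ : E3 => k : R') by exact: measurable_cst.
exists (fun z => k * C z), (fun z => k * S z); split.
- by split=> [|t]; apply: bcsZ.
- by split; apply: (decays2M _ mk (B := `|k|)).
- exact: has_transformZ.
- move=> t; have := has_transformZ k (bu t) (Hu t).
  by congr has_transform; apply/funext => z; rewrite mulrCA.
Qed.

Lemma wave_pair_shift a f u : wave_pair f u ->
  wave_pair (fun x => f (x - a)) (fun t x => u t (x - a)).
Proof.
move=> [C [S [[bf bu] [dC dS] Hf Hu]]].
have mdot : measurable_fun setT (fun z : E3 => dot3 a z : R').
  rewrite (_ : (fun z : E3 => dot3 a z : R') = fun z => dot3 z a); first exact: measurable_dot3.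
  by apply/funext => z; rewrite /dot3; ring.
have mca : measurable_fun setT (fun z : E3 => cos (dot3 a z) : R') by exact: measurable_cos_comp.
have msa : measurable_fun setT (fun z : E3 => sin (dot3 a z) : R') by exact: measurable_sin_comp.
have msaN : measurable_fun setT (fun z : E3 => - sin (dot3 a z) : R') by exact: measurableT_comp.
have c1 z : `|cos (dot3 a z)| <= 1 by exact: cos1.
have s1 z : `|sin (dot3 a z)| <= 1 by exact: sin1.
have sN1 z : `|- sin (dot3 a z)| <= 1 by rewrite normrN.
exists (fun z => cos (dot3 a z) * C z + (- sin (dot3 a z)) * S z),
  (fun z => cos (dot3 a z) * S z + sin (dot3 a z) * C z); split.
- by split=> [|t]; exact: bcs_shift.
- split; apply: decays2D.
  + exact: (decays2M dC mca c1).
  + exact: (decays2M dS msaN sN1).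
  + exact: (decays2M dS mca c1).
  + exact: (decays2M dC msa s1).
- exact: has_transform_shift.
- move=> t; have := has_transform_shift a (bu t) (Hu t).
  by congr has_transform; apply/funext => z; ring.
Qed.

Lemma wave_pair_sum (I : Type) (r : seq I) (f : I -> E3 -> R') (u : I -> R -> E3 -> R') :
  (forall i, wave_pair (f i) (u i)) ->
  wave_pair (fun x => \sum_(i <- r) f i x) (fun t x => \sum_(i <- r) u i t x).
Proof.
move=> H; elim: r => [|i r IH].
  have := wave_pair0; congr wave_pair; first by apply/funext => x; rewrite big_nil.
  by apply/funext => t; apply/funext => x; rewrite big_nil.
have := wave_pairD (H i) IH.
congr wave_pair; first by apply/funext => x; rewrite big_cons.
by apply/funext => t; apply/funext => x; rewrite big_cons.
Qed.

End WavePairs.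

(** * Waves with shell data *)

Section Shell.
Context (R : realType).
Local Notation R' := (measurableTypeR R).
Local Notation leb := (@lebesgue_measure R).
Local Notation leb2 := (@leb2 R).
Local Notation E2 := (R' * R')%type.
Local Notation E3 := (R' * R' * R')%type.

Variables a b : R.
Hypotheses (a0 : 0 < a) (ab : a <= b).

(** A primitive of the indicator of [[a, b]]: for [p <= q], [clamp q - clamp p] is the length of the
    part of [[p, q]] inside [[a, b]]. *)
Definition clamp (x : R) : R := Num.min b (Num.max a x).

(** Chosen so that [r * shell r] is an indicator for [r > 0]: this is the initial velocity of the
    one-dimensional wave [r u]. *)
Definition shell (r : R) : R := \1_(`]a, b[%classic : set R) r / r.

(* d'Alembert's formula for [r * u]: half the measure of ]a, b[ inside [|r -
   |t||, r + |t|], with junk value 0 at [r = 0]. *)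
Definition ushell (t r : R) : R :=
  Num.sg t * (clamp (r + `|t|) - clamp `|r - `|t| |) / (2 * r).

Lemma clampE p q : p <= q ->
  clamp q - clamp p = Num.max 0 (Num.min b q - Num.max a p).
Proof.
move=> pq; rewrite /clamp.
by case: (leP a q) => ?; case: (leP a p) => ?; repeat (case: (leP b) => ?);
  case: leP => ?; lra.
Qed.

Lemma clamp_le p q : p <= q -> 0 <= clamp q - clamp p <= q - p.
Proof.
move=> pq; rewrite clampE// le_max lexx/= ge_max subr_ge0 pq/=.
by rewrite lerB// ?ge_min ?lexx ?orbT// le_max lexx orbT.
Qed.

Lemma clamp_ge x : b <= x -> clamp x = b.
Proof. by move=> bx; rewrite /clamp; apply/min_idPl; rewrite le_max bx orbT. Qed.

Lemma measurable_clamp : measurable_fun setT (clamp : R' -> R').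
Proof.
apply: (measurable_minr (measurable_cst _)).
exact: (measurable_maxr (measurable_cst _)).
Qed.

Lemma measurable_inverse : measurable_fun setT (fun r : R' => r^-1 : R').
Proof.
rewrite (_ : (fun r : R' => r^-1 : R') = fun r : R' => r * (r ^+ 2) `^ (-1)).
  apply: measurable_funM => //.
  have mp := @measurable_powR R (-1); apply: (measurableT_comp mp).
  exact: measurable_funX.
apply/funext => r; rewrite powR_inv1 ?sqr_ge0//.
have [->|r0] := eqVneq r 0; first by rewrite invr0 mul0r.
by rewrite expr2 invfM mulrA mulfV ?mul1r.
Qed.

Lemma clamp_lip x y : `|clamp x - clamp y| <= `|x - y|.
Proof.
wlog xy : x y / y <= x.
  by move=> H; have [/H //|/ltW/H] := leP y x; rewrite distrC [leRHS]distrC.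
by have /andP[c0 c1] := clamp_le xy; rewrite !ger0_norm// subr_ge0.
Qed.

Lemma measurable_shell : measurable_fun setT (shell : R' -> R').
Proof.
by apply: measurable_funM; [exact: measurable_indic|exact: measurable_inverse].
Qed.

Lemma measurable_ushell t : measurable_fun setT (ushell t : R' -> R').
Proof.
apply: measurable_funM; last first.
  by apply: (measurableT_comp measurable_inverse); exact: measurable_funM.
apply: measurable_funM => //; apply: measurable_funB;
  apply: (measurableT_comp measurable_clamp); first exact: measurable_funD.
by apply: (measurableT_comp _ (measurable_funB _ _)).
Qed.

Lemma shell_le r : `|shell r| <= Num.max a^-1 b.
Proof.
rewrite /shell indicE; have [|] := boolP (r \in _).
  rewrite inE/= in_itv/= => /andP[ar _]; have r0 := lt_trans a0 ar.
  by rewrite mul1r normfV gtr0_norm// le_max lef_pV2 ?posrE// (ltW ar).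
by rewrite mul0r normr0 le_max invr_ge0 (ltW a0).
Qed.

Lemma shell_out r : Num.max a^-1 b < r -> shell r = 0.
Proof.
rewrite gt_max => /andP[_ br]; rewrite /shell indicE memNset ?mul0r//=.
by rewrite in_itv/= => /andP[_ rb]; have := lt_trans rb br; rewrite ltxx.
Qed.

(** [clamp] is 1-Lipschitz and its two arguments differ by at most [2 |r|], which compensates the
    division by [2 r] up to the origin. *)
Lemma ushell_le1 t r : `|ushell t r| <= 1.
Proof.
have [->|r0] := eqVneq r 0; first by rewrite /ushell mulr0 invr0 mulr0 normr0.
have r2 : 0 < `|2 * r| by rewrite normr_gt0 mulf_neq0.
rewrite /ushell !normrM normfV ler_pdivrMr// mul1r.
have s1 : `|Num.sg t| <= 1 by rewrite normr_sg; case: (t != 0).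
apply: (le_trans (ler_pM _ _ s1 (clamp_lip _ _))) => //; rewrite mul1r.
have T0 := normr_ge0 t; move: (`|t|) T0 => T T0.
rewrite normrM (ger0_norm (ler0n R 2)) ler_norml.
by case: (ler0P (r - T)) => ?; case: (ler0P r) => ?; apply/andP; split; lra.
Qed.

Lemma ushell_out t r : Num.max 1 (b + `|t|) < r -> ushell t r = 0.
Proof.
rewrite gt_max => /andP[_ bt]; rewrite /ushell !clamp_ge ?subrr ?mulr0 ?mul0r//.
  by rewrite (le_trans _ (ler_norm _))//; lra.
by have := normr_ge0 t; lra.
Qed.

Lemma bcs_shell : bcs (fun x : E3 => shell (norm3 x)).
Proof. exact: (bcs_norm3 measurable_shell shell_le shell_out). Qed.

Lemma bcs_ushell t : bcs (fun x : E3 => ushell t (norm3 x)).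
Proof.
apply: (bcs_norm3 (measurable_ushell t) _ (ushell_out (t := t))) => r.
by rewrite le_max ushell_le1.
Qed.

Lemma continuous_sinM (z : R) : continuous (fun r : R => sin (z * r)).
Proof.
move=> x; apply: continuous_comp; last exact: continuous_sin.
by apply: cvgM; [exact: cvg_cst|exact: cvg_id].
Qed.

Lemma integral_sin_itv (K z p q : R) : z != 0 -> p <= q ->
  (\int[leb]_(r in `]p, q[) (K * sin (z * r))%:E =
   (K * ((cos (z * p) - cos (z * q)) / z))%:E)%E.
Proof.
move=> z0 pq.
have D x : is_derive x (1 : R) (fun r : R => - K * (z^-1 * cos (z * r))) (K * sin (z * x)).
  by apply: is_derive_eq; rewrite /GRing.scale /= mulr1; field.
rewrite (@integral_is_derive_itv _ _ _ false true _ _ pq D).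
  by congr EFin; field.
by move=> x; apply: cvgM; [exact: cvg_cst|exact: continuous_sinM].
Qed.

(** The numbers [p.1], [p.2] and [T] are the sides of a nondegenerate triangle, with [p.2] in []a,
    b[]. The triangle inequalities are symmetric in the two variables, so that the sections are
    intervals of the same form in either order of integration. *)
Let triangle (T : R) : set E2 :=
  [set p | [/\ `|p.2 - T| < p.1, p.1 < p.2 + T & a < p.2 < b]].

Let measurable_triangle T : measurable (triangle T).
Proof.
have -> : triangle T = ((fun p : E2 => p.1 - `|p.2 - T| : R') @^-1` `]0, +oo[) `&`
   (((fun p : E2 => p.2 + T - p.1 : R') @^-1` `]0, +oo[) `&` (snd @^-1` `]a, b[)).
  apply/seteqP; split=> -[r y]; rewrite /triangle /= !in_itv/= !andbT !subr_gt0.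
    by case.
  by case=> ? [].
apply: measurableI; [|apply: measurableI]; rewrite -[X in measurable X]setTI.
- have m : measurable_fun setT (fun p : E2 => p.1 - `|p.2 - T| : R').
    apply: measurable_funB => //; apply: (measurableT_comp (@normr_measurable _ _)).
    exact: measurable_funB.
  by apply: m.
- have m : measurable_fun setT (fun p : E2 => p.2 + T - p.1 : R').
    by apply: measurable_funB => //; exact: measurable_funD.
  by apply: m.
- by apply: measurable_snd.
Qed.

(* d'Alembert's formula against sin (z r), with the two integrations exchanged. *)
Lemma integral_clamp_sin (K z T : R) : z != 0 -> 0 <= T ->
  (\int[leb]_(r in `]0%R, +oo[)
      ((clamp (r + T) - clamp `|r - T|) * (K * sin (z * r)))%:E =
   (2 * K * (sin (z * T) / z) * ((cos (z * a) - cos (z * b)) / z))%:E)%E.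
Proof.
move=> z0 T0; pose g (p : E2) : R' := \1_(triangle T) p * (K * sin (z * p.1)).
have ms : measurable_fun setT (fun r : R' => K * sin (z * r) : R').
  apply: measurable_funM => //; apply: continuous_measurable_fun; exact: continuous_sinM.
have mg : measurable_fun setT g.
  apply: measurable_funM; first exact: measurable_indic.
  exact: (measurableT_comp ms measurable_fst).
have ig : leb2.-integrable setT (EFin \o g).
  apply: (@bounded_box_integrable2 _ _ (Num.max `|K| (b + T))) => //.
  - move=> p; rewrite /g indicE le_max; apply/orP; left.
    rewrite !normrM; apply: (@le_trans _ _ (1 * (`|K| * 1))); last by rewrite mul1r mulr1.
    apply: ler_pM => //; first by case: (p \in _); rewrite ?normr1 ?normr0.
    by rewrite ler_wpM2l// ler_norml sin_geN1 sin_le1.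
  - move=> p; rewrite /g indicE; have [|] := boolP (p \in _); last by rewrite mul0r eqxx.
    rewrite inE /triangle /= => -[h1 h2 /andP[h3 h4]] _.
    have p1 := le_lt_trans (normr_ge0 _) h1.
    rewrite (gtr0_norm p1) (gtr0_norm (lt_trans a0 h3)).
    by rewrite !le_max; split; apply/orP; right; lra.
transitivity (\int[leb]_r \int[leb]_y (g (r, y))%:E)%E.
  rewrite integral_mkcond; apply: eq_integral => r _.
  rewrite patchE mem_setE in_itv/= andbT; case: ifPn => [r0|]; last first.
    rewrite -leNgt => r0; rewrite integral0_eq// => y _.
    rewrite /g indicE memNset ?mul0r// /triangle /= => -[h _ _].
    by have := le_lt_trans (normr_ge0 _) h; rewrite ltNge r0.
  pose I : set R' := `](Num.max a `|r - T|), (Num.min b (r + T))[%classic.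
  transitivity (\int[leb]_(y in I) (K * sin (z * r))%:E)%E; last first.
    rewrite [LHS]integral_mkcond; apply: eq_integral => y _.
    have E : (y \in I) = ((r, y) \in triangle T).
      apply/idP/idP; rewrite !inE /I /triangle /= in_itv/= gt_max lt_min.
        move=> /andP[/andP[h1 h2] /andP[h3 h4]].
        split; rewrite ?h1//; [rewrite ltr_norml|]; move: h2; rewrite ltr_norml => /andP[]; lra.
      case=> h1 h2 /andP[h3 h4]; rewrite h3 h4 ltr_norml; move: h1; rewrite ltr_norml => /andP[]; lra.
    by rewrite patchE /g indicE E; case: ifP; rewrite ?mul1r ?mul0r.
  have pq : `|r - T| <= r + T by rewrite ler_norml; lra.
  transitivity ((K * sin (z * r))%:E * leb I)%E; last first.
    by rewrite integral_cst// /I; exact: measurable_itv.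
  rewrite clampE// /I lebesgue_measure_itv/= lte_fin -EFinB.
  case: ifPn => h; first by rewrite -EFinM mulrC; congr (_ * _)%:E; apply/max_idPr; rewrite subr_ge0 ltW.
  rewrite mule0; congr EFin; rewrite (max_idPl _) ?mul0r//.
  by rewrite subr_le0 leNgt.
rewrite (Fubini (m1 := leb) (m2 := leb) ig).
(* For fixed [y] the inner integral is [K (cos (z (y - T)) - cos (z (y + T))) / z = 2 K sin (z T)
   sin (z y) / z]: the wave multiplier factors out. *)
transitivity (\int[leb]_(y in `]a, b[) (2 * K * (sin (z * T) / z) * sin (z * y))%:E)%E.
  rewrite [RHS]integral_mkcond; apply: eq_integral => y _.
  rewrite patchE mem_setE in_itv/=; case: ifPn => [/andP[ay yb]|yab]; last first.
    by rewrite integral0_eq// => r _; rewrite /g indicE memNset ?mul0r// => -[_ _]; exact/negP.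
  have y0 := lt_trans a0 ay.
  transitivity (\int[leb]_(r in `]`|y - T|%R, (y + T)%R[) (K * sin (z * r))%:E)%E.
    rewrite [RHS]integral_mkcond; apply: eq_integral => r _.
    rewrite patchE mem_setE in_itv/= /g indicE; case: ifPn => [/andP[h1 h2]|h].
      by rewrite mem_set ?mul1r//; split=> //=; rewrite ay.
    by rewrite memNset ?mul0r// => -[h1 h2 _]; move/negP: h; apply; apply/andP.
  rewrite integral_sin_itv//; last by rewrite ler_norml; lra.
  congr EFin.
  have -> : cos (z * `|y - T|) = cos (z * (y - T)).
    by case: (ler0P (y - T)) => // _; rewrite mulrN cosN.
  by rewrite mulrBr mulrDr cosB cosD; field.
by rewrite integral_sin_itv.
Qed.

Let cC (z : E3) : R' := 4 * kappa R / norm3 z *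
  ((cos (norm3 z * a) - cos (norm3 z * b)) / norm3 z).

Lemma shell_transform :
  has_transform (fun x : E3 => shell (norm3 x)) cC (fun=> 0).
Proof.
move=> z z0; have n0 := norm3_gt0 z0; have nn : norm3 z != 0 by rewrite gt_eqF.
split; last exact: (integral_sin_radial _ measurable_shell shell_le shell_out).
rewrite (integral_cos_radial measurable_shell shell_le shell_out n0).
transitivity (\int[leb]_(r in `]a, b[) (4 * kappa R / norm3 z * sin (norm3 z * r))%:E)%E.
  rewrite integral_mkcond [RHS]integral_mkcond; apply: eq_integral => r _.
  rewrite !patchE !mem_setE !in_itv/= andbT /shell indicE mem_setE in_itv/=.
  case: (boolP (a < r < b)) => [/andP[h1 h2]|h].
    have r0 := lt_trans a0 h1; rewrite r0; congr EFin.
    by rewrite mul1r mulfV ?mul1r// gt_eqF.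
  by case: ifP => // _; rewrite mul0r mulr0 mul0r mulr0.
exact: integral_sin_itv.
Qed.

Lemma ushell_transform t :
  has_transform (fun x : E3 => ushell t (norm3 x)) (fun z => wave_mult t z * cC z)
    (fun z => wave_mult t z * 0).
Proof.
have uB r : `|ushell t r| <= Num.max 1 (b + `|t|) by rewrite le_max ushell_le1.
move=> z z0; have n0 := norm3_gt0 z0; have nn : norm3 z != 0 by rewrite gt_eqF.
split; last first.
  by rewrite mulr0; exact: (integral_sin_radial _ (measurable_ushell t) uB (ushell_out (t := t))).
rewrite (integral_cos_radial (measurable_ushell t) uB (ushell_out (t := t)) n0).
pose K := 2 * kappa R / norm3 z * Num.sg t.
transitivity (\int[leb]_(r in `]0%R, +oo[)
    ((clamp (r + `|t|) - clamp `|r - `|t| |) * (K * sin (norm3 z * r)))%:E)%E.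
  apply: eq_integral => r; rewrite mem_setE in_itv/= andbT => r0; congr EFin.
  by rewrite /ushell /K; field; rewrite nn gt_eqF.
rewrite integral_clamp_sin//; congr EFin.
have -> : wave_mult t z = Num.sg t * (sin (norm3 z * `|t|) / norm3 z).
  rewrite /wave_mult mulrA [t * _]mulrC; congr (_ / _).
  have [t0|t0|->] := ltrgt0P t; first by rewrite gtr0_sg// mul1r.
    by rewrite ltr0_sg// mulrN sinN mulN1r opprK.
  by rewrite mulr0 sin0 mulr0.
by rewrite /cC /K; ring.
Qed.

(** The difference of cosines is twice a product of two sines. Bounding the sines by their arguments
    cancels the division by [norm3 z ^+ 2], bounding them by 1 gives the decay; the constant is the
    sum of the two bounds. *)
Let cC_decays : decays2 cC.
Proof.
have mn := @measurable_norm3 R.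
have mV : measurable_fun setT (fun z : E3 => (norm3 z)^-1 : R').
  exact: (measurableT_comp measurable_inverse mn).
have mc (k : R) : measurable_fun setT (fun z : E3 => cos (norm3 z * k) : R').
  by apply: measurable_cos_comp; exact: measurable_funM.
split.
  apply: measurable_funM; first exact: measurable_funM.
  by apply: measurable_funM => //; apply: measurable_funB; exact: mc.
have k0 := kappa_ge0 R.
have b0 : 0 <= b by rewrite (le_trans (ltW a0)).
exists (2 * kappa R * (b ^+ 2 - a ^+ 2) + 8 * kappa R) => z.
have d0 : 0 < 1 + norm3 z ^+ 2 by rewrite ltr_pwDl ?sqr_ge0.
rewrite ler_pdivlMr//.
have [n0|nn] := eqVneq (norm3 z) 0.
  rewrite /cC n0 invr0 !mulr0 normr0 mul0r addr_ge0 ?mulr_ge0//.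
  by rewrite subr_ge0 lerXn2r// nnegrE// ltW.
have n0 : 0 < norm3 z by rewrite lt_neqAle eq_sym nn norm3_ge0.
have E : cC z = 8 * kappa R / norm3 z ^+ 2 *
    (sin (norm3 z * ((a + b) / 2)) * sin (norm3 z * ((b - a) / 2))).
  rewrite /cC (_ : norm3 z * a = norm3 z * ((a + b) / 2) - norm3 z * ((b - a) / 2)); last by field.
  rewrite (_ : norm3 z * b = norm3 z * ((a + b) / 2) + norm3 z * ((b - a) / 2)); last by field.
  by rewrite cosB cosD; field.
move: (norm3 z) nn n0 E d0 => n nn n0 -> d0.
have k8 : 0 <= 8 * kappa R / n ^+ 2.
  by apply: divr_ge0; [exact: mulr_ge0|exact: sqr_ge0].
rewrite normrM (ger0_norm k8).
set s := `|_|.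
have s1 : s <= 1 by rewrite /s normrM mulr_ile1// ler_norml sin_geN1 sin_le1.
have s2 : s <= n ^+ 2 * ((b ^+ 2 - a ^+ 2) / 4).
  have -> : n ^+ 2 * ((b ^+ 2 - a ^+ 2) / 4) = (n * ((a + b) / 2)) * (n * ((b - a) / 2)).
    by field.
  rewrite /s normrM ler_pM//; apply: (le_trans (normr_sin_le _)); rewrite ger0_norm// mulr_ge0 ?(ltW n0)//.
    by have := a0; lra.
  by have := ab; lra.
rewrite mulrDr mulr1; apply: lerD.
  have -> : 2 * kappa R * (b ^+ 2 - a ^+ 2) = 8 * kappa R / n ^+ 2 * (n ^+ 2 * ((b ^+ 2 - a ^+ 2) / 4)).
    by field.
  by rewrite ler_wpM2l.
have -> : 8 * kappa R / n ^+ 2 * s * n ^+ 2 = 8 * kappa R * s by field.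
by rewrite -[leRHS]mulr1 ler_wpM2l// mulr_ge0.
Qed.

Lemma wave_pair_shell :
  wave_pair (fun x : E3 => shell (norm3 x)) (fun t x => ushell t (norm3 x)).
Proof.
have d0 : decays2 (fun=> 0 : R').
  by split; [exact: measurable_cst|exists 0 => z; rewrite normr0 mul0r].
exists cC, (fun=> 0); split.
- by split; [exact: bcs_shell|exact: bcs_ushell].
- by split; [exact: cC_decays|exact: d0].
- exact: shell_transform.
- exact: ushell_transform.
Qed.

End Shell.

(** * Test functions for BMO *)

Section IntegralMonotone.
Context d (T : measurableType d) (R : realType) (mu : {measure set T -> \bar R}).
Local Open Scope ereal_scope.

(* Unlike [ge0_le_integral], this asks for no measurability: it applies to
   suprema over uncountable families. *)
Lemma ge0_le_integralW (f g : T -> \bar R) : (forall x, 0 <= f x) ->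
  (forall x, f x <= g x) -> \int[mu]_x f x <= \int[mu]_x g x.
Proof.
move=> f0 fg; have g0 x : 0 <= g x := le_trans (f0 x) (fg x).
rewrite !ge0_integralTE//; apply: ge_ereal_sup => _ [h hf <-].
by apply: ereal_sup_ubound; exists h => // x; exact: le_trans (hf x) (fg x).
Qed.

End IntegralMonotone.

(** * Rational bounds on the heat kernel, uniform in time *)

Section HeatKernel.
Context (R : realType).
Local Notation R' := (measurableTypeR R).
Local Notation E3 := (R' * R' * R')%type.

Definition heat_const : R := (4 * pi) `^ (3 / 2).

Lemma heat_const_gt0 : 0 < heat_const.
Proof. by rewrite powR_gt0// mulr_gt0 ?ltr0n ?pi_gt0. Qed.

(** Writing the time as [s^2] replaces the exponent 3/2 by an integer, after which all estimates are
    identities and inequalities between rational functions. *)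
Lemma heat_kernelE (s : R) (y : E3) : 0 < s ->
  heat_kernel (s ^+ 2) y = (heat_const * s ^+ 3)^-1 * expR (- (norm3 y ^+ 2 / (4 * s ^+ 2))).
Proof.
move=> s0; rewrite /heat_kernel /heat_const powRM ?sqr_ge0//; last first.
  by rewrite mulr_ge0 ?ler0n// pi_ge0.
congr ((_ * _)^-1 * _); rewrite -(powR_mulrn 2 (ltW s0)) -(powR_mulrn 3 (ltW s0)) -powRrM.
by congr (_ `^ _); field.
Qed.

Lemma heat_kernel_ge0 (t : R) (y : E3) : 0 < t -> 0 <= heat_kernel t y.
Proof. by move=> t0; rewrite mulr_ge0 ?expR_ge0// invr_ge0 powR_ge0. Qed.

Lemma measurable_heat_kernel (t : R) : measurable_fun setT (heat_kernel t : E3 -> R').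
Proof.
apply: measurable_funM => //; apply: measurableT_comp => //; apply: measurableT_comp => //.
by apply: measurable_funM => //; apply: measurable_funX; exact: measurable_norm3.
Qed.

(** The inequality [1 + x <= exp x] at [x = u / 2], squared. The square is enough for the mass of
    the kernel; its increments call for the cube, which follows. *)
Lemma expRN_le_sqr (u : R) : 0 <= u -> expR (- u) <= ((1 + u / 2) ^+ 2)^-1.
Proof.
move=> u0; rewrite expRN lef_pV2 ?posrE ?expR_gt0 ?exprn_gt0//; last lra.
have -> : expR u = expR (u / 2) ^+ 2 by rewrite -expRM_natl; congr expR; lra.
by rewrite lerXn2r ?nnegrE ?expR_ge0 ?expR_ge1Dx//; lra.
Qed.

Lemma expRN_le_cube (u : R) : 0 <= u -> expR (- u) <= ((1 + u / 3) ^+ 3)^-1.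
Proof.
move=> u0; rewrite expRN lef_pV2 ?posrE ?expR_gt0 ?exprn_gt0//; last lra.
have -> : expR u = expR (u / 3) ^+ 3 by rewrite -expRM_natl; congr expR; lra.
by rewrite lerXn2r ?nnegrE ?expR_ge0 ?expR_ge1Dx//; lra.
Qed.

(** The squared majorant gives [64 s / heat_const * (8 s^2 + n)^-2] with [n = |y|^2]. Lowering [n]
    to [n / 2] turns the bracket into half of [(4 s)^2 + n], the form with a known integral, at the
    price of a factor 4. *)
Lemma heat_kernel_weight (s : R) (y : E3) : 0 < s ->
  heat_kernel (s ^+ 2) y <= 256 * s / heat_const * (((4 * s) ^+ 2 + norm3 y ^+ 2) ^+ 2)^-1.
Proof.
move=> s0; have c0 := heat_const_gt0; rewrite heat_kernelE//.
have n0 := sqr_ge0 (norm3 y); move: (norm3 y ^+ 2) n0 => n n0.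
have s2 : 0 < s ^+ 2 by rewrite exprn_gt0.
have w0 : 0 <= n / (4 * s ^+ 2) by rewrite divr_ge0// mulr_ge0 ?ler0n// ltW.
apply: (le_trans (ler_wpM2l _ (expRN_le_sqr w0))).
  by rewrite invr_ge0 mulr_ge0 ?exprn_ge0 ?(ltW s0) ?(ltW c0).
have d0 : 0 < (4 * s) ^+ 2 + n by rewrite ltr_wpDr// exprn_gt0// mulr_gt0 ?ltr0n.
have d1 : 0 < 8 * s ^+ 2 + n by rewrite ltr_wpDr// mulr_gt0 ?ltr0n.
have -> : (heat_const * s ^+ 3)^-1 * ((1 + n / (4 * s ^+ 2) / 2) ^+ 2)^-1 =
    64 * s / heat_const * ((8 * s ^+ 2 + n) ^+ 2)^-1.
  by field; rewrite ?expf_neq0 ?gt_eqF//; lra.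
have -> : 256 * s / heat_const * (((4 * s) ^+ 2 + n) ^+ 2)^-1 =
    64 * s / heat_const * (((8 * s ^+ 2 + n / 2)) ^+ 2)^-1.
  by field; rewrite ?expf_neq0 ?gt_eqF//; lra.
rewrite ler_wpM2l//; first by rewrite divr_ge0 ?(ltW c0)// mulr_ge0 ?ler0n// ltW.
rewrite lef_pV2 ?posrE ?exprn_gt0//; last lra.
by rewrite lerXn2r ?nnegrE//; lra.
Qed.

Lemma integral_heat_kernel_le (t : R) : 0 < t ->
  (\int[leb3]_y (heat_kernel t y)%:E <= (64 * kappa R * pi / heat_const)%:E)%E.
Proof.
move=> t0; have [s s0 ->] : exists2 s : R, 0 < s & t = s ^+ 2.
  by exists (Num.sqrt t); rewrite ?sqrtr_gt0// sqr_sqrtr// ltW.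
have c0 := heat_const_gt0.
have k0 : 0 <= 256 * s / heat_const.
  by apply: divr_ge0; [apply: mulr_ge0; [exact: ler0n|exact: ltW]|exact: ltW].
have s4 : 0 < 4 * s by rewrite mulr_gt0 ?ltr0n.
apply: (@le_trans _ _ (\int[leb3]_(y in [set: E3])
    ((256 * s / heat_const)%:E * ((((4 * s) ^+ 2 + norm3 y ^+ 2) ^+ 2)^-1)%:E))%E).
  apply: ge0_le_integralW => y; first by rewrite lee_fin heat_kernel_ge0// exprn_gt0.
  by rewrite -EFinM lee_fin; exact: heat_kernel_weight.
rewrite ge0_integralZl//=; last 2 first.
- by apply/measurable_EFinP; exact: measurable_weight.
- by move=> y _; rewrite lee_fin invr_ge0 sqr_ge0.
rewrite integral_weight// -EFinM lee_fin le_eqVlt; apply/orP; left; apply/eqP.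
by field; rewrite !gt_eqF.
Qed.

Lemma expRN_diff_le (A B w : R) : w <= A -> w <= B ->
  `|expR (- A) - expR (- B)| <= `|A - B| * expR (- w).
Proof.
wlog AB : A B / A <= B.
  move=> H wA wB; have [/H -> //|/ltW/H] := leP A B.
  by rewrite distrC [X in _ <= X * _]distrC; exact.
move=> wA _; rewrite ger0_norm ?subr_ge0 ?ler_expR ?lerN2//.
have e0 := expR_gt0 (- w).
have -> : expR (- B) = expR (- A) * expR (- (B - A)) by rewrite -expRD; congr expR; lra.
have ew : expR (- A) <= expR (- w) by rewrite ler_expR lerN2.
have := expR_ge1Dx (- (B - A)); have := expR_gt0 (- (B - A)); have := expR_gt0 (- A).
rewrite distrC ger0_norm ?subr_ge0//.
move: (expR (- (B - A))) (expR (- A)) (expR (- w)) ew e0 => c a b ew e0 a0 c0 h.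
apply: (@le_trans _ _ (a * (B - A))); first by rewrite -{1}(mulr1 a) -mulrBr ler_wpM2l ?(ltW a0)//; lra.
by rewrite [leRHS]mulrC ler_wpM2r// subr_ge0.
Qed.

(** With [p = |x|], both norms are at least [p / 2], so that both Gaussians are at most [exp (- w)],
    and the exponents differ by at most [rho p / s^2]. After the cubic majorant, where
    [w / 3 = p^2 / (48 s^2)], the time survives only in [s p^5 / (48 s^2 + p^2)^3], which is at most
    1. *)
Lemma heat_kernel_diff_le (t rho : R) (x y : E3) : 0 < t -> 0 < rho ->
  4 * rho <= norm3 x -> norm3 (x - y) <= rho ->
  `|heat_kernel t y - heat_kernel t x| <= 48 ^+ 3 * rho / heat_const / norm3 x ^+ 4.
Proof.
move=> t0 r0; have [s s0 ->] : exists2 s : R, 0 < s & t = s ^+ 2.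
  by exists (Num.sqrt t); rewrite ?sqrtr_gt0// sqr_sqrtr// ltW.
have c0 := heat_const_gt0; rewrite !heat_kernelE// -mulrBr normrM.
have k0 : 0 < (heat_const * s ^+ 3)^-1 by rewrite invr_gt0 mulr_gt0// exprn_gt0.
rewrite (gtr0_norm k0) => xr xy.
have q1 : norm3 y <= norm3 x + rho.
  by have := norm3D (y - x) x; rewrite subrK -(opprB x y) norm3N; lra.
have q2 : norm3 x <= norm3 y + rho by have := norm3D (x - y) y; rewrite subrK; lra.
move: (norm3 x) (norm3 y) xr q1 q2 {xy} => p q pr q1 q2.
have p0 : 0 < p by lra.
have s2 : 0 < s ^+ 2 by rewrite exprn_gt0.
pose w := p ^+ 2 / (16 * s ^+ 2).
have s4 : 0 < 4 * s ^+ 2 by rewrite mulr_gt0 ?ltr0n.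
have wE : w = (p / 2) ^+ 2 / (4 * s ^+ 2) by rewrite /w; field; rewrite gt_eqF.
have w0 : 0 <= w by rewrite divr_ge0 ?sqr_ge0// mulr_ge0 ?ler0n// ltW.
have wle v : p / 2 <= v -> w <= v ^+ 2 / (4 * s ^+ 2).
  by move=> v0; rewrite wE ler_pM2r ?invr_gt0// lerXn2r ?nnegrE; lra.
have h := expRN_diff_le (wle q _) (wle p _).
have AB : `|q ^+ 2 / (4 * s ^+ 2) - p ^+ 2 / (4 * s ^+ 2)| <= rho * p / s ^+ 2.
  rewrite -mulrBl normrM normfV (gtr0_norm s4) ler_pdivrMr//.
  rewrite (_ : _ * (4 * s ^+ 2) = 4 * rho * p); last by field; rewrite gt_eqF.
  rewrite subr_sqr normrM (gtr0_norm (_ : 0 < q + p)); last lra.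
  have : `|q - p| <= rho by rewrite ler_norml; apply/andP; split; lra.
  move=> h1; apply: (@le_trans _ _ (rho * (q + p))); first by rewrite ler_wpM2r//; lra.
  by rewrite -mulrA [4 * _]mulrC -mulrA ler_wpM2l ?(ltW r0)//; lra.
have {}h : `|expR (- (q ^+ 2 / (4 * s ^+ 2))) - expR (- (p ^+ 2 / (4 * s ^+ 2)))| <=
    rho * p / s ^+ 2 * ((1 + w / 3) ^+ 3)^-1.
  apply: (le_trans (h _ _)); [lra|lra|].
  by apply: ler_pM => //; exact: expRN_le_cube.
apply: (le_trans (ler_wpM2l (ltW k0) h)).
have d0 : 0 < 48 * s ^+ 2 + p ^+ 2 by rewrite addr_gt0 ?mulr_gt0 ?ltr0n ?exprn_gt0.
have -> : (heat_const * s ^+ 3)^-1 * (rho * p / s ^+ 2 * ((1 + w / 3) ^+ 3)^-1) =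
    48 ^+ 3 * rho / heat_const / p ^+ 4 * (s * p ^+ 5 / (48 * s ^+ 2 + p ^+ 2) ^+ 3).
  by rewrite /w; field; rewrite ?expf_neq0 ?gt_eqF//; lra.
rewrite ler_piMr//.
  by rewrite divr_ge0 ?exprn_ge0 ?(ltW p0)// divr_ge0 ?(ltW c0)// mulr_ge0 ?exprn_ge0 ?ler0n// ltW.
rewrite ler_pdivrMr ?exprn_gt0// mul1r.
have -> : s * p ^+ 5 = (s * p) * (p ^+ 2) ^+ 2 by ring.
rewrite [(_ + _) ^+ 3]exprS; apply: ler_pM.
- by rewrite mulr_ge0// ltW.
- by rewrite sqr_ge0.
- have := sqr_ge0 (s - p); have := sqr_ge0 s; have := sqr_ge0 p; rewrite !expr2; lra.
- by rewrite lerXn2r ?nnegrE ?sqr_ge0 ?(ltW d0)//; lra.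
Qed.

End HeatKernel.

Section HardyBound.
Context (R : realType).
Local Notation R' := (measurableTypeR R).
Local Notation E3 := (R' * R' * R')%type.
Implicit Types (G : E3 -> R') (x y a : E3).

Lemma mpres_reflect x : mpres leb3 (fun y : E3 => x - y : E3).
Proof.
have := mpres_comp (mpres_leb3_translate x) (mpres_leb3N R).
by congr (mpres _ _); apply/funext => y /=; rewrite addrC.
Qed.

Lemma Rintegral_mpres (phi : E3 -> E3) G : mpres leb3 phi -> measurable_fun setT G ->
  Rintegral leb3 setT (fun y => G (phi y)) = Rintegral leb3 setT G.
Proof.
move=> hphi mG; rewrite /Rintegral.
by rewrite (integral_mpres hphi (f := EFin \o G))//; apply/measurable_EFinP.
Qed.

Lemma bcs_reflect x G : bcs G -> bcs (fun y => G (x - y)).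
Proof.
case=> mG [B hB]; split; first exact: (measurableT_comp mG (mpres_reflect x).1).
exists (B + norm3 x) => y; split.
  by apply: (le_trans (hB _).1); rewrite lerDl norm3_ge0.
move=> h; apply: (hB _).2; have := norm3D (x - y) (- x).
by rewrite addrAC subrr add0r !norm3N; lra.
Qed.

Lemma heat_kernel_bounded (t : R) : 0 < t -> exists2 k : R, 0 < k &
  forall y : E3, `|k * heat_kernel t y| <= 1.
Proof.
move=> t0; have p0 : 0 < (4 * pi * t) `^ (3 / 2).
  by rewrite powR_gt0// !mulr_gt0 ?ltr0n ?pi_gt0.
exists ((4 * pi * t) `^ (3 / 2)) => // y.
rewrite /heat_kernel mulrA divff ?gt_eqF// mul1r ger0_norm ?expR_ge0//.
by rewrite -expR0 ler_expR oppr_le0 divr_ge0 ?sqr_ge0// mulr_ge0 ?ler0n// ltW.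
Qed.

Lemma bcs_heat (t : R) G : 0 < t -> bcs G -> bcs (fun y => heat_kernel t y * G y).
Proof.
move=> t0 bG; have [k k0 hk] := heat_kernel_bounded t0.
have -> : (fun y => heat_kernel t y * G y) =
    (fun y => k^-1 * ((k * heat_kernel t y) * G y)).
  by apply/funext => y; rewrite !mulrA mulVf ?gt_eqF// mul1r.
apply: bcsZ; apply: bcsM => //.
apply: measurable_funM => //; exact: measurable_heat_kernel.
Qed.

Lemma heat_integrable (t : R) : 0 < t -> leb3.-integrable setT (EFin \o (@heat_kernel R t : E3 -> R')).
Proof.
move=> t0; apply/integrableP; split.
  by apply/measurable_EFinP; exact: measurable_heat_kernel.
apply: le_lt_trans (ltry (64 * kappa R * pi / heat_const R)).
apply: le_trans (integral_heat_kernel_le t0); apply: ge0_le_integralW => y //.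
by rewrite /= lee_fin ger0_norm ?heat_kernel_ge0.
Qed.

(* Far from the support of G the cancellation gains a factor 1/|x|, making the
   bound O(|x|^-4) uniformly in t and hence integrable. *)
Lemma heat_potential_le G : bcs G -> Rintegral leb3 setT G = 0 ->
  exists2 C : R, 0 <= C & forall (t : R) x, 0 < t ->
    `|Rintegral leb3 setT (fun y => heat_kernel t y * G (x - y))|
      <= C * ((1 + norm3 x ^+ 2) ^+ 2)^-1.
Proof.
move=> bG G0; have [mG [B' hB']] := bG; pose B : R := B'.
have hB x : `|G x| <= B /\ (B < norm3 x -> G x = 0) := hB' x.
have c0 := heat_const_gt0 R; have [B0 _] := hB 0.
have {}B0 : 0 <= B := le_trans (normr_ge0 _) B0.
pose rho : R := B + 1; pose K := 64 * kappa R * pi / heat_const R.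
have r0 : 0 < rho by rewrite /rho; lra.
have K0 : 0 <= K.
  by rewrite divr_ge0 ?(ltW c0)// mulr_ge0 ?pi_ge0// mulr_ge0 ?kappa_ge0// ler0n.
pose I := Rintegral leb3 setT (fun y => `|G y|).
have I0 : 0 <= I by apply: Rintegral_ge0.
(* [C1] is for [|x| < 4 rho], where the integral is at most [B K]. [C2] is for [|x| >= 4 rho >= 1],
   where [(1 + |x|^2)^2 <= 4 |x|^4] explains the factor 4. *)
pose C1 : R := B * K * (1 + (4 * rho) ^+ 2) ^+ 2.
pose C2 : R := 4 * (48 ^+ 3 * rho / heat_const R * I).
have C10 : 0 <= C1 by rewrite mulr_ge0 ?sqr_ge0// mulr_ge0.
have C20 : 0 <= C2.
  by rewrite mulr_ge0 ?ler0n// mulr_ge0// divr_ge0 ?(ltW c0)// mulr_ge0 ?(ltW r0)//.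
exists (C1 + C2) => [|t x t0]; first exact: addr_ge0.
have bGx := bcs_reflect x bG.
have iK := heat_integrable t0.
have iKG := bcs_integrable (bcs_heat t0 bGx).
have n1 : 0 < 1 + norm3 x ^+ 2 by rewrite ltr_wpDr// sqr_ge0.
have [xr|xr] := leP (4 * rho) (norm3 x); last first.
  apply: (@le_trans _ _ (B * K)); last first.
    rewrite ler_pdivlMr ?exprn_gt0//; apply: (@le_trans _ _ C1); last by rewrite lerDl.
    apply: ler_wpM2l; first exact: mulr_ge0.
    apply: lerXn2r; rewrite ?nnegrE ?(ltW n1) ?addr_ge0 ?sqr_ge0//.
    by rewrite lerD2l lerXn2r ?nnegrE ?norm3_ge0 ?(ltW xr)// mulr_ge0 ?ler0n ?(ltW r0).
  apply: (le_trans (le_normr_Rintegral _ iKG)) => //.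
  apply: (@le_trans _ _ (Rintegral leb3 setT (fun y => B * heat_kernel t y))).
    apply: le_Rintegral => //.
    - exact: (integrable_abse iKG).
    - by have := integrableZl measurableT B iK.
    - move=> y _; rewrite normrM mulrC (ger0_norm (heat_kernel_ge0 y t0)).
      by rewrite ler_wpM2r ?heat_kernel_ge0// (hB _).1.
  rewrite RintegralZl// ler_wpM2l// -lee_fin /Rintegral fineK.
    exact: integral_heat_kernel_le.
  exact: integrable_fin_num.
have x1 : 1 <= norm3 x by move: xr; rewrite /rho; lra.
have p0 : 0 < norm3 x by lra.
apply: (@le_trans _ _ (C2 * ((1 + norm3 x ^+ 2) ^+ 2)^-1)); last first.
  by rewrite ler_wpM2r ?invr_ge0 ?sqr_ge0// lerDr.
pose D := 48 ^+ 3 * rho / heat_const R / norm3 x ^+ 4.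
have -> : Rintegral leb3 setT (fun y => heat_kernel t y * G (x - y)) =
    Rintegral leb3 setT (fun y => heat_kernel t y * G (x - y) - heat_kernel t x * G (x - y)).
  rewrite RintegralB//; last exact: (bcs_integrable (bcsZ _ bGx)).
  rewrite RintegralZl//; last exact: bcs_integrable.
  by rewrite (Rintegral_mpres (mpres_reflect x) mG) G0 mulr0 subr0.
have bd : bcs (fun y => heat_kernel t y * G (x - y) - heat_kernel t x * G (x - y)).
  have := bcsD (bcs_heat t0 bGx) (bcsZ (- heat_kernel t x) bGx).
  by congr bcs; apply/funext => y; rewrite mulNr.
apply: (le_trans (le_normr_Rintegral _ (bcs_integrable bd))) => //.
have iG : leb3.-integrable setT (EFin \o (fun y => `|G y|)).
  exact: (integrable_abse (bcs_integrable bG)).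
have iGx : leb3.-integrable setT (EFin \o (fun y => `|G (x - y)|)).
  exact: (integrable_abse (bcs_integrable bGx)).
apply: (@le_trans _ _ (Rintegral leb3 setT (fun y => D * `|G (x - y)|))).
  apply: le_Rintegral => //.
  - exact: (integrable_abse (bcs_integrable bd)).
  - by have := integrableZl measurableT D iGx.
  - move=> y _; rewrite -mulrBl normrM.
    have [xy|xy] := leP (norm3 (x - y)) rho.
      by rewrite ler_wpM2r//; exact: heat_kernel_diff_le.
    by rewrite (hB _).2 ?normr0 ?mulr0//; move: xy; rewrite /rho; lra.
rewrite RintegralZl// (Rintegral_mpres (mpres_reflect x) (G := fun y => `|G y|)); last first.
  exact: measurableT_comp.
rewrite -/I; pose Q : R := 48 ^+ 3 * rho / heat_const R * I.
have Q0 : 0 <= Q by move: C20; rewrite /C2 -/Q pmulr_rge0 ?ltr0n.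
have -> : D * I = Q * (norm3 x ^+ 4)^-1 by rewrite /D /Q mulrAC.
have -> : C2 * ((1 + norm3 x ^+ 2) ^+ 2)^-1 = Q * (4 * ((1 + norm3 x ^+ 2) ^+ 2)^-1).
  by rewrite /C2 -/Q [RHS]mulrA [Q * 4]mulrC.
apply: ler_wpM2l => //; rewrite ler_pdivlMr ?exprn_gt0// mulrC ler_pdivrMr ?exprn_gt0//.
have -> : 4 * norm3 x ^+ 4 = (2 * norm3 x ^+ 2) ^+ 2 by ring.
have p1 : 1 <= norm3 x ^+ 2 by rewrite exprn_ege1.
by apply: lerXn2r; rewrite ?nnegrE; move: p1; clear; lra.
Qed.

Lemma compact_box3 (B : R) : compact (box3 B : set (R * R * R)).
Proof.
by apply: compact_setX; [apply: compact_setX|]; exact: segment_compact.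
Qed.

(** The heat maximal function is at most [C] times the weight with [a = 1], which has mass
    [kappa * pi]. A translation of [G] only translates this majorant, so that one factor [e]
    normalises all translates. *)
Lemma bcs_bmo_test G : bcs G -> Rintegral leb3 setT G = 0 ->
  exists2 e : R, 0 < e & forall a, bmo_test (fun x => (e * G (x - a))%:C)%C.
Proof.
move=> bG G0; have [C C0 hC] := heat_potential_le bG G0.
have ck : 0 <= C * kappa R * pi by rewrite mulr_ge0 ?pi_ge0// mulr_ge0 ?kappa_ge0.
pose e : R := (1 + C * kappa R * pi)^-1.
have e0 : 0 < e by rewrite invr_gt0; lra.
exists e => // a; have bGa := bcsZ e (bcs_shift a bG).
have [mGa [B' hB']] := bGa; pose B : R := B'.
have hB x : `|e * G (x - a)| <= B /\ (B < norm3 x -> e * G (x - a) = 0) := hB' x.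
have I0 : Rintegral leb3 setT (fun x => e * G (x - a)) = 0.
  rewrite RintegralZl//; last exact: (bcs_integrable (bcs_shift a bG)).
  by rewrite (Rintegral_mpres (mpres_leb3_translate (- a)) bG.1) G0 mulr0.
split.
- by split.
- by exists B => x; rewrite normc_real; exact: (hB x).1.
- exists (box3 B); first exact: compact_box3.
  move=> x nx; rewrite (hB x).2//; have [h1 h2 h3] := norm3_coord x.
  rewrite ltNge; apply/negP => xB; apply: nx; split; [split|]; rewrite /= in_itv/= -ler_norml.
  + exact: le_trans h1 xB.
  + exact: le_trans h2 xB.
  + exact: le_trans h3 xB.
- rewrite /cintegral /= I0; congr (_ +i* _)%C.
  by rewrite /Rintegral integral0.
apply: (@le_trans _ _ (\int[leb3]_(x in [set: E3])
    ((e * C)%:E * (((1 ^+ 2 + norm3 (x - a) ^+ 2) ^+ 2)^-1)%:E))%E).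
  apply: ge0_le_integralW => x.
    apply: le_trans (ereal_sup_ubound _); last by exists 1 => //=; exact: ltr01.
    by rewrite lee_fin; exact: sqrtr_ge0.
  apply: ge_ereal_sup => _ [t t0 <-].
  rewrite -EFinM lee_fin /cintegral.
  have -> : (fun y : E3 => complex.Re ((heat_kernel t y)%:C * (e * G (x - y - a))%:C)%C) =
      (fun y => e * (heat_kernel t y * G (x - a - y))).
    by apply/funext => y; rewrite /= mul0r subr0 mulrCA [x - y - a]addrAC.
  have -> : (fun y : E3 => complex.Im ((heat_kernel t y)%:C * (e * G (x - y - a))%:C)%C) = (fun=> 0).
    by apply/funext => y; rewrite /= mulr0 mul0r addr0.
  rewrite [X in (_ +i* X)%C](_ : _ = 0); last by rewrite /Rintegral integral0.
  have -> (r : R) : (r +i* 0)%C = (r%:C)%C by [].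
  rewrite normc_real RintegralZl//; last exact: (bcs_integrable (bcs_heat t0 (bcs_reflect _ bG))).
  rewrite normrM (gtr0_norm e0) -mulrA expr1n; apply: ler_wpM2l (hC _ _ t0).
  exact: ltW.
rewrite ge0_integralZl//=; last 3 first.
- apply/measurable_EFinP.
  apply: (measurableT_comp (measurable_weight (ltr01 : 0 < (1 : R)))).
  exact: (mpres_leb3_translate (- a)).1.
- by move=> x _; rewrite lee_fin invr_ge0 sqr_ge0.
- by rewrite lee_fin mulr_ge0// ltW.
have -> : (\int[leb3]_x (((1 ^+ 2 + norm3 (x - a)%R ^+ 2) ^+ 2)^-1)%:E = (kappa R * pi / 1)%:E)%E.
  rewrite -(integral_weight (ltr01 : 0 < (1 : R))).
  apply: (integral_mpres (mpres_leb3_translate (- a))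
    (f := fun x : E3 => (((1 ^+ 2 + norm3 x ^+ 2) ^+ 2)^-1)%:E)).
  by apply/measurable_EFinP; exact: measurable_weight.
rewrite -EFinM lee_fin divr1 /e.
have -> : (1 + C * kappa R * pi)^-1 * C * (kappa R * pi) = C * kappa R * pi / (1 + C * kappa R * pi) by ring.
by rewrite ler_pdivrMr ?mul1r; lra.
Qed.

End HardyBound.

(** * An oscillating walk *)

Section Path.
Context (R : realType).

(** The triangular wave of slope 1 or -1 with values in [[0, p]], turning at each multiple of
    [p]. *)
Definition zig (p j : nat) : nat :=
  if odd (j %/ p) then (p - j %% p)%N else (j %% p)%N.

Lemma zig_le p j : (0 < p)%N -> (zig p j <= p)%N.
Proof.
move=> p0; rewrite /zig; case: ifP => _; first exact: leq_subr.
by rewrite ltnW// ltn_pmod.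
Qed.

Lemma zig_succ p j : (0 < p)%N -> `|(zig p j.+1)%:R - (zig p j)%:R : R| <= 1.
Proof.
move=> p0; rewrite /zig; set q := (j %/ p)%N; set r := (j %% p)%N.
have rp : (r < p)%N by rewrite ltn_pmod.
have je : j.+1 = (q * p + r.+1)%N by rewrite addnS -divn_eq.
have [rp1|rp1] := ltnP r.+1 p.
  have -> : (j.+1 %/ p)%N = q by rewrite je divnMDl// divn_small// addn0.
  have -> : (j.+1 %% p)%N = r.+1 by rewrite je modnMDl modn_small.
  by case: ifP => _; rewrite ?natrB ?(ltnW rp) ?(ltnW rp1)// -[r.+1%:R]natr1 ler_norml; lra.
have re : r.+1 = p by apply/eqP; rewrite eqn_leq rp rp1.
have -> : (j.+1 %/ p)%N = q.+1 by rewrite je re divnMDl// divnn p0 addn1.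
have -> : (j.+1 %% p)%N = 0%N by rewrite je re modnMDl modnn.
rewrite /= subn0; have pr : p%:R = r%:R + 1 :> R by rewrite -re natr1.
by case: (odd q) => /=; rewrite ?natrB ?(ltnW rp)// pr ler_norml; lra.
Qed.

Lemma zig_lip p j k : (0 < p)%N ->
  `|(zig p j)%:R - (zig p k)%:R : R| <= `|j%:R - k%:R|.
Proof.
move=> p0; wlog kj : j k / (k <= j)%N.
  by move=> H; have [/H //|/ltnW/H] := leqP k j; rewrite distrC [leRHS]distrC.
rewrite -(subnK kj); elim: (j - k)%N => [|d IH]; first by rewrite add0n !subrr normr0.
rewrite addSn -(subrK (zig p (d + k))%:R (zig p (d + k).+1)%:R) -addrA.
apply: (le_trans (ler_normD _ _)).
apply: (le_trans (lerD (zig_succ _ p0) IH)).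
have -> : (d + k).+1%:R - k%:R = d%:R + 1 :> R by rewrite -natr1 natrD; lra.
have -> : (d + k)%:R - k%:R = d%:R :> R by rewrite natrD; lra.
by have := ler0n R d => ?; rewrite !ger0_norm; lra.
Qed.

Lemma zig_block p j k : (0 < p)%N -> (j %/ p = k %/ p)%N ->
  `|(zig p j)%:R - (zig p k)%:R : R| = `|j%:R - k%:R|.
Proof.
move=> p0 e.
have -> : j%:R = (k %/ p * p)%:R + (j %% p)%:R :> R by rewrite -natrD -e -divn_eq.
have -> : k%:R = (k %/ p * p)%:R + (k %% p)%:R :> R by rewrite -natrD -divn_eq.
rewrite /zig e; have jp := ltn_pmod j p0; have kp := ltn_pmod k p0.
case: ifP => _; last by congr `|_|; ring.
by rewrite !natrB ?(ltnW jp) ?(ltnW kp)// -normrN; congr `|_|; ring.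
Qed.

(** The zigzag of height [256^m] is rescaled to height [16^m], the square root of its half-period:
    each scale has the size that Hoelder exponent 1/2 allows. *)
Definition walk (M j : nat) : R := \sum_(m < M) (zig (256 ^ m) j)%:R / 16 ^+ m.

(** Here [d] stands for [|j - k|]. Scales below [n] are bounded by their height [16^m], scales above
    [n] by their Lipschitz constant [16^-m]; both are geometric with ratio 16, whence the
    denominators 15. *)
Lemma walk_zig_tail (M n : nat) (d : R) : 0 <= d ->
  \sum_(m < M) (if (m < n)%N then 16 ^+ m else if m == n :> nat then 0 else d / 16 ^+ m)
  <= 16 ^+ n / 15 + d / (15 * 16 ^+ n).
Proof.
move=> d0; have p0 (i : nat) : 0 < 16 ^+ i :> R by rewrite exprn_gt0.
have pn (i : nat) : 16 ^+ i != 0 :> R by rewrite gt_eqF.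
(* The induction on [M] needs the exact value of the sum, which changes form once [M] passes [n]. *)
suff H : \sum_(m < M) (if (m < n)%N then 16 ^+ m else if m == n :> nat then 0 else d / 16 ^+ m)
    = (if (M <= n)%N then (16 ^+ M - 1) / 15 else
      (16 ^+ n - 1) / 15 + d / 15 * ((16 ^+ n)^-1 - 16 * (16 ^+ M)^-1)).
  rewrite H; have dn : 0 <= d / (15 * 16 ^+ n) by rewrite divr_ge0// mulr_ge0// ltW.
  case: ifP => Mn.
    have : 16 ^+ M <= 16 ^+ n :> R by rewrite ler_eXn2l// ltr1n.
    lra.
  have -> : d / 15 * ((16 ^+ n)^-1 - 16 * (16 ^+ M)^-1) =
    d / (15 * 16 ^+ n) - d * (16 / 15 / 16 ^+ M) by field; rewrite !pn.
  have : 0 <= d * (16 / 15 / 16 ^+ M) by rewrite mulr_ge0// !divr_ge0// ltW.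
  lra.
elim: M => [|M IH]; first by rewrite big_ord0 expr0 subrr mul0r.
rewrite big_ord_recr/= IH; case: (ltngtP M n) => [Mn|Mn|->].
- by rewrite exprS; lra.
- by rewrite exprS; field; rewrite !pn.
- by rewrite exprS; field; rewrite !pn.
Qed.

Lemma expr256 n : (256 ^ n)%:R = (16 ^+ n) ^+ 2 :> R.
Proof. by rewrite natrX -exprM mulnC exprM; congr (_ ^+ _); rewrite -natrX. Qed.

Lemma walk_diff_tail M n j k : (n < M)%N ->
  `|walk M j - walk M k - ((zig (256 ^ n) j)%:R - (zig (256 ^ n) k)%:R) / 16 ^+ n|
  <= 16 ^+ n / 15 + `|j%:R - k%:R| / (15 * 16 ^+ n).
Proof.
move=> nM; have p0 (i : nat) : 0 < 16 ^+ i :> R by rewrite exprn_gt0.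
pose c (m : 'I_M) : R := ((zig (256 ^ m) j)%:R - (zig (256 ^ m) k)%:R) / 16 ^+ m.
have -> : walk M j - walk M k = \sum_(m < M) c m.
  by rewrite /walk -sumrB; apply: eq_bigr => m _; rewrite /c mulrBl.
rewrite (bigD1 (Ordinal nM))//= [X in X - _]addrC addrK.
apply: (le_trans (ler_norm_sum _ _ _)); rewrite big_mkcond/=.
apply: le_trans (walk_zig_tail M n (normr_ge0 (j%:R - k%:R))).
apply: ler_sum => m _; rewrite -val_eqE/=.
have cm e : `|(zig (256 ^ m) j)%:R - (zig (256 ^ m) k)%:R : R| <= e ->
    `|c m| <= e / 16 ^+ m.
  by rewrite /c normrM normfV (gtr0_norm (p0 m)) ler_pM2r ?invr_gt0.
case: (ltngtP m n) => //= mn; last by apply: cm; apply: zig_lip; rewrite expn_gt0.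
have -> : 16 ^+ m = (256 ^ m)%:R / 16 ^+ m :> R by rewrite expr256 expr2 mulfK// gt_eqF.
apply: cm; have zj := zig_le j (_ : (0 < 256 ^ m)%N); have zk := zig_le k (_ : (0 < 256 ^ m)%N).
rewrite ler_norml; have := zj; rewrite expn_gt0 => /(_ isT); have := zk; rewrite expn_gt0 => /(_ isT).
rewrite -!(ler_nat R) => h1 h2; have := ler0n R (zig (256 ^ m) j); have := ler0n R (zig (256 ^ m) k); lra.
Qed.

(** Take the scale [n] with [256^n <= |j - k| < 256^(n+1)]. With [S = 16^n] and [d = |j - k|] the
    difference is at most [(16/15) S + d / (15 S)], and both terms are at most [16/15] times
    [sqrt d]. *)
Lemma walk_holder M j k : (j < 256 ^ M)%N -> (k < 256 ^ M)%N ->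
  (walk M j - walk M k) ^+ 2 <= 16 * `|j%:R - k%:R|.
Proof.
move=> jM kM; wlog kj : j k jM kM / (k < j)%N.
  move=> H; have [|/H-/(_ kM jM)|->] := ltngtP k j.
  - exact: H.
  - by rewrite distrC -sqrrN opprB.
  - by rewrite !subrr expr0n normr0 mulr0.
have d0 : (0 < j - k)%N by rewrite subn_gt0.
pose n := trunc_log 256 (j - k).
have /andP[n1 n2] : (256 ^ n <= j - k < 256 ^ n.+1)%N by apply: trunc_log_bounds.
have nM : (n < M)%N.
  rewrite -(ltn_exp2l _ _ (isT : (1 < 256)%N)) (leq_ltn_trans n1)//.
  by rewrite (leq_ltn_trans (leq_subr _ _)).
have p0 (i : nat) : 0 < 16 ^+ i :> R by rewrite exprn_gt0.
have h3 := walk_diff_tail j k nM.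
have jk : `|j%:R - k%:R| = (j - k)%:R :> R by rewrite natrB ?(ltnW kj)// ger0_norm// subr_ge0 ler_nat ltnW.
rewrite jk in h3 *.
have zn : `|((zig (256 ^ n) j)%:R - (zig (256 ^ n) k)%:R) / 16 ^+ n| <= 16 ^+ n :> R.
  rewrite normrM normfV (gtr0_norm (p0 n)) ler_pdivrMr// -expr2 -expr256.
  have q0 : (0 < 256 ^ n)%N by rewrite expn_gt0.
  have := zig_le j q0; have := zig_le k q0; rewrite -!(ler_nat R) ler_norml => h1 h2.
  have := ler0n R (zig (256 ^ n) j); have := ler0n R (zig (256 ^ n) k).
  by move: h1 h2; clear; lra.
move: n1 n2; rewrite -(ler_nat R) -(ltr_nat R) !expr256 [16 ^+ n.+1]exprS.
move: (p0 n) zn h3.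
set z := (_ / 16 ^+ n); set x := walk M j - walk M k.
move: ((j - k)%:R : R) (16 ^+ n : R) z x => d S z x S0 zn h3 h1 h2.
have hx : `|x| <= 16 / 15 * S + d / (15 * S).
  rewrite -(subrK z x) (le_trans (ler_normD _ _))//; lra.
have d0' : 0 <= d by rewrite (le_trans _ h1)// sqr_ge0.
rewrite -(real_normK (num_real x)).
have dS : d / (15 * S) * (d / (15 * S)) <= 256 / 225 * d.
  rewrite (_ : _ * _ = d / S ^+ 2 * (d / 225)); last by field; rewrite gt_eqF.
  rewrite (_ : _ * d = 256 * (d / 225)); last by field.
  have e0 : 0 <= d / 225 by rewrite divr_ge0 ?ler0n.
  apply: ler_wpM2r => //; rewrite ler_pdivrMr ?exprn_gt0//.
  by move: h2; rewrite exprMn => /ltW /le_trans; apply; rewrite -natrX.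
have hh : 0 <= d / (15 * S) by rewrite divr_ge0// mulr_ge0// ltW.
move: (d / (15 * S)) dS hh hx => e dS hh hx.
have := normr_ge0 x; move: `|x| hx => y hy y0.
apply: (@le_trans _ _ ((16 / 15 * S + e) ^+ 2)); first by rewrite lerXn2r ?nnegrE//; lra.
have := sqr_ge0 (16 / 15 * S - e); rewrite !expr2 in h1 *; lra.
Qed.

(** Inside a block the zigzag of scale [n] is affine of slope 1 or -1, hence contributes exactly
    [d / S] in absolute value, with [S = 16^n] and [d >= S^2 / 4]. The other scales take away at
    most [S / 15 + d / (15 S)], which leaves [S / 6]. *)
Lemma walk_spread M n j k : (n < M)%N -> (j %/ 256 ^ n = k %/ 256 ^ n)%N ->
  (256 ^ n)%:R <= 4 * `|j%:R - k%:R| :> R ->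
  16 ^+ n / 8 <= `|walk M j - walk M k|.
Proof.
move=> nM e h; have p0 : 0 < 16 ^+ n :> R by rewrite exprn_gt0.
have h3 := walk_diff_tail j k nM; set z := (_ / 16 ^+ n) in h3.
have zE : `|z| = `|j%:R - k%:R| / 16 ^+ n.
  by rewrite /z normrM normfV (gtr0_norm p0) zig_block// expn_gt0.
move: h h3 zE; rewrite expr256; set x := walk M j - walk M k.
move: z x (`|j%:R - k%:R| : R) (16 ^+ n : R) p0 => z x d S S0 h hx zE.
have h1 : `|z| <= `|x| + `|x - z|.
  by rewrite -{1}(subKr x z) (le_trans (ler_normB _ _)).
have h2 : S <= 4 * (d / S) by rewrite mulrA ler_pdivlMr// -expr2.
have eS : d / (15 * S) = d / S / 15 by field; rewrite gt_eqF.
rewrite eS in hx; move: h1 h2.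
rewrite zE; lra.
Qed.

End Path.

(** * Sums over pairs of indices and the energy of the walk *)

Section Sums.
Context (R : realType).

Definition dist (j k : nat) : nat := (j - k + (k - j))%N.

Lemma distE j k : (dist j k)%:R = `|j%:R - k%:R| :> R.
Proof.
rewrite /dist; have [kj|jk] := leqP k j.
  by rewrite (eqP (_ : (k - j)%N == 0%N)) ?subn_eq0// addn0 natrB// ger0_norm// subr_ge0 ler_nat.
have /eqP -> : (j - k)%N == 0%N by rewrite subn_eq0 ltnW.
by rewrite add0n natrB ?(ltnW jk)// distrC ger0_norm// subr_ge0 ler_nat ltnW.
Qed.

(** Each distance occurs at most twice, once on either side of [j]. *)
Lemma sum_dist_le (N j : nat) (h : nat -> R) : (j < N)%N -> (forall d, 0 <= h d) ->
  \sum_(k < N | k != j :> nat) h (dist j k) <= 2 * \sum_(1 <= d < N) h d.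
Proof.
move=> jN h0.
have mono m n : (m <= n)%N -> \sum_(1 <= d < m) h d <= \sum_(1 <= d < n) h d.
  have [m0|m1] := leqP m 1; first by rewrite big_geq// sumr_ge0.
  by move=> mn; rewrite (big_cat_nat (ltnW m1) mn)/= lerDl sumr_ge0.
rewrite -(big_mkord (fun k => k != j) (fun k => h (dist j k))).
rewrite (big_cat_nat (leq0n j) (ltnW jN))/= [X in _ + X]big_ltn_cond// eqxx/=.
rewrite mulr_natl mulr2n; apply: lerD.
  apply: le_trans (mono j.+1 N jN); rewrite big_add1/= big_nat_rev/= add0n.
  rewrite big_nat_cond [leRHS]big_nat_cond.
  rewrite le_eqVlt; apply/orP; left; apply/eqP.
  apply: eq_big => k; first by case: (ltngtP (j - k.+1)%N j) => //; lia.
  move=> /andP[/andP[_ kj] _]; congr h; rewrite /dist; lia.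
apply: le_trans (mono (N - j)%N N (leq_subr _ _)).
rewrite -{1}[j.+1]add1n big_addn.
rewrite big_nat_cond [leRHS]big_nat_cond.
rewrite le_eqVlt; apply/orP; left; apply/eqP.
apply: eq_big => k; first by case: (eqVneq (k + j)%N j) => //; lia.
by move=> _; congr h; rewrite /dist; lia.
Qed.

(** Between [256^M] and [256^(M+1)] there are [255 * 256^M] terms, none larger than [256^-M]. *)
Lemma harmonic_le M : \sum_(1 <= d < 256 ^ M) (d%:R)^-1 <= 255 * M%:R :> R.
Proof.
elim: M => [|M IH]; first by rewrite mulr0 big_geq.
have p0 : (0 < 256 ^ M)%N by rewrite expn_gt0.
have pM : (256 ^ M <= 256 ^ M.+1)%N by rewrite leq_exp2l.
rewrite (big_cat_nat p0 pM)/=.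
rewrite -[M.+1%:R]natr1 mulrDr mulr1 lerD//.
have : \sum_(256 ^ M <= d < 256 ^ M.+1) (d%:R)^-1 <=
    \sum_(256 ^ M <= d < 256 ^ M.+1) ((256 ^ M)%:R)^-1 :> R.
  rewrite big_nat_cond [leRHS]big_nat_cond; apply: ler_sum => d /andP[/andP[h _] _].
  by rewrite lef_pV2 ?posrE ?ltr0n ?ler_nat// (leq_trans p0).
move=> /le_trans; apply; rewrite sumr_const_nat -[leLHS]mulr_natl.
rewrite ler_pdivrMr ?ltr0n// expnS -{2}(mul1n (256 ^ M)%N) -mulnBl natrM; exact: lexx.
Qed.

Lemma sum_inv_sqr_le N : \sum_(1 <= d < N) (d%:R ^+ 2)^-1 <= 2 :> R.
Proof.
have [N1|N1] := leqP N 1; first by rewrite big_geq.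
case: N N1 => [|[|N]]// _.
suff : \sum_(1 <= d < N.+2) (d%:R ^+ 2)^-1 <= 2 - (N.+1%:R)^-1 :> R.
  by move=> h; rewrite (le_trans h)// gerBl invr_ge0.
elim: N => [|N IH]; first by rewrite big_nat1 expr1n !invr1; lra.
rewrite big_nat_recr//= (le_trans (lerD IH (lexx _)))//.
have n0 : 0 < N.+1%:R :> R by rewrite ltr0n.
rewrite -[N.+2%:R]natr1; move: (N.+1%:R : R) n0 => x x0.
rewrite -subr_ge0 (_ : _ - _ = (x * (x + 1) ^+ 2)^-1).
  by rewrite invr_ge0 mulr_ge0 ?sqr_ge0// ltW.
by field; rewrite !gt_eqF//; lra.
Qed.

(** The common block and the lower bound on the distance are the hypotheses of [walk_spread]; the
    upper bound makes the distance determine the scale, the windows from [256^n / 4] to [256^n / 2]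
    being disjoint. *)
Definition near_block (n j k : nat) : bool :=
  [&& j %/ 256 ^ n == k %/ 256 ^ n, 256 ^ n <= 4 * dist j k & 2 * dist j k <= 256 ^ n]%N.

Lemma near_block_inj m n j k : near_block m j k -> near_block n j k -> m = n.
Proof.
wlog mn : m n / (m < n)%N.
  by move=> H hm hn; case: (ltngtP m n) => // h; [exact: H|symmetry; exact: H].
move=> /and3P[_ h1 h2] /and3P[_ h3 h4].
have : (256 ^ m.+1 <= 256 ^ n)%N by rewrite leq_exp2l.
have : (0 < 256 ^ m)%N by rewrite expn_gt0.
rewrite expnS; lia.
Qed.

(** With [p = 256^n / 4], an integer because [n > 0], move from [j] by [p + l] with [l < p], to the
    right if [j] is in the left half of its block and to the left otherwise. This never leaves the
    block and produces [p] indices. *)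
Lemma card_near_block M n j : (n < M)%N -> (j < 256 ^ M)%N -> (0 < n)%N ->
  (256 ^ n <= 4 * #|[set k : 'I_(256 ^ M) | near_block n j k]%SET|)%N.
Proof.
move=> nM jM n0; pose p := (256 ^ n.-1 * 64)%N.
have Pp : (256 ^ n = 4 * p)%N by rewrite /p -{1}(prednK n0) expnS; lia.
have p0 : (0 < p)%N by rewrite /p muln_gt0 expn_gt0.
have [q Mq] : exists q, (256 ^ M = q * 256 ^ n)%N.
  by exists (256 ^ (M - n))%N; rewrite -expnD subnK// ltnW.
pose r := (j %% (4 * p))%N; pose b := (j %/ (4 * p))%N.
have jE : j = (b * (4 * p) + r)%N by rewrite -divn_eq.
have p4 : (0 < 4 * p)%N by rewrite muln_gt0.
have r4 : (r < 4 * p)%N by rewrite ltn_pmod.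
pose f (l : nat) := (if (r < 2 * p) then j + (p + l) else j - (p + l))%N.
have fE l : (l < p)%N -> (f l %/ (4 * p) = b)%N.
  move=> lp; rewrite /f; case: ifP => rp.
    have h : (r + (p + l) < 4 * p)%N by lia.
    by rewrite {1}jE -addnA divnMDl// divn_small// addn0.
  have h : (r - (p + l) < 4 * p)%N by lia.
  have h' : (p + l <= r)%N by lia.
  by rewrite {1}jE -addnBA// divnMDl// divn_small// addn0.
have bq : (b < q)%N by rewrite ltn_divLR// -Pp -Mq.
have fM l : (l < p)%N -> (f l < 256 ^ M)%N.
  by move=> lp; rewrite Mq Pp -ltn_divLR// fE.
have fd l : (l < p)%N -> dist j (f l) = (p + l)%N.
  move=> lp; rewrite /dist /f; case: ifP => rp; first by lia.
  suff : (p + l <= j)%N by lia.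
  by rewrite jE; lia.
rewrite Pp leq_mul2l/=.
pose F (l : 'I_p) : 'I_(256 ^ M) := Ordinal (fM l (ltn_ord l)).
have Finj : injective F.
  move=> l l' /(congr1 val)/= e; apply: val_inj => /=.
  by have := fd l (ltn_ord l); rewrite e fd//; lia.
rewrite -[leqLHS]card_ord -(card_imset _ Finj); apply: subset_leq_card.
apply/fintype.subsetP => k /imsetP[l _ ->]; rewrite inE /near_block/= Pp fE// eqxx/= fd//.
by have := ltn_ord l => ?; apply/andP; split; lia.
Qed.

(** A near pair of scale [n] contributes at least [((16^n / 8) / (256^n / 2))^2 = 1 / (16 * 256^n)],
    and there are at least [256^n / 4] of them: every scale [0 < n < M] gives 1/64. By
    [near_block_inj] no [k] is counted for two scales. *)
Lemma walk_energy M j : (j < 256 ^ M)%N ->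
  M.-1%:R / 64 <= \sum_(k < 256 ^ M | k != j :> nat)
    ((walk R M j - walk R M k) / (dist j k)%:R) ^+ 2 :> R.
Proof.
move=> jM.
have p0 (i : nat) : 0 < 16 ^+ i :> R by rewrite exprn_gt0.
pose a (n : nat) : R := (16 * (256 ^ n)%:R)^-1.
pose c (n k : nat) : R := if (0 < n)%N && near_block n j k then a n else 0.
have ck (k : 'I_(256 ^ M)) : \sum_(n < M) c n k <=
    if k != j :> nat then ((walk R M j - walk R M k) / (dist j k)%:R) ^+ 2 else 0.
  case: (pickP (fun n : 'I_M => (0 < n)%N && near_block n j k)) => [n /andP[n0 hn]|h]; last first.
    by rewrite big1 => [|n _]; [case: ifP => // _; exact: sqr_ge0|rewrite /c h].
  rewrite (bigD1 n)//= big1 => [|m mn]; last first.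
    rewrite /c; case: ifP => // /andP[_ hm]; move: mn.
    by rewrite (val_inj (near_block_inj hm hn)) eqxx.
  rewrite addr0 /c n0 hn/=; case/and3P : hn => /eqP e h1 h2.
  have d0 : (0 < dist j k)%N.
    by rewrite lt0n; apply/eqP => d0; move: h1; rewrite d0 muln0 leqNgt expn_gt0.
  have -> : k != j :> nat by apply: contraTneq d0 => ->; rewrite /dist subnn.
  have h3 : 16 ^+ n / 8 <= `|walk R M j - walk R M k|.
    apply: walk_spread => //; rewrite -distE -natrM ler_nat//.
  have : 0 < (dist j k)%:R :> R by rewrite ltr0n.
  move: h2; rewrite -(ler_nat R) natrM /a expr256 => h2.
  rewrite exprMn -(real_normK (num_real (walk R M j - walk R M k))) exprVn.
  move: (`|_| : R) ((dist j k)%:R : R) (16 ^+ n : R) (p0 n) h2 h3 => y d S S0 h2 h3 d0'.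
  rewrite ler_pdivlMr ?exprn_gt0// mulrC ler_pdivrMr; last by rewrite mulr_gt0// exprn_gt0.
  apply: (@le_trans _ _ ((S ^+ 2 / 2) ^+ 2)).
    by rewrite lerXn2r ?nnegrE ?divr_ge0 ?sqr_ge0 ?(ltW d0')//; lra.
  apply: (@le_trans _ _ ((S / 8) ^+ 2 * (16 * S ^+ 2))).
    by rewrite le_eqVlt; apply/orP; left; apply/eqP; field.
  rewrite ler_wpM2r//; first by rewrite mulr_ge0// sqr_ge0.
  by rewrite lerXn2r ?nnegrE ?divr_ge0 ?(ltW S0)//; lra.
rewrite [leRHS]big_mkcond/=; apply: le_trans (ler_sum _ (fun k _ => ck k)).
rewrite exchange_big/=.
apply: (@le_trans _ _ (\sum_(n < M) if (0 < n)%N then 64^-1 else 0)); last first.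
  apply: ler_sum => n _; rewrite /c; case: ifP => n0; last by rewrite big1.
  rewrite -big_mkcond/= sumr_const -[leRHS]mulr_natr.
  have := card_near_block (ltn_ord n) jM n0; rewrite -(ler_nat R) natrM.
  rewrite /a (eq_card (B := [set k : 'I_(256 ^ M) | near_block n j k]%SET)) => [|k]; last by rewrite inE.
  set m := (#|_|%:R : R); set P := ((256 ^ n)%:R : R) => h.
  have P0 : 0 < P by rewrite ltr0n expn_gt0.
  have P16 : 0 < 16 * P by apply: mulr_gt0 => //; rewrite ltr0n.
  by rewrite mulrC ler_pdivlMr//; move: h; clear; lra.
case: M {jM c ck a} => [|M]; first by rewrite big_ord0 mul0r.
by rewrite big_ord_recl/= add0r sumr_const card_ord mulr_natl.
Qed.

End Sums.

(** * Pulses and the size of their overlaps *)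

Section ShellSlab.
Context (R : realType).
Local Notation R' := (measurableTypeR R).
Local Notation leb := (@lebesgue_measure R).
Local Notation E2 := (R' * R')%type.
Local Notation E3 := (R' * R' * R')%type.

Definition shell_slab (R1 R2 al be : R) (z : E3) : set E3 :=
  [set x | R1 <= norm3 x <= R2 /\ al <= dot3 x z <= be].

Lemma measurable_shell_slab R1 R2 al be z : measurable (shell_slab R1 R2 al be z).
Proof.
have -> : shell_slab R1 R2 al be z =
    ((@norm3 R : E3 -> R') @^-1` (`[R1, R2]%classic : set R')) `&`
    ((fun x : E3 => dot3 x z : R') @^-1` (`[al, be]%classic : set R')).
  by apply/seteqP; split => x /=; rewrite !in_itv/=.
apply: measurableI; rewrite -[X in measurable X]setTI.
  by apply: measurable_norm3 => //; exact: measurable_itv.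
by apply: measurable_dot3 => //; exact: measurable_itv.
Qed.

(** After rotating [z] to the third axis the set is a rectangle in height and radius, of sides
    [(be - al) / |z|] and [R2 - R1], and the density there is at most [2 * kappa * R2]. *)
Lemma leb3_shell_slab_le R1 R2 al be z : 0 <= R1 -> R1 <= R2 -> al <= be ->
  0 < norm3 z ->
  (leb3 (shell_slab R1 R2 al be z) <=
     (2 * kappa R * R2 * (R2 - R1) * (be - al) / norm3 z)%:E)%E.
Proof.
move=> R10 R12 ab z0; have k0 := kappa_ge0 R.
have [rho [mrho nrho drho]] := rotate_to_axis z.
have mA := measurable_shell_slab R1 R2 al be z.
rewrite -(mrho.2 _ mA).
pose C : set R' := `[al / norm3 z, be / norm3 z]%classic.
pose D : set R' := `[R1, R2]%classic.
have mC : measurable C by exact: measurable_itv.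
have mD : measurable D by exact: measurable_itv.
pose h (p : E2) : \bar R := (\1_(C `*` D) p)%:E.
have mh : measurable_fun setT h.
  by apply/measurable_EFinP; apply: measurable_indic; exact: measurableX.
have h0 p : (0 <= h p)%E by rewrite lee_fin indicE ler0n.
have mAr : measurable (rho @^-1` shell_slab R1 R2 al be z).
  by rewrite -[X in measurable X]setTI; exact: mrho.1.
have -> : leb3 (rho @^-1` shell_slab R1 R2 al be z) = (\int[leb3]_x h (x.2, norm3 x))%E.
  rewrite -[LHS]mule1 -[LHS]muleC -integral_cst// integral_mkcond.
  apply: eq_integral => x _; rewrite patchE /h indicE.
  have -> : (((x.2, norm3 x) : E2) \in C `*` D) = (x \in rho @^-1` shell_slab R1 R2 al be z).
    apply/idP/idP; rewrite !inE /C /D /shell_slab /= !in_itv/= nrho drho.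
      by rewrite ler_pdivrMr// ler_pdivlMr// ![x.2 * _]mulrC => -[].
    by rewrite ler_pdivrMr// ler_pdivlMr// ![x.2 * _]mulrC => -[].
  by case: (x \in _).
rewrite integral3_cyl_ge0//.
apply: (@le_trans _ _ (\int[leb]_c ((2 * kappa R * R2 * (R2 - R1)) * \1_C c)%:E)%E).
  apply: ge0_le_integralW => c.
    apply: integral_ge0 => r; rewrite /= in_itv/= andbT => cr.
    by rewrite mule_ge0// lee_fin mulr_ge0 ?mulr_ge0 ?ler0n// ltW// (le_lt_trans _ cr).
  rewrite integral_mkcond/=.
  apply: (@le_trans _ _ (\int[leb]_r ((2 * kappa R * R2 * \1_C c)%:E * (\1_D r)%:E))%E).
    apply: ge0_le_integralW => r.
      rewrite patchE; case: ifPn => //; rewrite inE/= in_itv/= andbT => cr.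
      by rewrite mule_ge0// lee_fin mulr_ge0 ?mulr_ge0 ?ler0n// ltW// (le_lt_trans _ cr).
    have R20 : 0 <= R2 by lra.
    have i0 : 0 <= \1_C c :> R by rewrite indicE ler0n.
    have j0 : 0 <= \1_D r :> R by rewrite indicE ler0n.
    rewrite patchE; case: ifPn => [_|_]; last first.
      by rewrite -EFinM lee_fin !mulr_ge0// ler0n.
    rewrite /h -!EFinM lee_fin.
    have -> : \1_(C `*` D) (c, r) = \1_C c * \1_D r :> R by rewrite !indicE in_setX -natrM mulnb.
    rewrite mulrA; case: (boolP (r \in D)) => [|/negbTE] rD; last first.
      by rewrite [\1_D r]indicE rD !mulr0.
    apply: ler_wpM2r => //; apply: ler_wpM2r => //.
    apply: ler_wpM2l; first by rewrite mulr_ge0 ?ler0n.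
    by move: rD; rewrite inE/= /D/= in_itv/= => /andP[].
  rewrite ge0_integralZl//; last 2 first.
  - by apply/measurable_EFinP; exact: measurable_indic.
  - by rewrite lee_fin !mulr_ge0 ?ler0n//; lra.
  rewrite [X in (_ * X <= _)%E](_ : _ = (R2 - R1)%:E); last first.
    by rewrite integral_indic// setIT; exact: leb_itvcc.
  rewrite -EFinM lee_fin.
  by rewrite mulrAC.
rewrite (eq_integral (fun c => (2 * kappa R * R2 * (R2 - R1))%:E * (\1_C c)%:E))%E; last first.
  by move=> c _; rewrite EFinM.
rewrite ge0_integralZl//; last 2 first.
- by apply/measurable_EFinP; exact: measurable_indic.
- by rewrite lee_fin !mulr_ge0 ?ler0n//; lra.
rewrite [X in (_ * X <= _)%E](_ : _ = (be / norm3 z - al / norm3 z)%:E); last first.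
  by rewrite integral_indic// setIT; apply: leb_itvcc; rewrite ler_pM2r ?invr_gt0.
by rewrite -EFinM lee_fin -mulrBl mulrA.
Qed.

End ShellSlab.

Section Pulse.
Context (R : realType).
Local Notation R' := (measurableTypeR R).
Local Notation leb := (@lebesgue_measure R).
Local Notation E3 := (R' * R' * R')%type.

(* Near the focusing time [s] the wave of this datum equals 1 in a ball around
   the focus; at other times its fronts live where |r - |t - s|| <= 2. *)
Definition pulse (s : R) (x : E3) : R' :=
  2 * shell (s - 1) (s + 1) (norm3 x) + -1 * shell (s - 2) (s + 2) (norm3 x).

Definition upulse (s t : R) (x : E3) : R' :=
  2 * ushell (s - 1) (s + 1) t (norm3 x) + -1 * ushell (s - 2) (s + 2) t (norm3 x).

Lemma wave_pair_pulse (s : R) : 2 < s -> wave_pair (pulse s) (upulse s).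
Proof.
move=> s2; apply: wave_pairD; apply: wave_pairZ; apply: wave_pair_shell; lra.
Qed.

Definition annulus (s : R) : set E3 := [set x | s - 2 <= norm3 x <= s + 2].

(** The pulse is [1 / |x|] within distance 1 of the sphere of radius [s] and [-1 / |x|] between
    distances 1 and 2; there [|x| >= T - 2 >= T / 2]. *)
Lemma pulse_le (s T : R) (x : E3) : 4 <= T -> T <= s ->
  `|pulse s x| <= 2 / T * \1_(annulus s) x.
Proof.
move=> T4 Ts; have eA : (x \in annulus s) = (s - 2 <= norm3 x <= s + 2).
  by apply/idP/idP; rewrite inE.
rewrite /pulse /shell !indicE eA !mem_setE !in_itv/=.
have n0 := norm3_ge0 x; move: (norm3 x) n0 => r r0.
have [/andP[h1 h2]|h] := boolP (s - 2 < r < s + 2); last first.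
  rewrite (_ : (s - 1 < r < s + 1) = false); last first.
    by apply: contraNF h => /andP[h1 h2]; apply/andP; split; lra.
  by rewrite !mul0r !mulr0 addr0 normr0 mulr_ge0 ?divr_ge0 ?ler0n//; lra.
have r1 : 0 < r by lra.
rewrite (ltW h1) (ltW h2)/= mulr1.
have : r^-1 <= 2 / T.
  by rewrite -[r^-1]mul1r ler_pdivrMr// mulrAC ler_pdivlMr; lra.
have : 0 < r^-1 by rewrite invr_gt0.
by case: (s - 1 < r < s + 1) => ? ?; rewrite /= ?mul0r ?mul1r ler_norml; apply/andP; split; lra.
Qed.

Lemma measurable_annulus s : measurable (annulus s).
Proof.
have -> : annulus s = (@norm3 R : E3 -> R') @^-1` (`[s - 2, s + 2]%classic : set R').
  by apply/seteqP; split => x /=; rewrite in_itv/=.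
by rewrite -[X in measurable X]setTI; apply: measurable_norm3 => //; exact: measurable_itv.
Qed.

Definition annulus_at (s : R) (X : E3) : set E3 := (fun x : E3 => x - X) @^-1` annulus s.

Lemma measurable_annulus_at s X : measurable (annulus_at s X).
Proof.
rewrite /annulus_at -[X in measurable X]setTI.
by apply: (mpres_leb3_translate (- X)).1 => //; exact: measurable_annulus.
Qed.

Lemma leb3_annulus_at_le (T s : R) (X : E3) : 4 <= T -> T <= s -> s <= 2 * T ->
  (leb3 (annulus_at s X) <= (144 * kappa R * T ^+ 2)%:E)%E.
Proof.
move=> T4 Ts sT; have k0 := kappa_ge0 R.
rewrite /annulus_at (mpres_leb3_translate (- X)).2; last exact: measurable_annulus.
pose e3 : E3 := ((0, 0), 1).
have e31 : norm3 e3 = 1 by rewrite /norm3 /dot3/= !mulr0 !add0r mulr1 sqrtr1.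
apply: (@le_trans _ _ (leb3 (shell_slab (s - 2) (s + 2) (- (s + 2)) (s + 2) e3))).
  apply: le_measure; rewrite ?inE; [exact: measurable_annulus|exact: measurable_shell_slab|].
  move=> x /andP[h1 h2]; split; first by apply/andP; split.
  have := dot3_le x e3; have := dot3_le (- x) e3; rewrite norm3N e31 mulr1.
  rewrite /dot3/= !mulr0 !mulr1 !add0r => ? ?; apply/andP; split; lra.
have [h1 h2 h3] : [/\ 0 <= s - 2, s - 2 <= s + 2 & - (s + 2) <= s + 2] by split; lra.
have e0 : 0 < norm3 e3 by rewrite e31.
apply: le_trans (leb3_shell_slab_le h1 h2 h3 e0) _.
rewrite e31 lee_fin divr1.
have -> : 2 * kappa R * (s + 2) * (s + 2 - (s - 2)) * (s + 2 - - (s + 2)) =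
  kappa R * (16 * (s + 2) ^+ 2) by ring.
have -> : 144 * kappa R * T ^+ 2 = kappa R * (16 * (3 * T) ^+ 2) by ring.
apply: ler_wpM2l => //; apply: ler_wpM2l; first exact: ler0n.
by apply: lerXn2r; rewrite ?nnegrE; lra.
Qed.

(* On the intersection, |x - X|^2 - |x - Y|^2 is confined to an interval of
   length O(T), so that x lies in a slab orthogonal to Y - X of thickness
   O(T / |Y - X|). *)
Lemma leb3_annulus_atI_le (T s s' : R) (X Y : E3) : 4 <= T ->
  T <= s -> s <= 2 * T -> T <= s' -> s' <= 2 * T -> 0 < norm3 (Y - X) ->
  (leb3 (annulus_at s X `&` annulus_at s' Y) <=
     (384 * kappa R * T ^+ 2 / norm3 (Y - X))%:E)%E.
Proof.
move=> T4 Ts sT Ts' sT' YX; have k0 := kappa_ge0 R.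
set Z := Y - X in YX *; pose n := norm3 Z.
(* By polarisation [(x - X).Z = (|x - X|^2 + |Z|^2 - |x - Y|^2) / 2]; [al] and [be] are the bounds
   that the two annuli impose on it. *)
pose al := ((s - 2) ^+ 2 + n ^+ 2 - (s' + 2) ^+ 2) / 2.
pose be := ((s + 2) ^+ 2 + n ^+ 2 - (s' - 2) ^+ 2) / 2.
have ab : be - al = 4 * (s + s') by rewrite /be /al; field.
have ab0 : al <= be by rewrite -subr_ge0 ab; lra.
have mS := measurable_shell_slab (s - 2) (s + 2) al be Z.
apply: (@le_trans _ _ (leb3 (shell_slab (s - 2) (s + 2) al be Z))).
  rewrite -((mpres_leb3_translate (- X)).2 _ mS); apply: le_measure; rewrite ?inE.
  - by apply: measurableI; exact: measurable_annulus_at.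
  - by rewrite -[X in measurable X]setTI; exact: (mpres_leb3_translate (- X)).1.
  move=> x [/andP[h1 h2] /andP[h3 h4]]; split; first by apply/andP; split.
  have e : dot3 (x - X) Z = (norm3 (x - X) ^+ 2 + n ^+ 2 - norm3 (x - Y) ^+ 2) / 2.
    by rewrite /n !norm3_sqr /Z /dot3/=; field.
  rewrite e /al /be.
  have a1 : (s - 2) ^+ 2 <= norm3 (x - X) ^+ 2 by apply: lerXn2r; rewrite ?nnegrE ?norm3_ge0//; lra.
  have a2 : norm3 (x - X) ^+ 2 <= (s + 2) ^+ 2 by apply: lerXn2r; rewrite ?nnegrE ?norm3_ge0//; lra.
  have a3 : (s' - 2) ^+ 2 <= norm3 (x - Y) ^+ 2 by apply: lerXn2r; rewrite ?nnegrE ?norm3_ge0//; lra.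
  have a4 : norm3 (x - Y) ^+ 2 <= (s' + 2) ^+ 2 by apply: lerXn2r; rewrite ?nnegrE ?norm3_ge0//; lra.
  by apply/andP; split; rewrite ler_pM2r ?invr_gt0 ?ltr0n//; lra.
have [h1 h2] : 0 <= s - 2 /\ s - 2 <= s + 2 by split; lra.
apply: le_trans (leb3_shell_slab_le h1 h2 ab0 YX) _.
rewrite lee_fin ler_pM2r ?invr_gt0// ab.
have -> : 2 * kappa R * (s + 2) * (s + 2 - (s - 2)) * (4 * (s + s')) =
  kappa R * (32 * ((s + 2) * (s + s'))) by ring.
have -> : 384 * kappa R * T ^+ 2 = kappa R * (32 * ((3 * T) * (4 * T))) by ring.
apply: ler_wpM2l => //; apply: ler_wpM2l; first exact: ler0n.
by apply: ler_pM; lra.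
Qed.

Lemma integral_pulseM_le (T s s' : R) (X Y : E3) : 4 <= T -> T <= s -> T <= s' ->
  (\int[leb3]_x `|pulse s (x - X) * pulse s' (x - Y)|%:E <=
    (4 / T ^+ 2)%:E * leb3 (annulus_at s X `&` annulus_at s' Y))%E.
Proof.
move=> T4 Ts Ts'.
have T0 : 0 <= 4 / T ^+ 2 by rewrite divr_ge0 ?ler0n ?sqr_ge0.
have mA : measurable (annulus_at s X `&` annulus_at s' Y).
  by apply: measurableI; exact: measurable_annulus_at.
apply: (@le_trans _ _ (\int[leb3]_x
    ((4 / T ^+ 2)%:E * (\1_(annulus_at s X `&` annulus_at s' Y) x)%:E))%E).
  apply: ge0_le_integralW => x; first by rewrite lee_fin.
  rewrite -EFinM lee_fin normrM.
  apply: (le_trans (ler_pM _ _ (pulse_le _ T4 Ts) (pulse_le _ T4 Ts'))) => //.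
  rewrite le_eqVlt; apply/orP; left; apply/eqP.
  rewrite indicI/= /annulus_at /=.
  have -> (A : set E3) (Z : E3) : \1_((fun x0 : E3 => x0 - Z) @^-1` A) x = \1_A (x - Z) :> R.
    by rewrite !indicE; congr (_%:R); apply/idP/idP; rewrite !inE.
  by rewrite -[(x - X) ]/(x - X); field; lra.
rewrite ge0_integralZl//; last by apply/measurable_EFinP; exact: measurable_indic.
by rewrite integral_indic// setIT.
Qed.

End Pulse.

(** * Wave fronts near a focus *)

Section UPulse.
Context (R : realType).
Local Notation R' := (measurableTypeR R).
Local Notation E3 := (R' * R' * R')%type.

(** The profile of a front: [v] on [[-1, 1]], then back to 0 at [2] and [-2]. A single shell would
    leave a constant on either side of its front; the coefficients 2 and -1 of the pulse cancel
    these constants. *)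
Definition sawtooth (v : R) : R := 2 * clamp (-1) 1 v - clamp (-2) 2 v.

Lemma sawtooth_id v : `|v| <= 1 -> sawtooth v = v.
Proof.
rewrite ler_norml => /andP[h1 h2]; rewrite /sawtooth /clamp.
rewrite (max_idPr h1) (min_idPr h2) max_r ?min_r; lra.
Qed.

Lemma sawtooth_ge v : 2 <= v -> sawtooth v = 0.
Proof. by move=> h; rewrite /sawtooth !clamp_ge; lra. Qed.

Lemma sawtooth_le v : v <= -2 -> sawtooth v = 0.
Proof.
move=> h; rewrite /sawtooth /clamp max_l; last lra.
by rewrite max_l// !min_r; lra.
Qed.

Lemma clamp_if (a b v : R) : a <= b ->
  clamp a b v = if v <= a then a else if v <= b then v else b.
Proof.
move=> ab; rewrite /clamp; have [va|va] := leP v a; first by rewrite (min_idPr ab).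
by have [] := leP v b.
Qed.

Lemma clamp_shift (s h v : R) : 0 <= h ->
  clamp (s - h) (s + h) v = s + clamp (- h) h (v - s).
Proof.
move=> h0; rewrite !clamp_if; [|lra..].
by do ![case: ifPn; rewrite -?ltNge => ?]; lra.
Qed.

Lemma clampN (h v : R) : 0 <= h -> clamp (- h) h (- v) = - clamp (- h) h v.
Proof.
move=> h0; rewrite !clamp_if; [|lra..].
by do ![case: ifPn; rewrite -?ltNge => ?]; lra.
Qed.

(** For [r <= t] the absolute value in d'Alembert's formula opens as [t - r], and oddness of the
    centred clamp turns [t - r - s] into [r - (t - s)]. The two terms are the fronts at signed radii
    [s - t] and [t - s]. *)
Lemma ushellE (s h t r : R) : 0 <= h -> 0 < t -> 0 < r -> r <= t ->
  ushell (s - h) (s + h) t r =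
  (clamp (- h) h (r + (t - s)) + clamp (- h) h (r - (t - s))) / (2 * r).
Proof.
move=> h0 t0 r0 rt; rewrite /ushell gtr0_sg// mul1r (gtr0_norm t0).
have -> : `|r - t| = t - r by rewrite distrC ger0_norm// subr_ge0.
rewrite !clamp_shift// (_ : t - r - s = - (r - (t - s))); last by ring.
by rewrite clampN// addrA; congr (_ / _); rewrite opprD opprK addrACA subrr add0r.
Qed.

Lemma upulseE (s t : R) (x : E3) : 0 < t -> 0 < norm3 x -> norm3 x <= t ->
  upulse s t x = (sawtooth (norm3 x + (t - s)) + sawtooth (norm3 x - (t - s))) / (2 * norm3 x).
Proof.
move=> t0 x0 xt; rewrite /upulse !ushellE ?ler0n// /sawtooth.
move: (clamp _ _ _) (clamp _ _ _) (clamp _ _ _) (clamp _ _ _) => a b c d.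
by field; rewrite gt_eqF.
Qed.

(** Both arguments lie in the linear range of [sawtooth], so that the wave is 1 off the centre; at
    the centre itself division by zero gives 0. *)
Lemma upulse_focus_ge0 (s t : R) (x : E3) : 0 < t -> norm3 x <= t ->
  `|t - s| <= 1 / 4 -> norm3 x <= 3 / 4 -> 0 <= upulse s t x.
Proof.
move=> t0 xt; rewrite ler_norml => /andP[h1 h2] x34.
have := norm3_ge0 x; rewrite le_eqVlt => /predU1P[x0|x0].
  by rewrite /upulse /ushell -x0 !mulr0 !invr0 !mulr0 addr0.
rewrite upulseE// !sawtooth_id ?ler_norml; [|lra|lra].
by rewrite divr_ge0; lra.
Qed.

Lemma upulse_focus_out (s t : R) (x : E3) : 0 < t -> norm3 x <= t ->
  `|t - s| <= 1 / 4 -> 9 / 4 <= norm3 x -> upulse s t x = 0.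
Proof.
move=> t0 xt; rewrite ler_norml => /andP[h1 h2] x94.
by rewrite upulseE ?sawtooth_ge ?addr0 ?mul0r; lra.
Qed.

Lemma upulse_far (s t : R) (x : E3) : 0 < t -> 0 < norm3 x -> norm3 x <= t ->
  2 <= norm3 x + `|t - s| ->
  upulse s t x = sawtooth (norm3 x - `|t - s|) / (2 * norm3 x).
Proof.
move=> t0 x0 xt h; rewrite upulseE//; move: h; case: (ler0P (t - s)) => ts h.
  by rewrite [X in _ + X]sawtooth_ge ?addr0 ?opprK; last lra.
by rewrite [X in X + _]sawtooth_ge ?add0r; last lra.
Qed.

Lemma norm3_sqrE (a b c : R) : norm3 ((a, b), c) ^+ 2 = a ^+ 2 + b ^+ 2 + c ^+ 2.
Proof. by rewrite norm3_sqr /dot3/= !expr2. Qed.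

(** With [e = E / (2 D^2)] one has [D / r = (1 + 2 e)^(-1/2) = 1 - e + (3/2) e^2 - ...]. The
    coefficient 2 instead of 3/2 absorbs the remainder for [|e| <= 1/500], and
    [2 e^2 <= 1 / (2 D^2)] because [|e| <= 1 / (2 D)]. *)
Lemma one_subV_sqrt_ge (D r E : R) : 255 <= D -> 0 <= r -> r ^+ 2 = D ^+ 2 + E ->
  `|E| <= D ->
  [/\ 0 < r, `|r - D| <= 1 & (E - 1) / (2 * D ^+ 2) <= 1 - D / r].
Proof.
move=> D255 r0 q; rewrite ler_norml => /andP[hE1 hE2]; have D0 : 0 < D by lra.
have rD1 : D - 1 <= r.
  rewrite -(ler_sqr (x := D - 1)) ?nnegrE//; last lra.
  by rewrite q sqrrB; lra.
have rD2 : r <= D + 1.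
  rewrite -(ler_sqr (y := D + 1)) ?nnegrE//; last lra.
  by rewrite q sqrrD; have := sqr_ge0 D; lra.
have r1 : 0 < r by lra.
split=> //; first by rewrite ler_norml; apply/andP; split; lra.
have D2 : 0 < D ^+ 2 by rewrite exprn_gt0.
pose e := E / (2 * D ^+ 2).
have eE : r ^+ 2 = D ^+ 2 * (1 + 2 * e) by rewrite q /e; field; rewrite gt_eqF.
have dD : 1 / (2 * D) <= 1 / 500.
  by rewrite !div1r lef_pV2 ?posrE ?mulr_gt0 ?ltr0n//; lra.
have eb : `|e| <= 1 / (2 * D).
  rewrite /e normrM normfV (gtr0_norm (_ : 0 < 2 * D ^+ 2)) ?mulr_gt0 ?ltr0n//.
  rewrite ler_pdivrMr ?mulr_gt0 ?ltr0n//.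
  rewrite (_ : 1 / (2 * D) * _ = D); last by field; rewrite gt_eqF.
  by rewrite ler_norml hE1 hE2.
have e2 : 2 * e ^+ 2 <= 1 / (2 * D ^+ 2).
  have -> : 1 / (2 * D ^+ 2) = 2 * (1 / (2 * D)) ^+ 2 by field; rewrite gt_eqF.
  apply: ler_wpM2l; first exact: ler0n.
  rewrite -(real_normK (num_real e)); apply: lerXn2r => //; rewrite nnegrE.
  by rewrite (le_trans _ eb).
have -> : (E - 1) / (2 * D ^+ 2) = e - 1 / (2 * D ^+ 2) by rewrite /e; field; rewrite gt_eqF.
suff : D / r <= 1 - e + 2 * e ^+ 2 by move: e2; clear; lra.
rewrite ler_pdivrMr// mulrC.
have /andP[e3 e4] : - (1 / 500) <= e <= 1 / 500 by rewrite -ler_norml (le_trans eb).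
clearbody e; move: e3 e4 eE D2 r1 D0; clear => e3 e4 eE D2 r1 D0.
have es := sqr_ge0 e.
have c0 : 0 < 1 - e + 2 * e ^+ 2 by lra.
rewrite -ler_sqr ?nnegrE ?(ltW D0) ?mulr_ge0 ?(ltW c0) ?(ltW r1)// exprMn eE.
rewrite -mulrA ler_peMr ?(ltW D2)//.
have -> : (1 + 2 * e) * (1 - e + 2 * e ^+ 2) ^+ 2 =
  1 + e ^+ 2 * (1 + 6 * e - 4 * e ^+ 2 + 8 * (e * e ^+ 2)) by ring.
rewrite lerDl mulr_ge0//.
have h1 : e ^+ 2 <= 1 / 500.
  have : 0 <= (1 / 500 - e) * (1 / 500 + e) by rewrite mulr_ge0; lra.
  by rewrite expr2; lra.
have h2 : - (1 / 500) * e ^+ 2 <= e * e ^+ 2 by rewrite ler_wpM2r; lra.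
lra.
Qed.

(** The squared distance is [D^2 + E], and [15 om^2 <= D] keeps [|E| <= D]. The gap [om] contributes
    the main term, [x1] and [x2] enter linearly and will integrate to zero over a centred cube, and
    what is lost is [O(1 / D^2)], summable over the fronts. *)
Lemma front_lower (De om x1 x2 x3 : R) (r := norm3 ((De + x1, om + x2), x3))
    (D := `|De|) :
  255 <= D -> 15 * om ^+ 2 <= D -> `|x1| <= 1 / 4 -> `|x2| <= 1 / 4 -> `|x3| <= 1 / 4 ->
  [/\ 0 < r, `|r - D| <= 1 &
   om ^+ 2 / (2 * D ^+ 2) - 1 / D ^+ 2 + De / D ^+ 2 * x1 + om / D ^+ 2 * x2
     <= 1 - D / r].
Proof.
move=> D255 omD h1 h2 h3; have D0 : 0 < D by lra.
pose E := 2 * (De * x1) + x1 ^+ 2 + om ^+ 2 + 2 * (om * x2) + x2 ^+ 2 + x3 ^+ 2.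
have q : r ^+ 2 = D ^+ 2 + E.
  by rewrite /r norm3_sqrE /D real_normK ?num_real//; rewrite /E; ring.
have sq (y : R) : `|y| <= 1 / 4 -> 0 <= y ^+ 2 <= 1 / 16.
  move=> hy; rewrite sqr_ge0 -real_normK ?num_real//=.
  by rewrite (_ : 1 / 16 = (1 / 4) ^+ 2) ?lerXn2r ?nnegrE//; move: hy; clear; lra.
have /andP[p1 q1] := sq _ h1; have /andP[p2 q2] := sq _ h2; have /andP[p3 q3] := sq _ h3.
have Dx1 : `|De * x1| <= D / 4.
  by rewrite normrM -/D ler_wpM2l ?(ltW D0)//; move: h1; clear; lra.
have om2 : `|om * x2| <= D / 120 + 1 / 8.
  have hom : `|om| <= D / 30 + 1 / 2.
    have := sqr_ge0 (`|om| - 1); rewrite -[om ^+ 2](real_normK (num_real om)) in omD.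
    by move: omD; rewrite !expr2; clear; lra.
  rewrite normrM; apply: (le_trans (ler_pM _ _ hom h2)) => //; move: D0; clear; lra.
have o0 := sqr_ge0 om.
have hE : `|E| <= D.
  move: Dx1 om2 D255 omD p1 q1 p2 q2 p3 q3 o0; rewrite /E !ler_norml; clear.
  by move=> /andP[? ?] /andP[? ?] *; apply/andP; split; lra.
have [r1 rD le] := one_subV_sqrt_ge D255 (norm3_ge0 _) q hE; split=> //.
apply: le_trans le; have D2 : 0 < D ^+ 2 by rewrite exprn_gt0.
have -> : om ^+ 2 / (2 * D ^+ 2) - 1 / D ^+ 2 + De / D ^+ 2 * x1 + om / D ^+ 2 * x2 =
  (om ^+ 2 - 2 + 2 * (De * x1) + 2 * (om * x2)) / (2 * D ^+ 2) by field; rewrite gt_eqF.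
rewrite ler_pM2r ?invr_gt0 ?mulr_gt0 ?ltr0n//.
by move: p1 p2 p3; rewrite /E; clear; lra.
Qed.

(** A longitudinal shift by about 3 changes the radius by about 3, outwards or inwards according to
    the sign of [De]. The transverse part [W <= |De| / 5] changes it by only about 1/10, so that a
    gap of 2 remains. *)
Let sqrt_shift_gap (De y W r : R) : 255 <= `|De| -> 11 / 4 <= y -> y <= 13 / 4 ->
  0 <= W -> W <= `|De| / 5 -> 0 <= r -> r ^+ 2 = (De + y) ^+ 2 + W ->
  [/\ 0 < r, r <= `|De| + 5 & 2 <= `|r - `|De| | ].
Proof.
move=> h y1 y2 W0 W1 r0 q; have [De0|De0] := leP 0 De.
  rewrite (ger0_norm De0) in h W1 *.
  have r2 : De + 2 <= r.
    rewrite -(ler_sqr (x := De + 2)) ?nnegrE ?addr_ge0//.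
    apply: (@le_trans _ _ ((De + y) ^+ 2)); last by rewrite q lerDl.
    by apply: lerXn2r; rewrite ?nnegrE; lra.
  have r5 : r <= De + 5.
    rewrite -(ler_sqr (y := De + 5)) ?nnegrE ?addr_ge0// q.
    apply: (@le_trans _ _ ((De + 4) ^+ 2 + De / 5)); last by rewrite !sqrrD; lra.
    by apply: lerD W1; apply: lerXn2r; rewrite ?nnegrE; lra.
  by split; [lra| |rewrite ler_normr; apply/orP; left; lra].
rewrite (ltr0_norm De0) in h W1 *.
have r2 : r <= - De - 2.
  rewrite -(ler_sqr (y := - De - 2)) ?nnegrE//; last lra.
  rewrite q -sqrrN; apply: (@le_trans _ _ ((- De - 11 / 4) ^+ 2 - De / 5)).
    by rewrite -[- (De / 5)]mulNr; apply: lerD => //; apply: lerXn2r; rewrite ?nnegrE; lra.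
  by rewrite !sqrrB; lra.
have rp : 0 < r.
  rewrite lt0r r0 andbT -sqrf_eq0 q gt_eqF//.
  by apply: ltr_pwDl => //; rewrite -sqrrN exprn_gt0//; lra.
by split; [|lra|rewrite ler_normr; apply/orP; right; lra].
Qed.

(** Three units along the axis exceed the half-width 2 of a front by enough to absorb the size 1/4
    of the cube and the transverse displacement. *)
Lemma front_out (De om x1 x2 x3 : R) (r := norm3 ((De + (x1 + 3), om + x2), x3))
    (D := `|De|) :
  255 <= D -> 15 * om ^+ 2 <= D -> `|x1| <= 1 / 4 -> `|x2| <= 1 / 4 -> `|x3| <= 1 / 4 ->
  [/\ 0 < r, r <= D + 5 & sawtooth (r - D) = 0].
Proof.
move=> D255 omD h1 h2 h3; have D0 : 0 < D by lra.
have q : r ^+ 2 = (De + (x1 + 3)) ^+ 2 + ((om + x2) ^+ 2 + x3 ^+ 2).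
  by rewrite /r norm3_sqrE -addrA.
have sq (y : R) : `|y| <= 1 / 4 -> 0 <= y ^+ 2 <= 1 / 16.
  move=> hy; rewrite sqr_ge0 -real_normK ?num_real//=.
  by rewrite (_ : 1 / 16 = (1 / 4) ^+ 2) ?lerXn2r ?nnegrE//; move: hy; clear; lra.
have /andP[p2 q2] := sq _ h2; have /andP[p3 q3] := sq _ h3.
have om2 : (om + x2) ^+ 2 <= 2 * om ^+ 2 + 1 / 8.
  by have := sqr_ge0 (om - x2); rewrite sqrrB sqrrD; move: q2; clear; lra.
have om0 := sqr_ge0 (om + x2).
have /andP[a1 a2] : -(1 / 4) <= x1 <= 1 / 4 by rewrite -ler_norml.
have W0 : 0 <= (om + x2) ^+ 2 + x3 ^+ 2 by rewrite addr_ge0.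
have W1 : (om + x2) ^+ 2 + x3 ^+ 2 <= D / 5.
  by move: om2 omD q3 D255; clear; lra.
have y1 : 11 / 4 <= x1 + 3 by move: a1; clear; lra.
have y2 : x1 + 3 <= 13 / 4 by move: a2; clear; lra.
have [r0 r5 gap] := sqrt_shift_gap D255 y1 y2 W0 W1 (norm3_ge0 _) q; split=> //.
move: gap; rewrite ler_normr => /orP[|gap]; first exact: sawtooth_ge.
by apply: sawtooth_le; rewrite lerNr.
Qed.

End UPulse.

(** * The counterexample *)

Section Configuration.
Context (R : realType) (M : nat).
Local Notation R' := (measurableTypeR R).
Local Notation leb := (@lebesgue_measure R).
Local Notation E3 := (R' * R' * R')%type.
Local Notation N := (256 ^ M)%N.

(** Large enough that, at the times and points considered, every centre is at distance at most [t],
    where the two-front formula holds, and that all initial radii lie between [delay] and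
    [2 * delay]. *)
Definition delay : R := 512 * N%:R.
Definition centre (j : nat) : E3 := ((256 * j%:R, walk R M j), 0).
Definition focus (j : nat) : R := delay + 256 * j%:R.
Definition datum (x : E3) : R' := \sum_(j < N) pulse (focus j) (x - centre j).
Definition wave (t : R) (x : E3) : R' := \sum_(j < N) upulse (focus j) t (x - centre j).

Lemma N_ge1 : 1 <= N%:R :> R.
Proof. by rewrite ler1n expn_gt0. Qed.

Lemma delay_ge4 : 4 <= delay.
Proof. by rewrite /delay; have := N_ge1; lra. Qed.

Lemma focus_ge j : delay <= focus j.
Proof. by rewrite /focus lerDl mulr_ge0 ?ler0n. Qed.

Lemma focus_le j : (j < N)%N -> focus j <= 2 * delay.
Proof.
move=> jN; have : j%:R <= N%:R :> R by rewrite ler_nat ltnW.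
by have := N_ge1; rewrite /focus /delay; lra.
Qed.

Lemma wave_pair_datum : wave_pair datum wave.
Proof.
apply: wave_pair_sum => j; apply: wave_pair_shift; apply: wave_pair_pulse.
by have := focus_ge j; have := delay_ge4; lra.
Qed.

Lemma centre_dist j k : 256 * (dist j k)%:R <= norm3 (centre k - centre j).
Proof.
have [h _ _] := norm3_coord (centre k - centre j); apply: le_trans h.
rewrite /= distE distrC -mulrBr normrM ger0_norm ?ler0n//.
Qed.

(** Expand the square and bound each product by [4 / T^2] times the volume of an intersection of
    annuli, with [T = delay]. The diagonal gives [4 * 144 = 576]; off the diagonal, centres at
    distance at least [256 d] give [4 * 384 / 256 = 6] over [d], and [6 * 2 * 255 = 3060] after the
    harmonic sum. *)
Lemma datum_sqr_le :
  (\int[leb3]_x (datum x ^+ 2)%:E <= (N%:R * (kappa R * (576 + 3060 * M%:R)))%:E)%E.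
Proof.
have k0 := kappa_ge0 R; have T4 := delay_ge4.
have T0 : delay != 0 by rewrite gt_eqF//; lra.
pose c (j k : nat) : R := if k == j then 576 * kappa R else 6 * kappa R * ((dist j k)%:R)^-1.
have mp j : measurable_fun setT (fun x : E3 => pulse (focus j) (x - centre j) : R').
  have f2 : 2 < focus j by have := focus_ge j; move: T4; clear; lra.
  by have [? [? [[h _] _ _ _]]] := wave_pair_shift (centre j) (wave_pair_pulse f2); exact: h.1.
apply: (@le_trans _ _ (\int[leb3]_x \sum_(j < N) \sum_(k < N)
    `|pulse (focus j) (x - centre j) * pulse (focus k) (x - centre k)|%:E)%E).
  apply: ge0_le_integralW => x; first by rewrite lee_fin sqr_ge0.
  rewrite expr2 /datum big_distrlr/=; under [leRHS]eq_bigr do rewrite sumEFin.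
  rewrite sumEFin lee_fin; apply: ler_sum => j _; apply: ler_sum => k _; exact: ler_norm.
pose F j k (x : E3) := (`|pulse (focus j) (x - centre j) * pulse (focus k) (x - centre k)|%:E)%E.
have F0 j k x : (0 <= F j k x)%E by rewrite lee_fin.
have mF j k : measurable_fun setT (F j k).
  by have h := measurable_funM (mp j) (mp k); apply/measurable_EFinP; exact: measurableT_comp.
rewrite ge0_integral_sum; [|by []| |]; last 2 first.
- by move=> j; apply: emeasurable_sum => k; exact: mF.
- by move=> j x _; apply: sume_ge0.
apply: (@le_trans _ _ (\sum_(j < N) \sum_(k < N) (c j k)%:E)%E).
  apply: lee_sum => j _; rewrite ge0_integral_sum; [|by []|by move=> k; exact: mF|by move=> k x _; exact: F0].
  apply: lee_sum => k _; apply: le_trans (integral_pulseM_le _ _ T4 (focus_ge _) (focus_ge _)) _.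
  have s2 : 0 < delay ^+ 2 by rewrite exprn_gt0//; move: T4; clear; lra.
  rewrite /c; case: ifPn => [/eqP ->|kj].
    rewrite setIid; apply: (@le_trans _ _ ((4 / delay ^+ 2)%:E * (144 * kappa R * delay ^+ 2)%:E)%E).
      apply: lee_wpmul2l; first by rewrite lee_fin; apply: divr_ge0; [exact: ler0n|exact: ltW].
      exact: leb3_annulus_at_le T4 (focus_ge _) (focus_le (ltn_ord _)).
    by rewrite -EFinM lee_fin le_eqVlt; apply/orP; left; apply/eqP; field.
  have d0 : 0 < (dist j k)%:R :> R.
    by rewrite ltr0n /dist; move: kj; rewrite neq_ltn => /orP[]; lia.
  have dn := centre_dist j k.
  have n0 : 0 < norm3 (centre k - centre j).
    by apply: lt_le_trans dn; apply: mulr_gt0; [rewrite ltr0n|exact: d0].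
  apply: (@le_trans _ _ ((4 / delay ^+ 2)%:E *
      (384 * kappa R * delay ^+ 2 / norm3 (centre k - centre j))%:E)%E).
    apply: lee_wpmul2l; first by rewrite lee_fin; apply: divr_ge0; [exact: ler0n|exact: ltW].
    by apply: leb3_annulus_atI_le => //; first [exact: focus_ge|apply: focus_le; exact: ltn_ord].
  rewrite -EFinM lee_fin.
  have -> : 4 / delay ^+ 2 * (384 * kappa R * delay ^+ 2 / norm3 (centre k - centre j)) =
    6 * kappa R * (256 / norm3 (centre k - centre j)) by field; rewrite T0 gt_eqF.
  apply: ler_wpM2l; first by rewrite mulr_ge0 ?ler0n.
  by rewrite ler_pdivrMr// [leRHS]mulrC ler_pdivlMr.
under eq_bigr do rewrite sumEFin.
rewrite sumEFin lee_fin.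
apply: (@le_trans _ _ (\sum_(j < N) kappa R * (576 + 3060 * M%:R))).
  apply: ler_sum => j _; rewrite (bigD1 j)//= /c eqxx.
  under eq_bigr => k kj do rewrite ifN//.
  rewrite -mulr_sumr.
  have h := sum_dist_le (h := fun d => (d%:R : R)^-1) (ltn_ord j) (fun d => _).
  have {}h : \sum_(k < N | k != j) ((dist j k)%:R)^-1 <= 2 * (255 * M%:R) :> R.
    apply: (le_trans (h _)); first by move=> d; rewrite invr_ge0 ler0n.
    by apply: ler_wpM2l; [exact: ler0n|exact: harmonic_le].
  have -> : kappa R * (576 + 3060 * M%:R) =
    576 * kappa R + 6 * kappa R * (2 * (255 * M%:R)) by ring.
  by rewrite lerD2l; apply: ler_wpM2l => //; rewrite mulr_ge0 ?ler0n.
by rewrite sumr_const card_ord -[leLHS]mulr_natl.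
Qed.

End Configuration.

(** * The wave near a moving focus, and three units ahead of it *)

Section Cells.
Context (R : realType) (M : nat).
Local Notation R' := (measurableTypeR R).
Local Notation leb := (@lebesgue_measure R).
Local Notation E3 := (R' * R' * R')%type.
Local Notation N := (256 ^ M)%N.
Local Notation centre := (centre R M).
Local Notation focus := (focus R M).
Local Notation wave := (@wave R M).

Variables (j : nat) (de : R).
Hypotheses (jN : (j < N)%N) (hde : `|de| <= 1 / 4).

(* Moves along the first axis at the speed of the fronts. *)
Definition cell : E3 := ((256 * j%:R + de, walk R M j), 0).
Let De (k : nat) : R := 256 * (j%:R - k%:R) + de.
Let om (k : nat) : R := walk R M j - walk R M k.

Let cellE (k : nat) (x1 x2 x3 : R) :
  cell + ((x1, x2), x3) - centre k = ((De k + x1, om k + x2), x3).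
Proof. by rewrite /cell /centre /De /om; congr ((_, _), _); rewrite /=; ring. Qed.

Let focusE (k : nat) : focus j + de - focus k = De k.
Proof. by rewrite /focus /De; ring. Qed.

Let dist_ge1 (k : nat) : k != j -> 1 <= (dist j k)%:R :> R.
Proof. by move=> kj; rewrite ler1n /dist; move: kj; rewrite neq_ltn => /orP[]; lia. Qed.

Let De_bounds (k : nat) : k != j ->
  255 * (dist j k)%:R <= `|De k| /\ `|De k| <= 256 * (dist j k)%:R + 1 / 4.
Proof.
move=> /dist_ge1 d1; have dE : `|256 * (j%:R - k%:R) : R| = 256 * (dist j k)%:R.
  by rewrite normrM distE (ger0_norm (ler0n R 256)).
have := ler_normD (256 * (j%:R - k%:R)) de; have := lerB_normD (256 * (j%:R - k%:R)) de.
by rewrite dE -/(De k) => ? ?; split; move: hde d1; lra.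
Qed.

(** The Hoelder constant of the walk fits the spacing of the centres: [15 * 16 <= 255]. *)
Let om_le (k : nat) : (k < N)%N -> k != j -> 15 * om k ^+ 2 <= `|De k|.
Proof.
move=> kN kj; have [h _] := De_bounds kj; have := walk_holder R jN kN.
by rewrite -distE -/(om k); move: h (dist_ge1 kj); lra.
Qed.

Let De_ge (k : nat) : k != j -> 255 <= `|De k|.
Proof. by move=> kj; have [h _] := De_bounds kj; move: h (dist_ge1 kj); lra. Qed.

Let De_le (k : nat) : (k < N)%N -> k != j -> `|De k| + 5 <= focus j + de.
Proof.
move=> kN kj; have [_ h] := De_bounds kj.
have : (dist j k)%:R + 1 <= N%:R :> R.
  by rewrite natr1 ler_nat /dist; move: jN kN; lia.
have := focus_ge R M j; have := N_ge1 R M; rewrite /delay; have := hde; rewrite ler_norml => /andP[? ?].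
by move: h; lra.
Qed.

Let t_gt0 : 5 <= focus j + de.
Proof.
have := focus_ge R M j; have := N_ge1 R M; rewrite /delay.
by have := hde; rewrite ler_norml => /andP[? ?]; lra.
Qed.

(** The constant term, and below it the linear coefficients, of the sum of the bounds of
    [front_lower], halved because a front has height [(1 - D / r) / 2]. *)
Definition cell_mean : R :=
  \sum_(k < N | k != j :> nat) (om k ^+ 2 / (2 * De k ^+ 2) - 1 / De k ^+ 2) / 2.
Definition cell_slope1 : R := \sum_(k < N | k != j :> nat) De k / De k ^+ 2 / 2.
Definition cell_slope2 : R := \sum_(k < N | k != j :> nat) om k / De k ^+ 2 / 2.

Let far_lower (k : nat) (x1 x2 x3 : R) : (k < N)%N -> k != j ->
  `|x1| <= 1 / 4 -> `|x2| <= 1 / 4 -> `|x3| <= 1 / 4 ->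
  (om k ^+ 2 / (2 * De k ^+ 2) - 1 / De k ^+ 2) / 2 +
    De k / De k ^+ 2 / 2 * x1 + om k / De k ^+ 2 / 2 * x2
  <= upulse (focus k) (focus j + de) (cell + ((x1, x2), x3) - centre k).
Proof.
move=> kN kj h1 h2 h3; rewrite cellE.
have [r0 rD le] := front_lower (De_ge kj) (om_le kN kj) h1 h2 h3.
have D5 := De_le kN kj; have D255 := De_ge kj; have t5 := t_gt0.
have rt : norm3 ((De k + x1, om k + x2), x3) <= focus j + de.
  by move: rD; rewrite ler_norml => /andP[? ?]; lra.
have r2 : 2 <= norm3 ((De k + x1, om k + x2), x3) + `|De k|.
  by apply: ler_wpDl (ltW r0) (le_trans _ D255); rewrite ler_nat.
rewrite upulse_far ?focusE ?(lt_le_trans _ t5) ?ltr0n//.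
rewrite sawtooth_id// -[De k ^+ 2](real_normK (num_real _)).
move: le; set r := norm3 _ in r0 *; have -> : (r - `|De k|) / (2 * r) = (1 - `|De k| / r) / 2.
  by field; rewrite gt_eqF.
lra.
Qed.

(** The focusing pulse [j] is nonnegative here and is bounded below by 0; the other fronts are
    estimated term by term. *)
Lemma wave_cell_ge (x1 x2 x3 : R) :
  `|x1| <= 1 / 4 -> `|x2| <= 1 / 4 -> `|x3| <= 1 / 4 ->
  cell_mean + cell_slope1 * x1 + cell_slope2 * x2
    <= wave (focus j + de) (cell + ((x1, x2), x3)).
Proof.
move=> h1 h2 h3; rewrite /wave (bigD1 (Ordinal jN))//= -[leLHS]add0r; apply: lerD.
  have small : norm3 (cell + ((x1, x2), x3) - centre j) <= 3 / 4.
    have -> : cell + ((x1, x2), x3) - centre j = ((de + x1, x2), x3).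
      by rewrite cellE /De /om !subrr mulr0 !add0r.
    have p34 : 0 <= 3 / 4 :> R by lra.
    rewrite -ler_sqr ?nnegrE ?norm3_ge0 ?p34// norm3_sqrE.
    have sq (y : R) (c : R) : `|y| <= c -> y ^+ 2 <= c ^+ 2.
      by move=> hy; rewrite -(real_normK (num_real y)) lerXn2r ?nnegrE ?(le_trans _ hy).
    have := sq _ _ h2; have := sq _ _ h3; have := sq (de + x1) (1 / 2) _.
    rewrite !expr_div_n !expr1n => a b c.
    have {}a : (de + x1) ^+ 2 <= 1 / 2 ^+ 2.
      by apply: a; apply: (le_trans (ler_normD _ _)); move: hde h1; lra.
    by move: a b c; rewrite !expr2; lra.
  apply: upulse_focus_ge0 => //.
  - by have := t_gt0; lra.
  - by apply: le_trans small _; have := t_gt0; lra.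
  - by rewrite addrAC subrr add0r.
rewrite /cell_mean /cell_slope1 /cell_slope2 !mulr_suml -!big_split/=.
by apply: ler_sum => k kj; apply: far_lower.
Qed.

(** The focusing pulse lives within 9/4 of its centre, while the points are at distance at least
    [3 - 1/4 - 1/4]; all other fronts vanish by [front_out]. *)
Lemma wave_cell_out (x1 x2 x3 : R) :
  `|x1| <= 1 / 4 -> `|x2| <= 1 / 4 -> `|x3| <= 1 / 4 ->
  wave (focus j + de) (cell + ((x1 + 3, x2), x3)) = 0.
Proof.
move=> h1 h2 h3; rewrite /wave big1// => k _; rewrite cellE.
have t5 := t_gt0; have t0 : 0 < focus j + de by lra.
have [kj|kj] := eqVneq (k : nat) j.
  have e : ((De k + (x1 + 3), om k + x2), x3) = ((de + (x1 + 3), x2), x3).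
    by rewrite kj /De /om !subrr mulr0 !add0r.
  rewrite e kj; apply: upulse_focus_out => //.
  - rewrite -ler_sqr ?nnegrE ?norm3_ge0//; last lra.
    rewrite norm3_sqrE; apply: (@le_trans _ _ (5 ^+ 2)); last first.
      by apply: lerXn2r; rewrite ?nnegrE; lra.
    have sq (y : R) (c : R) : `|y| <= c -> y ^+ 2 <= c ^+ 2.
      by move=> hy; rewrite -(real_normK (num_real y)) lerXn2r ?nnegrE ?(le_trans _ hy).
    have := sq _ _ h2; have := sq _ _ h3; have := sq (de + (x1 + 3)) 4 _.
    rewrite !expr_div_n !expr1n => a b c.
    have {}a : (de + (x1 + 3)) ^+ 2 <= 4 ^+ 2.
      apply: a; move: hde h1; rewrite !ler_norml => /andP[? ?] /andP[? ?].
      by apply/andP; split; lra.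
    by move: a b c; rewrite !expr2; lra.
  - by rewrite addrAC subrr add0r.
  - have [h _ _] := norm3_coord ((de + (x1 + 3), x2), x3); apply: le_trans h => /=.
    move: hde h1; rewrite !ler_norml => /andP[? ?] /andP[? ?].
    by rewrite ler_normr; apply/orP; left; lra.
have [r0 r5 g0] := front_out (De_ge kj) (om_le (ltn_ord k) kj) h1 h2 h3.
have D5 := De_le (ltn_ord k) kj; have D255 := De_ge kj.
have rt := le_trans r5 D5.
rewrite upulse_far ?focusE ?g0 ?mul0r//.
by apply: le_trans (_ : _ <= 255) _; [rewrite ler_nat|rewrite ler_wpDl// ltW].
Qed.

(** With [d = dist j k], the bound [|De k| <= 512 d] compares the main term with the energy of the
    walk, whence [1024^2]. The bound [|De k| >= 2 d] makes each error at most [1 / (8 d^2)]; as the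
    inverse squares sum to at most 4, the total loss is 1/2, whatever [M] is. *)
Lemma cell_mean_ge : M.-1%:R / (64 * 1024 ^+ 2) - 1 / 2 <= cell_mean.
Proof.
have e := walk_energy R jN.
have s2 : \sum_(k < N | k != j :> nat) ((dist j k)%:R ^+ 2)^-1 <= 4 :> R.
  have h := sum_dist_le (h := fun d => ((d%:R : R) ^+ 2)^-1) jN (fun d => _).
  apply: (le_trans (h _)) => [d|]; first by rewrite invr_ge0 sqr_ge0.
  by have := sum_inv_sqr_le R N; move: (\sum_(1 <= d < N) _) => S; lra.
suff : \sum_(k < N | k != j :> nat) ((1024 ^+ 2)^-1 * ((walk R M j - walk R M k) / (dist j k)%:R) ^+ 2
    - 8^-1 * ((dist j k)%:R ^+ 2)^-1) <= cell_mean.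
  apply: le_trans; rewrite sumrB -!mulr_sumr; apply: lerB; last by move: s2; lra.
  apply: (@le_trans _ _ ((1024 ^+ 2)^-1 * (M.-1%:R / 64))); last first.
    by apply: ler_wpM2l; [rewrite invr_ge0; exact: sqr_ge0|exact: e].
  by rewrite [leRHS]mulrC -mulrA -invfM.
apply: ler_sum => k kj; have [h1 h2] := De_bounds kj; have d1 := dist_ge1 kj.
rewrite -[De k ^+ 2](real_normK (num_real _)) -/(om k).
move: (`|De k|) ((dist j k)%:R : R) (om k) h1 h2 d1 => D d w h1 h2 d1.
have d0 : 0 < d by lra.
have D0 : 0 < D by lra.
have -> : (w ^+ 2 / (2 * D ^+ 2) - 1 / D ^+ 2) / 2 =
  w ^+ 2 * ((2 * D) ^+ 2)^-1 - 2 * ((2 * D) ^+ 2)^-1 by field; rewrite gt_eqF.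
have -> : 8^-1 * (d ^+ 2)^-1 = 2 * ((4 * d) ^+ 2)^-1 by field; rewrite gt_eqF.
have -> (K : R) : (K ^+ 2)^-1 * (w / d) ^+ 2 = w ^+ 2 * ((K * d) ^+ 2)^-1.
  by rewrite -exprVn -[X in _ = _ * X]exprVn -!exprMn invfM mulrCA.
have D1 : 2 * D <= 1024 * d.
  have -> : 1024 * d = 4 * (256 * d) by rewrite mulrA -natrM.
  have s1 : 1 <= 256 * d by rewrite -[leLHS]mulr1; apply: ler_pM; rewrite ?ler1n.
  by move: (256 * d) h2 s1 => s ? ?; lra.
have D2 : 4 * d <= 2 * D.
  suff : 2 * d <= D by lra.
  by apply: le_trans h1; rewrite ler_wpM2r ?(ltW d0) ?ler_nat.
have inv2 (x y : R) : 0 < x -> x <= y -> (y ^+ 2)^-1 <= (x ^+ 2)^-1.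
  move=> x0 xy; have y0 := lt_le_trans x0 xy.
  rewrite lef_pV2 ?posrE ?exprn_gt0//.
  by apply: lerXn2r => //; rewrite nnegrE ltW.
apply: lerB.
  by apply: ler_wpM2l; [exact: sqr_ge0|apply: inv2 D1; rewrite mulr_gt0 ?ltr0n].
by apply: ler_wpM2l; [exact: ler0n|apply: inv2 D2; rewrite mulr_gt0 ?ltr0n].
Qed.

End Cells.

(** * The test function *)

Section Dipole.
Context (R : realType).
Local Notation R' := (measurableTypeR R).
Local Notation E3 := (R' * R' * R')%type.

(** Half-side 1/4, so that the cube, even displaced by a time lag of 1/4, stays in the ball of
    radius 3/4 where the focusing pulse is nonnegative. *)
Definition cube : set E3 := box3 (1 / 4).
Definition offset : E3 := ((3, 0), 0).
Definition dipole (x : E3) : R' := \1_cube x - \1_cube (x - offset).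

Lemma cube_coord (x : E3) : (x \in cube) =
  [&& `|x.1.1| <= 1 / 4, `|x.1.2| <= 1 / 4 & `|x.2| <= 1 / 4].
Proof.
rewrite !ler_norml; apply/idP/idP; rewrite inE /cube /box3 /=.
  by move=> [[/= + +] +]; rewrite !in_itv/= => -> -> ->.
by move=> /and3P[h1 h2 h3]; split; [split|]; rewrite /= in_itv.
Qed.

Lemma measurable_cube : measurable cube.
Proof. exact: measurable_box3. Qed.

Lemma bcs_cube (f : E3 -> R') : measurable_fun setT f ->
  (forall x, x \in cube -> `|f x| <= 1) -> bcs (fun x => \1_cube x * f x).
Proof.
move=> mf f1; split; first by apply: measurable_funM => //; exact: measurable_indic measurable_cube.
exists 1 => x; rewrite indicE; case: (boolP (x \in cube)) => [xQ|_]; last by rewrite mul0r normr0.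
split; first by rewrite mul1r f1.
move: xQ; rewrite cube_coord => /and3P[h1 h2 h3].
have : norm3 x <= 1.
  case: x {f1 h1 h2 h3} (h1) (h2) (h3) => -[a b] c /= h1 h2 h3.
  rewrite -ler_sqr ?nnegrE ?norm3_ge0// norm3_sqrE.
  have sq (y : R) : `|y| <= 1 / 4 -> y ^+ 2 <= (1 / 4) ^+ 2.
    by move=> hy; rewrite -(real_normK (num_real y)) lerXn2r ?nnegrE ?(le_trans _ hy).
  by have := sq _ h1; have := sq _ h2; have := sq _ h3; rewrite !expr2; lra.
by move=> h1' h2'; exfalso; lra.
Qed.

Lemma cube_shiftF (x : E3) : x \in cube -> (x - offset \in cube) = false.
Proof.
rewrite !cube_coord => /and3P[h1 _ _]; apply/negbTE/negP => /and3P[+ _ _].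
by rewrite /=; move: h1; rewrite !ler_norml => /andP[? ?] /andP[? ?]; lra.
Qed.

Lemma dipole_le (x : E3) : `|dipole x| <= 1.
Proof.
rewrite /dipole !indicE; case: (boolP (x \in cube)) => [/cube_shiftF ->|_].
  by rewrite subr0 normr1.
by rewrite sub0r normrN; case: (_ \in _); rewrite ?normr1 ?normr0.
Qed.

Lemma bcs_indic_cube : bcs (\1_cube : E3 -> R').
Proof.
have := bcs_cube (f := fun=> 1) (measurable_cst _) (fun _ _ => _).
have -> : (fun x : E3 => \1_cube x * 1) = (\1_cube : E3 -> R') by apply/funext => x; rewrite mulr1.
by apply; rewrite normr1.
Qed.

Lemma bcs_dipole : bcs dipole.
Proof.
have := bcsD bcs_indic_cube (bcsZ (-1) (bcs_shift offset bcs_indic_cube)).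
by congr bcs; apply/funext => x; rewrite mulN1r.
Qed.

Lemma integral_dipole : Rintegral leb3 setT dipole = 0.
Proof.
have b := bcs_indic_cube; rewrite /dipole RintegralB//; last 2 first.
- exact: bcs_integrable.
- exact: (bcs_integrable (bcs_shift offset b)).
by rewrite (Rintegral_mpres (mpres_leb3_translate (- offset)) b.1) subrr.
Qed.

Lemma cubeN (x : E3) : (- x \in cube) = (x \in cube).
Proof. by rewrite !cube_coord /= !normrN. Qed.

(** The cube is symmetric about the origin, so the linear terms are odd and drop out; its volume is
    [(1/2)^3 = 1/8]. *)
Lemma integral_affine_cube (A B C : R) :
  bcs (fun x : E3 => \1_cube x * (A + B * x.1.1 + C * x.1.2)) /\
  Rintegral leb3 setT (fun x : E3 => \1_cube x * (A + B * x.1.1 + C * x.1.2)) = A / 8.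
Proof.
have m11 : measurable_fun setT (fun x : E3 => x.1.1 : R').
  exact: (measurableT_comp measurable_fst measurable_fst).
have m12 : measurable_fun setT (fun x : E3 => x.1.2 : R').
  exact: (measurableT_comp measurable_snd measurable_fst).
have b1 : bcs (fun x : E3 => \1_cube x * x.1.1).
  apply: bcs_cube => // x; rewrite cube_coord => /and3P[h _ _]; lra.
have b2 : bcs (fun x : E3 => \1_cube x * x.1.2).
  apply: bcs_cube => // x; rewrite cube_coord => /and3P[_ h _]; lra.
have odd (f : E3 -> R') : bcs (fun x => \1_cube x * f x) -> (forall x, f (- x) = - f x) ->
    Rintegral leb3 setT (fun x => \1_cube x * f x) = 0.
  move=> bf fN; rewrite /Rintegral integral_odd// => x.
  by rewrite !indicE cubeN fN mulrN.
have b0 := bcs_indic_cube.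
have e : (fun x : E3 => \1_cube x * (A + B * x.1.1 + C * x.1.2)) =
    (fun x => A * \1_cube x + (B * (\1_cube x * x.1.1) + C * (\1_cube x * x.1.2))).
  by apply/funext => x; ring.
have bs := bcsD (bcsZ B b1) (bcsZ C b2).
rewrite e; split; first exact: (bcsD (bcsZ A b0) bs).
rewrite RintegralD//; [|exact: (bcs_integrable (bcsZ A b0))|exact: (bcs_integrable bs)].
rewrite RintegralD//; [|exact: (bcs_integrable (bcsZ B b1))|exact: (bcs_integrable (bcsZ C b2))].
rewrite !RintegralZl//; [|exact: (bcs_integrable b2)|exact: (bcs_integrable b1)|exact: (bcs_integrable b0)].
rewrite (odd _ b1)// (odd _ b2)// !mulr0 !addr0; congr (_ * _).
rewrite /Rintegral integral_indic//; last exact: measurable_cube.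
rewrite setIT /cube leb3_box3; last lra.
by rewrite /=; field.
Qed.

End Dipole.

Section CellPairing.
Context (R : realType) (M : nat).
Local Notation R' := (measurableTypeR R).
Local Notation E3 := (R' * R' * R')%type.
Local Notation N := (256 ^ M)%N.
Local Notation focus := (focus R M).
Local Notation wave := (@wave R M).

Lemma bcs_wave (t : R) : bcs (wave t).
Proof. by have [? [? [[_ h] _ _ _]]] := wave_pair_datum R M. Qed.

(** Pointwise comparison of the integrands: the affine minorant on the positive cube, a vanishing
    wave on the negative one, and zero on both sides elsewhere. *)
Lemma pairing_ge (j : nat) (de : R) : (j < N)%N -> `|de| <= 1 / 4 ->
  cell_mean M j de / 8 <=
  Rintegral leb3 setT (fun x => wave (focus j + de) x * dipole (x - cell M j de)).
Proof.
move=> jN hde; set t := focus j + de; set c := cell M j de.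
have [ba <-] := integral_affine_cube (cell_mean M j de) (cell_slope1 M j de) (cell_slope2 M j de).
rewrite -(Rintegral_mpres (mpres_leb3_translate (- c)) ba.1).
have bw : bcs (fun x => dipole (x - c) * wave t x).
  apply: bcsM; [exact: bcs_wave| |by move=> x; exact: dipole_le].
  exact: (bcs_shift c (bcs_dipole R)).1.
apply: le_Rintegral => //.
- exact: (bcs_integrable (bcs_shift c ba)).
- by have := bcs_integrable bw; congr integrable; apply/funext => x /=; rewrite mulrC.
move=> x _; have -> : wave t x = wave t (c + (x - c)) by rewrite addrC subrK.
set y := x - c; rewrite indicE /dipole.
case: (boolP (y \in @cube R)) => yQ.
  rewrite !indicE cube_shiftF// yQ subr0 mulr1 mul1r.
  move: yQ; rewrite cube_coord; case: (y) => -[a b] d /= /and3P[h1 h2 h3].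
  exact: wave_cell_ge.
rewrite !indicE (negbTE yQ) mul0r sub0r.
case: (boolP (y - offset R \in @cube R)) => yQ'; last by rewrite oppr0 mulr0.
move: yQ'; rewrite cube_coord; case: (y) => -[a b] d /= /and3P[h1 h2 h3].
have := wave_cell_out jN hde h1; rewrite !subr0 in h2 h3 => /(_ _ _ h2 h3).
by rewrite subrK => ->; rewrite mul0r.
Qed.

Lemma bmo_norm_wave_ge (e : R) (j : nat) (de : R) : 0 < e ->
  (forall a : E3, bmo_test (fun x => (e * dipole (x - a))%:C)%C) ->
  (j < N)%N -> `|de| <= 1 / 4 ->
  ((e * (M.-1%:R / (64 * 1024 ^+ 2) - 1 / 2) / 8)%:E <=
    bmo_norm (fun x => (wave (focus j + de) x)%:C)%C)%E.
Proof.
move=> e0 he jN hde; have h := pairing_ge jN hde; have hm := cell_mean_ge jN hde.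
set t := focus j + de in h *; set c := cell M j de in h.
have bw : bcs (fun x => dipole (x - c) * wave t x).
  apply: bcsM; [exact: bcs_wave| |by move=> x; exact: dipole_le].
  exact: (bcs_shift c (bcs_dipole R)).1.
apply: le_trans (ereal_sup_ubound _); last by exists (fun x => (e * dipole (x - c))%:C)%C; [exact: he|].
rewrite lee_fin /cintegral.
have -> : (fun x : E3 => complex.Re ((wave t x)%:C * (e * dipole (x - c))%:C)%C) =
    (fun x => e * (wave t x * dipole (x - c))).
  by apply/funext => x; rewrite /= mul0r subr0 mulrCA.
have -> : (fun x : E3 => complex.Im ((wave t x)%:C * (e * dipole (x - c))%:C)%C) = (fun=> 0).
  by apply/funext => x; rewrite /= mulr0 mul0r addr0.
rewrite [X in (_ +i* X)%C](_ : _ = 0); last by rewrite /Rintegral integral0.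
have -> (r : R) : (r +i* 0)%C = (r%:C)%C by [].
rewrite normc_real RintegralZl//; last first.
  by have := bcs_integrable bw; congr integrable; apply/funext => x /=; rewrite mulrC.
rewrite -mulrA; apply: le_trans (ler_norm _); apply: ler_wpM2l; first exact: ltW.
by apply: le_trans h; rewrite ler_pM2r.
Qed.

End CellPairing.

(** * Integration over the focusing times *)

Section TimeIntegral.
Context (R : realType) (M : nat).
Local Notation R' := (measurableTypeR R).
Local Notation leb := (@lebesgue_measure R).
Local Notation N := (256 ^ M)%N.
Local Notation focus := (focus R M).
Local Notation wave := (@wave R M).

(** The intervals of length 1/2 around the foci are disjoint, the foci being 256 apart. The norm is
    compared with a step function by the monotonicity that does not ask whether [t |-> bmo_norm] is
    measurable. *)
Lemma integral_bmo_wave_ge (b : R) : 0 <= b ->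
  (forall j (de : R), (j < N)%N -> `|de| <= 1 / 4 ->
     (b%:E <= bmo_norm (fun x => (wave (focus j + de) x)%:C)%C)%E) ->
  ((N%:R * (b ^+ 2 / 2))%:E <=
    \int[leb]_t (bmo_norm (fun x => (wave t x)%:C)%C ^+ 2))%E.
Proof.
move=> b0 hb; pose I (j : nat) : set R' := `[focus j - 1 / 4, focus j + 1 / 4]%classic.
have mI j : measurable (I j) by exact: measurable_itv.
have memI j (t : R) : (t \in I j) = (`|t - focus j| <= 1 / 4).
  rewrite ler_norml; apply/idP/idP; rewrite inE /I /= in_itv/= => /andP[? ?].
    by apply/andP; split; lra.
  by apply/andP; split; lra.
have injI (t : R) j k : t \in I j -> t \in I k -> j = k.
  rewrite !memI => hj hk; apply/eqP; apply: contraT => jk.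
  have : 1 <= `|j%:R - k%:R : R|.
    by rewrite -distE ler1n /dist; move: jk; rewrite neq_ltn => /orP[]; lia.
  have : `|256 * (j%:R - k%:R) : R| <= 1 / 2.
    have -> : 256 * (j%:R - k%:R) = (t - focus k) - (t - focus j) :> R by rewrite /focus; ring.
    by apply: le_trans (ler_normB _ _) _; lra.
  rewrite normrM (ger0_norm (ler0n R 256)); lra.
apply: (@le_trans _ _ (\int[leb]_t (\sum_(j < N) (b ^+ 2)%:E * (\1_(I j) t)%:E))%E).
  rewrite ge0_integral_sum; [| by [] | |]; last 2 first.
  - move=> j; apply: measurable_funeM; apply/measurable_EFinP.
    exact: measurable_indic.
  - by move=> j t _; rewrite -EFinM lee_fin mulr_ge0 ?sqr_ge0// indicE ler0n.
  rewrite (eq_bigr (fun=> (b ^+ 2 / 2)%:E)) => [|j _]; last first.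
    rewrite ge0_integralZl//; last 2 first.
    - by apply/measurable_EFinP; exact: measurable_indic.
    - by rewrite lee_fin sqr_ge0.
    rewrite [X in (_ * X)%E](_ : _ = (1 / 2)%:E); last first.
      rewrite integral_indic// setIT; transitivity ((focus j + 1 / 4 - (focus j - 1 / 4))%:E : \bar R).
        by apply: leb_itvcc; lra.
      by congr EFin; field.
    by rewrite -EFinM; congr EFin; ring.
  by rewrite sumEFin sumr_const card_ord lee_fin mulr_natl.
apply: ge0_le_integralW => t.
  by apply: sume_ge0 => j _; rewrite -EFinM lee_fin mulr_ge0 ?sqr_ge0// indicE ler0n.
have sq0 (x : \bar R) : (0 <= x ^+ 2)%E.
  by case: x => [x| |]; rewrite expe2 ?mulyy ?mulNyNy ?leey// -EFinM lee_fin -expr2 sqr_ge0.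
case: (pickP (fun j : 'I_N => t \in I j)) => [j tj|h]; last first.
  by rewrite big1 => [|j _]; [exact: sq0|rewrite indicE h mule0].
rewrite (bigD1 j)//= big1 => [|k kj]; last first.
  rewrite indicE (_ : (t \in I k) = false) ?mule0//; apply/negP => tk.
  by move: kj; rewrite (val_inj (injI _ _ _ tk tj)) eqxx.
rewrite adde0 indicE tj mule1 expr2 EFinM.
have := hb j (t - focus j) (ltn_ord j); rewrite -memI => /(_ tj).
rewrite addrC subrK => le; apply: lee_pmul => //; by rewrite lee_fin.
Qed.

End TimeIntegral.

Lemma linear_sqr_gt_linear (R : realType) (a b K : R) : 0 < a -> 0 <= b -> 0 <= K ->
  (* For [x >= v], the second summand of [v] gives [a x - b >= a x / 2], the third gives
     [(a x / 2)^2 >= 2 K x], and the first, 2, gives [2 K x >= K (x + 2)]. *)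
  exists n : nat, 0 <= a * n%:R - b /\ K * (n%:R + 2) < (a * n%:R - b) ^+ 2.
Proof.
move=> a0 b0 K0; pose v := 2 + 2 * b / a + 8 * K / a ^+ 2.
have v1 : 0 <= 2 * b / a by rewrite divr_ge0 ?mulr_ge0 ?ler0n// ltW.
have v2 : 0 <= 8 * K / a ^+ 2 by apply: divr_ge0 (sqr_ge0 _); rewrite mulr_ge0 ?ler0n.
have v0 : 0 <= v by rewrite /v; lra.
exists (Num.bound v); have := archi_boundP v0; move: (_%:R : R) => x vx.
have h1 : 2 * b <= a * x.
  have : 2 * b / a <= x by move: vx; rewrite /v; lra.
  by rewrite ler_pdivrMr// [x * a]mulrC.
have h2 : 8 * K < a ^+ 2 * x.
  have : 8 * K / a ^+ 2 < x by move: vx; rewrite /v; lra.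
  by rewrite ltr_pdivrMr ?exprn_gt0// [x * _]mulrC.
have x2 : 2 < x by move: v1 v2 vx; rewrite /v; clear; lra.
split; first by lra.
apply: (@lt_le_trans _ _ ((a * x / 2) ^+ 2)); last first.
  by apply: lerXn2r; rewrite ?nnegrE; lra.
have h3 : 8 * K * x < a ^+ 2 * x * x by rewrite ltr_pM2r//; lra.
have h4 : 0 <= K * (x - 2) by rewrite mulr_ge0//; lra.
by move: h3 h4; rewrite !expr2; lra.
Qed.

Theorem theorem3 (R : realType) :
  ~ ((forall (f : R * R * R -> R[i]) (u : R -> R * R * R -> R[i]),
        Lp 2%:E f -> wave_flow f u -> L2_bmo u) /\
     (exists c : R,
        forall (f : R * R * R -> R[i]) (u : R -> R * R * R -> R[i]),
          Lp 2%:E f -> wave_flow f u ->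
          ((\int[@lebesgue_measure R]_t (bmo_norm (u t) ^+ 2)) `^ 2^-1
             <= c%:E * Lp_norm 2%:E f)%E)).
Proof.
move=> [_ [c hc]].
have [e e0 he] := bcs_bmo_test (bcs_dipole R) (integral_dipole R).
(* For [M = n + 1] the lower bound on the BMO norm reads [a n - b]. In [K], the factor 2 undoes the
   halving by the length of the time intervals, and 3060 is the constant of the logarithmic term in
   the norm of the datum. *)
pose a : R := e / 8 / (64 * 1024 ^+ 2); pose b := e / 16.
pose K := 2 * c ^+ 2 * (3060 * kappa R).
have a0 : 0 < a by rewrite /a divr_gt0 ?divr_gt0 ?mulr_gt0 ?exprn_gt0 ?ltr0n.
have b0 : 0 <= b by rewrite divr_ge0 ?ler0n// ltW.
have k0 := kappa_ge0 R.
have K0 : 0 <= K.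
  by apply: mulr_ge0; apply: mulr_ge0; rewrite ?sqr_ge0 ?ler0n ?k0.
have [n [bn hn]] := linear_sqr_gt_linear a0 b0 K0.
have wp := wave_pair_datum R n.+1.
have [? [? [[bf _] _ _ _]]] := wp.
have hle := hc _ _ (bcs_Lp2 bf) (wave_pair_flow wp).
pose P : R := (256 ^ n.+1)%:R.
have P0 : 0 < P by rewrite ltr0n expn_gt0.
pose A : R := P * (kappa R * (576 + 3060 * n.+1%:R)).
pose B : R := P * ((a * n%:R - b) ^+ 2 / 2).
have A0 : 0 <= A.
  apply: mulr_ge0 (ltW P0) _; apply: mulr_ge0 k0 _.
  by apply: addr_ge0; [|apply: mulr_ge0]; exact: ler0n.
have B0 : 0 <= B by apply: mulr_ge0 (ltW P0) _; apply: divr_ge0; [exact: sqr_ge0|exact: ler0n].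
have sqrtE (x : R) : 0 <= x -> ((x%:E `^ 2^-1)%E = (Num.sqrt x)%:E).
  by move=> x0; rewrite poweR_EFin powR12_sqrt.
have mono (x y : \bar R) : (0 <= x -> x <= y -> x `^ 2^-1 <= y `^ 2^-1)%E.
  move=> x0 xy; apply: gt0_ler_poweR => //; rewrite ?invr_ge0 ?ler0n// in_itv/= ?leey ?andbT//.
  exact: le_trans x0 xy.
have low : ((Num.sqrt B)%:E <=
    (\int[@lebesgue_measure R]_t (bmo_norm (fun x => (@wave R n.+1 t x)%:C)%C ^+ 2)) `^ 2^-1)%E.
  rewrite -sqrtE//; apply: mono; first by rewrite lee_fin.
  apply: integral_bmo_wave_ge => // j de jN hde.
  apply: le_trans (bmo_norm_wave_ge e0 he jN hde).
  rewrite lee_fin le_eqVlt; apply/orP; left; apply/eqP.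
  by rewrite /a /b /= mulrBr mulrBl; congr (_ - _); [ring|field].
have up : (Lp_norm 2%:E (fun x => (@datum R n.+1 x)%:C)%C <= (Num.sqrt A)%:E)%E.
  rewrite -sqrtE// Lp_norm2E; apply: mono.
    by apply: integral_ge0 => x _; rewrite lee_fin sqr_ge0.
  apply: le_trans (datum_sqr_le R n.+1).
  apply: ge0_le_integralW => x; first by rewrite lee_fin sqr_ge0.
  by rewrite normc_real lee_fin real_normK ?num_real.
(* The sign of [c] is unknown; with [|c|] both sides are nonnegative and may be squared. *)
have : Num.sqrt B <= `|c| * Num.sqrt A.
  rewrite -lee_fin EFinM; apply: (le_trans low); apply: (le_trans hle).
  have L0 : (0 <= Lp_norm 2%:E (fun x => (@datum R n.+1 x)%:C)%C)%E.
    by rewrite Lp_norm2E; exact: poweR_ge0.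
  apply: (@le_trans _ _ (`|c|%:E * Lp_norm 2%:E (fun x => (@datum R n.+1 x)%:C)%C)%E).
    by apply: lee_wpmul2r => //; rewrite lee_fin ler_norm.
  by apply: lee_wpmul2l => //; rewrite lee_fin.
rewrite -ler_sqr ?nnegrE ?sqrtr_ge0 ?mulr_ge0 ?sqrtr_ge0// exprMn !sqr_sqrtr// real_normK ?num_real//.
(* The number [P] of pulses cancels, which leaves a quadratic function of [n] against a linear
   one. *)
rewrite /A /B [c ^+ 2 * (P * _)]mulrCA ler_pM2l// => h.
have c2 : 0 <= c ^+ 2 * kappa R by rewrite mulr_ge0 ?sqr_ge0.
have : c ^+ 2 * (kappa R * (576 + 3060 * n.+1%:R)) <= c ^+ 2 * kappa R * (3060 * (n%:R + 2)).
  rewrite mulrA; apply: ler_wpM2l => //; rewrite -[n.+1%:R]natr1.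
  have : 576 <= 3060 :> R by rewrite ler_nat.
  by move: (576 : R) (3060 : R) (n%:R : R) => p q x; clear; lra.
move: hn h; have -> : K * (n%:R + 2) = 2 * (c ^+ 2 * kappa R * (3060 * (n%:R + 2))).
  by rewrite /K; move: (3060 : R) => q; ring.
move: (a * n%:R - b) (c ^+ 2 * kappa R * _) (c ^+ 2 * (kappa R * _)) => z w w'.
by clear; lra.
Qed.
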